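(* Let $W$ be a random variable in the minimal Kahane--Peyri\`ere regime, and let $\widetilde\mu$ be the dyadic scalar Mandelbrot cascade on $[0,1]$ generated by $W$. Let $\gamma:[0,1]\to\mathbb R^2$ be a fixed nondegenerate $C^2$ embedded arc, and set $\mu_\gamma=\gamma_\#\widetilde\mu$ and $S_\gamma=\{\widetilde\mu([0,1])>0\}$. Then, almost surely on $S_\gamma$, $$\dim_{\mathrm F}(\mu_\gamma)=A_{\mathrm{loc}}(W).$$ Moreover, if $A_{\mathrm{loc}}(W)>0$, then, almost surely on $S_\gamma$, for every $0<\sigma<A_{\mathrm{loc}}(W)$ there are finite random constants $C_\sigma,R_\sigma<\infty$ such that $$|\widehat{\mu_\gamma}(\xi)|\le C_\sigma|\xi|^{-\sigma/2}\qquad(|\xi|\ge R_\sigma,\ \xi\in\mathbb R^2).$$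
   Context: Minimal Kahane--Peyri\`ere regime: $W\ge0$, $\mathbb E W=1$, $\mathbb E[W\log_2^+W]<\infty$ and $\mathbb E[W\log_2W]<1$, where $\log_2^+x=\max\{\log_2x,0\}$ and $0\log_20=0$. Endpoint exponent: $A_{\mathrm{loc}}(W)=\sup_{q>1}\max\{0,\ (q-1-\log_2\mathbb E[W^q])/q\}$, where the $q$-term is interpreted as $0$ whenever $\mathbb E[W^q]=\infty$. Dyadic scalar cascade on $[0,1]$: for $v=(v_1,\dots,v_n)\in\{0,1\}^n$ let $a_v=\sum_{j=1}^nv_j2^{-j}$ and let $I_v=[a_v,a_v+2^{-n})$, except that $I_v=[a_v,1]$ if $v=(1,\dots,1)$, and $I_\varnothing=[0,1]$. Attach i.i.d. copies $W_v$ of $W$ to all nonempty finite binary words $v$; put $Q_v=\prod_{j=1}^nW_{v|j}$, where $v|j=(v_1,\dots,v_j)$, and $Q_\varnothing=1$. Let $d\widetilde\mu_n(t)=\sum_{|v|=n}Q_v\mathbf 1_{I_v}(t)\,dt$. Almost surely $\widetilde\mu_n$ converges weakly to a finite random Borel measure $\widetilde\mu$, the cascade generated by $W$. A fixed nondegenerate $C^2$ embedded arc is a $C^2$ embedding $\gamma:[0,1]\to\mathbb R^2$ (deterministic) with $\inf_{[0,1]}|\gamma'|>0$ and $\inf_{[0,1]}|\det(\gamma',\gamma'')|>0$. For a finite Borel measure $\eta$ on $\mathbb R^2$, $\widehat\eta(\xi)=\int e^{-2\pi ix\cdot\xi}\,d\eta(x)$. For nonzero $\eta$, $\dim_{\mathrm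 F}(\eta)=\sup\{0\le\sigma\le2:\ |\widehat\eta(\xi)|=O(|\xi|^{-\sigma/2})\text{ as }|\xi|\to\infty\}$. *)

(* Defs.v *)
From HB Require Import structures.
From mathcomp Require Import all_boot all_order all_algebra.
From mathcomp Require Import all_classical all_reals all_analysis.
From mathcomp Require Import complex.

Set Implicit Arguments.
Unset Strict Implicit.
Unset Printing Implicit Defensive.

Import Order.TTheory GRing.Theory Num.Theory.
Import numFieldNormedType.Exports.

Local Open Scope classical_set_scope.
Local Open Scope ring_scope.

Section generator.
Context d (T : measurableType d) (R : realType).
Variables (P : probability T R) (W : T -> R).

(* [ln x = 0] for [x <= 0], so that [0 * log2 0 = 0]. *)
Definition log2 (x : R) : R := ln x / ln 2.

Definition log2p (x : R) : R := Num.max (log2 x) 0.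

Definition minimal_Kahane_Peyriere : Prop :=
  [/\ {ae P, forall w, 0 <= W w},
      ('E_P[W] = 1)%E,
      ('E_P[fun w => (W w * log2p (W w))%R] < +oo)%E &
      ('E_P[fun w => (W w * log2 (W w))%R] < 1)%E].

Definition A_loc_term (q : R) : R :=
  let m := ('E_P[fun w => (W w `^ q)%R])%E in
  if (m == +oo)%E then 0 else Num.max 0 ((q - 1 - log2 (fine m)) / q).

(* Since [E[W] = 1], Jensen's inequality bounds every term by [(q - 1) / q],
   so this real-valued supremum is a genuine one. *)
Definition A_loc : R := sup [set A_loc_term q | q in [set q : R | 1 < q]].

End generator.

Section iid.
Context d (T : measurableType d) (R : realType).
Variable P : probability T R.

Definition mutually_independent (I : choiceType) (D : set I)
    (X : I -> {RV P >-> R}) : Prop :=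
  forall (s : seq I) (A : I -> set R), uniq s -> [set` s] `<=` D ->
    (forall i, measurable (A i)) ->
    P (\bigcap_(i in [set` s]) (X i @^-1` A i)) =
    (\prod_(i <- s) P (X i @^-1` A i))%E.

(* The index set is the set of nonempty words; [X [::]] is irrelevant. *)
Definition iid_copies d0 (T0 : measurableType d0) (P0 : probability T0 R)
    (W : {RV P0 >-> R}) (X : seq bool -> {RV P >-> R}) : Prop :=
  (forall v, v != [::] -> forall A, measurable A ->
     distribution P (X v) A = distribution P0 W A) /\
  mutually_independent [set v | v != [::]] X.

End iid.

Section cascade.
Context d (T : measurableType d) (R : realType).
Variable X : seq bool -> T -> R.

Definition cascade_left (v : seq bool) : R :=
  \sum_(j < size v) (nth false v j : nat)%:R / 2 ^+ j.+1.

(* The rightmost interval is closed; for the empty word it is [[0, 1]]. *)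
Definition cascade_itv (v : seq bool) : set R :=
  if all id v then `[cascade_left v, 1]%classic
  else `[cascade_left v, cascade_left v + 2 ^- size v[%classic.

Definition cascade_weight (v : seq bool) (w : T) : R :=
  \prod_(1 <= j < (size v).+1) X (take j v) w.

Definition cascade_density (n : nat) (w : T) (t : R) : R :=
  \sum_(v : n.-tuple bool) cascade_weight v w * \1_(cascade_itv v) t.

(* Seen as a set function on [R], null outside [[0, 1]]; it is a measure for
   every [w] at which all the weights are nonnegative, hence almost surely. *)
Definition cascade_approx (n : nat) (w : T) (A : set R) : \bar R :=
  (\int[lebesgue_measure]_(t in A) (cascade_density n w t)%:E)%E.

End cascade.

Definition weak_cvg (R : realType) (m : nat -> set R -> \bar R)
    (l : set R -> \bar R) : Prop :=
  forall f : R -> R, continuous f -> bounded_fun f ->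
    (\int[m n]_t (f t)%:E)%E @[n --> \oo] --> (\int[l]_t (f t)%:E)%E.

(* [[0, 1]] being closed, the weak limit is carried by [[0, 1]], and testing
   against functions on [R] or on [[0, 1]] is the same. *)
Definition is_cascade d (T : measurableType d) (R : realType)
    (P : probability T R) (X : seq bool -> T -> R) (mu : R.-ftker T ~> R) :
    Prop :=
  {ae P, forall w, weak_cvg (fun n => cascade_approx X n w) (mu w)}.

(* An arc on [[0, 1]] is given by a measurable extension [g] to [R]; the image of
   a measure carried by [[0, 1]] does not depend on the extension. *)
Section image_measure.
Context d d' (T : measurableType d) (T' : measurableType d') (R : realType).
Variables (m : {measure set T -> \bar R}) (g : {mfun T >-> T'}).

Definition image_measure : set T' -> \bar R := pushforward m g.

Let image_measure0 : image_measure set0 = 0%E.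
Proof. exact: measure0. Qed.

Let image_measure_ge0 A : (0 <= image_measure A)%E.
Proof. exact: measure_ge0. Qed.

Let image_measure_sigma_additive : semi_sigma_additive image_measure.
Proof. exact: measure_semi_sigma_additive. Qed.

HB.instance Definition _ := isMeasure.Build _ _ _ image_measure
  image_measure0 image_measure_ge0 image_measure_sigma_additive.

End image_measure.

Section plane.
Context (R : realType).
Implicit Types x y xi : R * R.

Definition dot2 x y : R := x.1 * y.1 + x.2 * y.2.

(* The norm [`|x|] of [R * R] is the max norm. *)
Definition norm2 x : R := Num.sqrt (x.1 ^+ 2 + x.2 ^+ 2).

Definition det2 x y : R := x.1 * y.2 - x.2 * y.1.

(* Derivative of the restriction to [[0, 1]], hence one-sided at 0 and 1. *)
Definition derivative_on01 (g g' : R -> R * R) : Prop :=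
  forall t, t \in `[0, 1] ->
    ((s - t)^-1 *: (g s - g t)) @[s --> within `[0, 1]%classic t^'] --> g' t.

(* Only the restriction of [g] to [[0, 1]] matters. By compactness, an injective
   immersion of [[0, 1]] is an embedding. On [[0, 1]], [g'] and [g''] are
   determined by [g]. *)
Definition nondegenerate_C2_arc (g : R -> R * R) : Prop :=
  exists g' g'' : R -> R * R,
    [/\ derivative_on01 g g', derivative_on01 g' g'' &
        {within `[0, 1], continuous g''}] /\
    [/\ set_inj `[0, 1]%classic g,
        0 < inf [set norm2 (g' t) | t in `[0, 1]] &
        0 < inf [set `|det2 (g' t) (g'' t)| | t in `[0, 1]]].

(* Real and imaginary parts of the integral of [exp (- 2 pi i x.xi)]. *)
Definition fourier (eta : {measure set (R * R)%type -> \bar R}) xi : R[i] :=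
  Complex (\int[eta]_x cos (2 * pi * dot2 x xi))
          (- \int[eta]_x sin (2 * pi * dot2 x xi)).

Definition fourier_decay (eta : {measure set (R * R)%type -> \bar R}) (s : R) :
    Prop :=
  exists C r : R, forall xi, r <= norm2 xi ->
    Normc.normc (fourier eta xi) <= C * norm2 xi `^ (- (s / 2)).

Definition fourier_dim (eta : {measure set (R * R)%type -> \bar R}) : R :=
  sup [set s : R | 0 <= s <= 2 /\ fourier_decay eta s].

End plane.

(* Main.v *)
(** Lower bound.  Conditionally on the first n levels, the (n+1)-st level mass of a bounded
    test coefficient is a sum of independent centred terms, and q > 1 with
    (q - 1 - log2 E[W^q]) / q > s makes all cell masses at level n at most 2^(-n s).  Bernstein's
    inequality, applied to truncated weights, controls all the increments; a first
    application gives the Frostman bound mass I_u <= C 2^(-s |u|).  For |xi| ~ 2^(2m) the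
    coefficients are averages of exp (-2 pi i gamma . xi) over dyadic cells.  Nondegeneracy
    bounds the phase derivative below by |xi| times the distance to boundedly many points, so
    that these averages decay harmonically in the block index and the Frostman bound gives a
    conditional variance of order 2^(-2 m s).  A union bound over a grid of frequencies of mesh
    2^(-2m), and a Lipschitz estimate between them, give the decay |xi|^(-s/2).

    Upper bound.  A Fejer kernel in the direction normal to the arc shows that a Fourier decay
    of exponent s forces mass I <= C (n + 1) 2^(-n s) on dyadic cells I of length 2^(-n): the
    arc stays within O(4^(-n)) of its tangent there.  If s exceeds the endpoint exponent,
    exponential tilting (Cramer) produces an N such that a word u of length N satisfies
    Q_u 2^(-N) >= 2^(-N s) with a probability larger than 2^(-N).  Iterating along the tree, a
    supercritical branching argument yields heavy cells at arbitrarily deep levels with positive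
    probability.  The probability p that the cell masses have bounded growth satisfies
    p <= (a + b p)^2, where a = P(W = 0) and b = 1 - a, whereas the extinction probability
    satisfies e = (a + b e)^2; as p < 1, they agree, and bounded growth occurs only on
    extinction. *)

Require Import Defs.
From HB Require Import structures.
From mathcomp Require Import all_boot all_order all_algebra.
From mathcomp Require Import all_classical all_reals all_analysis.
From mathcomp Require Import complex measurable_realfun.
From mathcomp Require Import lra ring zify.

Set Implicit Arguments.
Unset Strict Implicit.
Unset Printing Implicit Defensive.

Import Order.TTheory GRing.Theory Num.Theory.
Import numFieldNormedType.Exports.

Local Open Scope classical_set_scope.
Local Open Scope ring_scope.

(** * Independent coordinates on the binary tree *)

(** The available moments shape the lower bound: besides [E W = 1], only a moment of some order
    [q > 1], possibly close to 1, is known to be finite. Variances may be infinite, so the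
    exponential bounds are applied to weights cut at a size that all masses eventually respect, and
    the [q]-th moment pays for the mean lost by the cut. No conditional expectation is formed:
    disjoint sets of words generate independent sigma-algebras, and early levels are frozen by
    Fubini. Powers of [r = 2 ^ (- s / 2)] are used since [|xi| = 4 ^ m] turns [|xi| ^ (- s / 2)]
    into [r ^ (2 m)]. In the upper bound moments of order above 1 may all be infinite; cutting the
    weights to [[1/K, K]] makes every tilt finite. There [E[W log2 W] < 1] controls the tilts
    [q <= 1], and the endpoint exponent those with [q > 1]. Convergence of the total mass in every
    subtree is never proved: it is replaced by the event that this mass exceeds a constant
    infinitely often, which is enough to bound cells of the weak limit from below. *)

Section independent_pair.
Context d d1 d2 (T : measurableType d) (S1 : measurableType d1)
  (S2 : measurableType d2) (R : realType) (P : probability T R).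

Definition independent2 (f : T -> S1) (g : T -> S2) : Prop :=
  forall A B, measurable A -> measurable B ->
    P (f @^-1` A `&` g @^-1` B) = (P (f @^-1` A) * P (g @^-1` B))%E.

Variables (f : T -> S1) (g : T -> S2).
Hypotheses (mf : measurable_fun setT f) (mg : measurable_fun setT g).
Hypothesis fg : independent2 f g.

Let F : {mfun T >-> S1} := HB.pack f (isMeasurableFun.Build _ _ _ _ f mf).
Let G : {mfun T >-> S2} := HB.pack g (isMeasurableFun.Build _ _ _ _ g mg).
Let FG : {mfun T >-> (S1 * S2)%type} := HB.pack (fun w => (f w, g w))
  (isMeasurableFun.Build _ _ _ _ _ (measurable_fun_pair mf mg)).

Let joint_lawE (X : set (S1 * S2)) : measurable X ->
  distribution P FG X = (distribution P F \x distribution P G)%E X.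
Proof.
move=> mX; apply/esym; apply: product_measure_unique mX => A B mA mB.
rewrite /distribution /pushforward /= -fg//.
Qed.

Lemma independent2_integral (h : S1 * S2 -> \bar R) :
  measurable_fun [set: S1 * S2] h -> (forall x, (0 <= h x)%E) ->
  (\int[P]_w h (f w, g w) = \int[P]_w \int[P]_w' h (f w, g w'))%E.
Proof.
move=> mh h0.
have -> : (\int[P]_w h (f w, g w) = \int[distribution P FG]_x h x)%E.
  by rewrite ge0_integral_distribution.
rewrite (eq_measure_integral (distribution P F \x distribution P G)%E); last first.
  by move=> A mA _; exact: joint_lawE.
rewrite fubini_tonelli1// ge0_integral_distribution//; last 2 first.
  exact: measurable_fun_fubini_tonelli_F.
  by move=> x; apply: integral_ge0 => y _; exact: h0.
apply: eq_integral => w _ /=; rewrite /fubini_F ge0_integral_distribution//.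
exact: measurableT_comp.
Qed.

(** The substitute for conditioning on [f]: by Fubini, a bound valid for every frozen value of the
    first map survives when that value is random. *)
Lemma independent2_prob_le (B : set (S1 * S2)) (e : R) :
  measurable B -> (forall x, (P [set w | B (x, g w)] <= e%:E)%E) ->
  (P [set w | B (f w, g w)] <= e%:E)%E.
Proof.
move=> mB Be.
pose h (x : S1 * S2) : \bar R := (\1_B x)%:E.
have h0 x : (0 <= h x)%E by rewrite lee_fin.
have mh : measurable_fun [set: S1 * S2] h.
  by apply/measurable_EFinP; exact: measurable_indic.
have intE (k : T -> S1 * S2) : measurable_fun setT k ->
    P [set w | B (k w)] = (\int[P]_w h (k w))%E.
  move=> mk; have mkB : measurable (k @^-1` B).
    by rewrite -[X in measurable X]setTI; exact: mk.
  by rewrite -[in LHS](setIT [set _ | _]) -(@integral_indic _ _ _ P setT).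
rewrite (intE (fun w => (f w, g w))); last exact: measurable_fun_pair.
rewrite (independent2_integral mh h0).
apply: (@le_trans _ _ (\int[P]_(w in setT) (cst e%:E w))%E); last first.
  by rewrite integral_cst//= [P setT]probability_setT mule1.
have e0 : 0 <= e.
  by rewrite -lee_fin; apply: le_trans (Be (f point)).
have mI : measurable_fun setT (fun w => (\int[P]_w' h (f w, g w'))%E).
  have := measurableT_comp (@measurable_fun_fubini_tonelli_F _ _ _ _ _
    (distribution P G) h mh h0) mf.
  apply: eq_measurable_fun => w _ /=; rewrite /fubini_F ge0_integral_distribution//.
  exact: (measurableT_comp mh (pair1_measurable (f w))).
apply: ge0_le_integral => //.
- by move=> w _; apply: integral_ge0.
- move=> w _; rewrite -(intE (fun w' => (f w, g w')))//.
  exact: (measurableT_comp (pair1_measurable (f w)) mg).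
Qed.

Lemma independent2_integralM (h1 : S1 -> \bar R) (h2 : S2 -> \bar R) :
  measurable_fun setT h1 -> measurable_fun setT h2 ->
  (forall x, (0 <= h1 x)%E) -> (forall x, (0 <= h2 x)%E) ->
  (\int[P]_w (h1 (f w) * h2 (g w)) =
   \int[P]_w h1 (f w) * \int[P]_w h2 (g w))%E.
Proof.
move=> m1 m2 h10 h20.
pose h (x : S1 * S2) := (h1 x.1 * h2 x.2)%E.
rewrite (@independent2_integral h); last 2 first.
- by apply: emeasurable_funM;
    [exact: measurableT_comp m1 measurable_fst|exact: measurableT_comp m2 measurable_snd].
- by move=> x; exact: mule_ge0.
under eq_integral => w _.
  rewrite /h /= ge0_integralZl//; last exact: measurableT_comp.
  over.
rewrite ge0_integralZr//; [exact: measurableT_comp| exact: integral_ge0].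
Qed.

End independent_pair.

Section path_space.
Context (R : realType).
Implicit Types D : set (seq bool).

Definition cylinders D : set (set (seq bool -> R)) :=
  [set C | exists (s : seq (seq bool)) (A : seq bool -> set R),
    [/\ [set` s] `<=` D, forall t, measurable (A t) &
        C = [set x | forall t, t \in s -> A t (x t)]]].

(* Environments of weights, observed only at the words in [D]. *)
Definition path_space D := g_sigma_algebraType (cylinders D).

Lemma cylinders_setI D : setI_closed (cylinders D).
Proof.
move=> _ _ [s [A [sD mA ->]]] [s' [A' [sD' mA' ->]]].
exists (s ++ s'), (fun t => (if t \in s then A t else setT) `&`
                           (if t \in s' then A' t else setT)); split.
- by move=> t /=; rewrite mem_cat => /orP[/sD|/sD'].
- by move=> t; apply: measurableI; case: ifP.
- apply/seteqP; split=> x /=.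
    move=> [xA xA'] t _; split; case: ifPn => // ts; [exact: xA|exact: xA'].
  move=> H; split=> t ts.
    by have [] := H t _; rewrite ?mem_cat ts//=.
  by have [] := H t _; rewrite ?mem_cat ts ?orbT//=.
Qed.

Lemma cylinders_setT D : cylinders D setT.
Proof.
exists [::], (fun=> setT); split => //.
by apply/seteqP; split.
Qed.

Lemma measurable_path d (T : measurableType d) D (f : T -> path_space D) :
  (forall t, D t -> measurable_fun setT (fun w => f w t)) ->
  measurable_fun setT f.
Proof.
move=> mf; apply: (@measurability _ _ T (path_space D) setT f (cylinders D)) => //.
move=> _ [_ [s [A [sD mA ->]]] <-]; rewrite setTI.
have -> : f @^-1` [set x | forall t, t \in s -> A t (x t)] =
    \bigcap_(t in [set` s]) ((fun w => f w t) @^-1` A t) by [].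
apply: fin_bigcap_measurable => // t /sD Dt.
by rewrite -[X in measurable X]setTI; exact: mf.
Qed.

Lemma measurable_coord D t : D t ->
  measurable_fun setT (fun x : path_space D => x t).
Proof.
move=> Dt _ A mA; rewrite setTI; apply: sub_sigma_algebra.
exists [:: t], (fun=> A); split => //.
  by move=> t'; rewrite /= inE => /eqP ->.
apply/seteqP; split=> x /=; first by move=> Ax _ /[!inE] /eqP ->.
by apply; rewrite inE.
Qed.

Lemma path_space_measure_unique D (m1 m2 : {measure set (path_space D) -> \bar R}) :
  (m1 setT < +oo)%E -> (forall C, cylinders D C -> m1 C = m2 C) ->
  forall A, measurable A -> m1 A = m2 A.
Proof.
move=> m1oo m12 A mA.
apply: (@measure_unique _ R (path_space D) (cylinders D) (fun=> setT)) => //.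
- exact: cylinders_setI.
- by move=> i; exact: cylinders_setT.
- by rewrite bigcup_const.
Qed.

End path_space.

Section iid_family.
Context d (T : measurableType d) (R : realType) (P : probability T R)
  (nu : set R -> \bar R).

(** Common law and independence in a single product formula. The root is left out, as it enters no
    weight. *)
Definition iid_family (Y : seq bool -> T -> R) : Prop :=
  (forall v, measurable_fun setT (Y v)) /\
  forall (s : seq (seq bool)) (A : seq bool -> set R), uniq s -> [::] \notin s ->
    (forall v, measurable (A v)) ->
    P (\bigcap_(v in [set` s]) (Y v @^-1` A v)) = (\prod_(v <- s) nu (A v))%E.

Variable Y : seq bool -> T -> R.
Hypothesis iY : iid_family Y.

Let mY v : measurable_fun setT (Y v). Proof. by have [] := iY. Qed.

Definition nonnil : set (seq bool) := [set v | v != [::]].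

Definition path_of D (w : T) : path_space R D := fun t => Y t w.

(** The coordinate at [[::]] is the weight at [v] itself. The sigma-algebra of [nonnil] does not see
    it, which is why the law does not depend on [v], not even for [v = [::]]. *)
Definition subtree (v : seq bool) (w : T) : path_space R nonnil :=
  fun t => Y (v ++ t) w.

Lemma measurable_path_of D : measurable_fun setT (path_of D).
Proof. by apply: (@measurable_path _ _ T) => t _; exact: mY. Qed.

Lemma measurable_subtree v : measurable_fun setT (subtree v).
Proof. by apply: (@measurable_path _ _ T) => t _; exact: mY. Qed.

Let F D : {mfun T >-> path_space R D} := HB.pack (path_of D)
  (isMeasurableFun.Build _ _ _ _ _ (@measurable_path_of D)).

Let G v : {mfun T >-> path_space R nonnil} := HB.pack (subtree v)
  (isMeasurableFun.Build _ _ _ _ _ (@measurable_subtree v)).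

Lemma iid_cylinder s (A : seq bool -> set R) : [::] \notin s ->
  (forall v, measurable (A v)) ->
  P [set w | forall t, t \in s -> A t (Y t w)] = (\prod_(v <- undup s) nu (A v))%E.
Proof.
move=> s0 mA; rewrite -(proj2 iY) ?undup_uniq ?mem_undup//; congr (P _).
by apply/seteqP; split=> w /= H t; [move=> /=|move=> ts; apply: H => /=];
  rewrite mem_undup// => /H.
Qed.

(** Relabelling [t] as [v ++ t] turns a cylinder into one with the same product of factors, and
    cylinders determine the law. *)
Lemma subtree_law v A : measurable A ->
  P (subtree v @^-1` A) = P (subtree [::] @^-1` A).
Proof.
move=> mA.
rewrite -[LHS]/(distribution P (G v) A) -[RHS]/(distribution P (G [::]) A).
apply: path_space_measure_unique mA.
  by rewrite (le_lt_trans (probability_le1 _ _))// ltry.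
move=> _ [s [B [sD mB ->]]].
have s0 : [::] \notin s by apply/negP => /sD; rewrite /nonnil /=.
transitivity (\prod_(t <- undup s) nu (B t))%E; last by rewrite -iid_cylinder.
pose B' t := B (drop (size v) t).
transitivity (P [set w | forall t, t \in map (cat v) s -> B' t (Y t w)]).
  congr (P _); apply/seteqP; split=> w /= H.
    by move=> _ /mapP[t ts ->]; rewrite /B' drop_size_cat//; exact: H.
  move=> t ts; have := H (v ++ t); rewrite /B' drop_size_cat//; apply.
  exact: map_f.
rewrite iid_cylinder; last by move=> t; exact: mB.
  rewrite undup_map_inj; last first.
    by move=> t t' /(congr1 (drop (size v))); rewrite !drop_size_cat.
  by rewrite big_map; apply: eq_bigr => t _; rewrite /B' drop_size_cat.
apply/negP => /mapP[t ts /(congr1 size)]; rewrite size_cat.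
by case: t ts => [ts|b t _]; [rewrite ts in s0|rewrite addnS].
Qed.
(** In [A], both sides are finite measures: [P] restricted to [E] and [P] scaled by [P E]. Agreement
    on cylinders therefore extends. Independence of two families follows by applying this once to
    each factor. *)
Let cylinder_to_event D (E : set T) : measurable E ->
  (forall C, cylinders D C ->
    P (path_of D @^-1` C `&` E) = (P (path_of D @^-1` C) * P E)%E) ->
  forall A : set (path_space R D), measurable A ->
    P (path_of D @^-1` A `&` E) = (P (path_of D @^-1` A) * P E)%E.
Proof.
move=> mE H A mA.
have PE0 : 0 <= fine (P E) by rewrite fine_ge0.
pose m1 : {measure set (path_space R D) -> \bar R} :=
  image_measure (mrestr P mE) (F D).
pose m2 : {measure set (path_space R D) -> \bar R} :=
  mscale (NngNum PE0) (image_measure P (F D)).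
have m2E B : m2 B = (P (path_of D @^-1` B) * P E)%E.
  by rewrite muleC -[P E]fineK ?fin_num_measure.
rewrite -m2E -[LHS]/(m1 A); apply: path_space_measure_unique mA.
  rewrite /m1 /= /image_measure /pushforward /mrestr /= preimage_setT setTI.
  by rewrite (le_lt_trans (probability_le1 _ _))// ltry.
by move=> C cC; rewrite m2E -H.
Qed.

Lemma path_independent D D' : D `<=` nonnil -> D' `<=` nonnil ->
  D `&` D' = set0 -> independent2 P (path_of D) (path_of D').
Proof.
move=> Dn Dn' DD' A B mA mB.
have mp D0 C : measurable C -> measurable (path_of D0 @^-1` C).
  by move=> mC; rewrite -[X in measurable X]setTI; exact: measurable_path_of.
apply: cylinder_to_event => //; first exact: mp.
move=> C cC; rewrite setIC muleC.
apply: cylinder_to_event => //; first by apply: mp; exact: sub_sigma_algebra.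
move=> C' [s' [A' [sD' mA' ->]]]; case: cC => s [A0 [sD mA0 ->]].
have s0 : [::] \notin s by apply/negP => /sD /Dn; rewrite /nonnil /=.
have s'0 : [::] \notin s' by apply/negP => /sD' /Dn'; rewrite /nonnil /=.
have dss t : t \in s' -> t \in s -> False.
  by move=> /sD' tD' /sD tD; suff: (D `&` D') t by rewrite DD'.
rewrite -[X in X `&` _]/[set w | forall t, t \in s' -> A' t (Y t w)].
rewrite -[X in _ `&` X]/[set w | forall t, t \in s -> A0 t (Y t w)].
rewrite -[X in (P X * _)%E]/[set w | forall t, t \in s' -> A' t (Y t w)].
rewrite -[X in (_ * P X)%E]/[set w | forall t, t \in s -> A0 t (Y t w)].
(* As the two lists of words are disjoint, both constraints merge into a single cylinder, to which
   the product formula applies. *)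
have -> : [set w | forall t, t \in s' -> A' t (Y t w)] `&`
          [set w | forall t, t \in s -> A0 t (Y t w)] =
  [set w | forall t, t \in s' ++ s ->
     (if t \in s' then A' t else A0 t) (Y t w)].
  apply/seteqP; split=> w /=.
    move=> [h' h] t; rewrite mem_cat; case: ifPn => //= ts'; first by move=> _; exact: h'.
    by move=> ts; exact: h.
  move=> h; split=> t ts.
    by have := h t; rewrite mem_cat ts/=; apply.
  have := h t; rewrite mem_cat ts orbT.
  by case: ifPn => [ts'|_]; [have := dss _ ts' ts|apply].
have ss0 : [::] \notin s' ++ s by rewrite mem_cat negb_or s'0.
have mA'0 t : measurable (if t \in s' then A' t else A0 t) by case: ifP.
rewrite (iid_cylinder ss0 mA'0) !iid_cylinder//.
rewrite undup_cat big_cat /=; congr (_ * _)%E.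
  rewrite [in LHS]big_filter.
  rewrite [LHS]big_seq_cond [RHS]big_seq; apply: eq_big => t.
    rewrite mem_undup; rewrite andbC; case: (boolP (t \in s')) => ts' //=; last by rewrite andbF.
    rewrite andbT; exact/negP/(dss _ ts').
  by rewrite mem_undup => /andP[-> _].
rewrite [LHS]big_seq [RHS]big_seq; apply: eq_bigr => t; rewrite mem_undup => ts.
by case: ifPn => // ts'; have := dss _ ts' ts.
Qed.

End iid_family.

Lemma integral_cst_prob d (T : measurableType d) (R : realType)
    (P : probability T R) (r : R) : (\int[P]_w r%:E = r%:E)%E.
Proof.
by rewrite (eq_integral (cst r%:E))// integral_cst// [X in (_ * X)%E]probability_setT mule1.
Qed.

Section iid_integrals.
Context d (T : measurableType d) d0 (T0 : measurableType d0) (R : realType)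
  (P : probability T R) (P0 : probability T0 R) (V : {RV P0 >-> R})
  (Y : seq bool -> T -> R).
Hypothesis iY : iid_family P (distribution P0 V) Y.

Let mY v : measurable_fun setT (Y v). Proof. by have [] := iY. Qed.

Lemma iid_law v A : v != [::] -> measurable A ->
  P (Y v @^-1` A) = P0 (V @^-1` A).
Proof.
move=> v0 mA; have := @iid_cylinder _ _ _ _ _ _ iY [:: v] (fun=> A).
rewrite inE eq_sym v0 => /(_ isT (fun=> mA)).
rewrite /= big_seq1 => H; apply: etrans H; congr (P _).
apply/seteqP; split=> w /=.
  by move=> Aw t; rewrite inE => /eqP ->.
by apply; rewrite inE.
Qed.

Lemma iid_integral v (f : R -> \bar R) : v != [::] -> measurable_fun setT f ->
  (forall x, (0 <= f x)%E) ->
  (\int[P]_w f (Y v w) = \int[P0]_w f (V w))%E.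
Proof.
move=> v0 mf f0.
pose Yv : {RV P >-> R} := HB.pack (Y v) (isMeasurableFun.Build _ _ _ _ _ (mY v)).
transitivity (\int[distribution P Yv]_x f x)%E.
  by rewrite ge0_integral_distribution.
transitivity (\int[distribution P0 V]_x f x)%E; last first.
  by rewrite ge0_integral_distribution.
by apply: eq_measure_integral => A mA _; exact: iid_law.
Qed.

Lemma iid_integral_prod (s : seq (seq bool)) (f : seq bool -> R -> R) :
  uniq s -> [::] \notin s -> (forall t, measurable_fun setT (f t)) ->
  (forall t x, 0 <= f t x) ->
  (\int[P]_w (\prod_(t <- s) f t (Y t w))%:E =
   \prod_(t <- s) \int[P0]_w (f t (V w))%:E)%E.
Proof.
move=> + + mf f0; elim: s => [_ _|v s IHs].
  under eq_integral do rewrite big_nil.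
  by rewrite big_nil integral_cst_prob.
rewrite /= inE negb_or => /andP[vs us] /andP[v0 s0].
under eq_integral do rewrite big_cons EFinM.
rewrite big_cons -IHs// -(@iid_integral v (EFin \o f v)); last 3 first.
- by rewrite eq_sym.
- exact/measurable_EFinP.
- by move=> x; rewrite lee_fin.
pose h1 (x : path_space R [set v]) := (f v (x v))%:E.
pose h2 (x : path_space R [set` s]) := (\prod_(t <- s) f t (x t))%:E.
have mh1 : measurable_fun setT h1.
  apply/measurable_EFinP.
  by apply: measurableT_comp (mf v) _; exact: measurable_coord.
have mh2 : measurable_fun setT h2.
  apply/measurable_EFinP; apply: measurable_prod => t ts.
  by apply: measurableT_comp (mf t) _; exact: measurable_coord.
have ind : independent2 P (path_of Y [set v]) (path_of Y [set` s]).
  apply: (path_independent iY).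
  - by move=> t /= ->; rewrite /nonnil /= eq_sym.
  - by move=> t /= ts; rewrite /nonnil /=; apply: contraNN s0 => /eqP <-.
  - by apply/seteqP; split=> t //= [-> vs']; rewrite vs' in vs.
have h10 x : (0 <= h1 x)%E by rewrite lee_fin.
have h20 x : (0 <= h2 x)%E by rewrite lee_fin; apply: prodr_ge0.
have := independent2_integralM (measurable_path_of iY (D:=_))
  (measurable_path_of iY (D:=_)) ind mh1 mh2 h10 h20.
by [].
Qed.

End iid_integrals.

(** * Bernstein deviations *)

Section bernstein.
Context (R : realType).

(** From [exp (- x) >= 1 - x] one gets [exp x <= 1 / (1 - x)], and [(1 + x + 2 x^2) (1 - x) = 1 +
    x^2 (1 - 2 x)]. *)
Lemma expR_le_quadratic (x : R) : x <= 2^-1 -> expR x <= 1 + x + 2 * x ^+ 2.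
Proof.
move=> x2; have x1 : 0 < 1 - x by lra.
have eNx : 1 - x <= expR (- x) by rewrite expR_ge1Dx.
have : expR x <= (1 - x)^-1.
  by rewrite -[x]opprK expRN opprK lef_pV2 // posrE expR_gt0.
move/le_trans; apply.
rewrite -[leLHS]mul1r ler_pdivrMr//.
by nra.
Qed.

Lemma expR_truncated_le (b c h q z : R) : 0 < b -> `|c| <= 1 -> 2 * b <= h ->
  1 < q -> 0 <= z ->
  (if z <= b then expR (c * z / h) else 0) <=
  1 + c * z / h + 2 * c ^+ 2 * b * z / h ^+ 2 + z `^ q * b `^ (1 - q) / h.
Proof.
move=> b0 c1 bh q1 z0.
have h0 : 0 < h by apply: lt_le_trans bh; rewrite mulr_gt0.
have p0 : 0 <= z `^ q * b `^ (1 - q) / h.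
  by rewrite divr_ge0 ?mulr_ge0 ?powR_ge0// ltW.
have -> : 2 * c ^+ 2 * b * z / h ^+ 2 = 2 * (c ^+ 2 * ((b / h) * (z / h))).
  by rewrite expr2 invfM; ring.
rewrite -mulrA; move: p0; set p := _ / h; set u := z / h; set e := b / h => p0.
have u0 : 0 <= u by rewrite divr_ge0// ltW.
have e0 : 0 <= e by rewrite divr_ge0// ltW.
have c20 : 0 <= c ^+ 2 * (e * u) by rewrite mulr_ge0 ?sqr_ge0// mulr_ge0.
case: ifPn => zb.
  have ue : u <= e by rewrite ler_pM2r ?invr_gt0.
  have e12 : e <= 2^-1 by rewrite ler_pdivrMr//; lra.
  have cu : c * u <= 2^-1.
    have := ler_norm (c * u); rewrite normrM (ger0_norm u0) => /le_trans; apply.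
    by apply: le_trans (ler_wpM2r u0 c1) _; rewrite mul1r (le_trans ue).
  apply: le_trans (expR_le_quadratic cu) _.
  have : c ^+ 2 * u ^+ 2 <= c ^+ 2 * (e * u).
    by rewrite ler_wpM2l ?sqr_ge0// expr2 ler_wpM2r.
  rewrite [(c * u) ^+ 2]exprMn.
  move: (c ^+ 2 * u ^+ 2) (c ^+ 2 * (e * u)) => X1 X2 ?; lra.
have {}zb : b < z by rewrite ltNge.
have zp : u <= p.
  rewrite ler_pM2r ?invr_gt0//.
  rewrite -{1}(mulr_powRB1 z0 (lt_trans ltr01 q1)) -mulrA ler_peMr//.
  rewrite -[1 - q]opprB powRN ler_pdivlMr ?powR_gt0// mul1r ge0_ler_powR ?nnegrE//; lra.
have cu : - u <= c * u.
  have := ler_norm (- (c * u)); rewrite normrN normrM (ger0_norm u0).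
  have := ler_wpM2r u0 c1; lra.
move: (c ^+ 2 * (e * u)) c20 => X2 ?; lra.
Qed.

End bernstein.

Lemma measurable_set_ler d (T : measurableType d) (R : realType) (f g : T -> R) :
  measurable_fun setT f -> measurable_fun setT g ->
  measurable [set w | f w <= g w].
Proof.
move=> mf mg; rewrite -[X in measurable X]setTI.
rewrite (_ : [set w | _] = (fun w => f w <= g w) @^-1` [set true]).
  by apply: measurable_fun_ler.
by apply/seteqP; split=> w /= ->.
Qed.

Lemma measurable_set_ltr d (T : measurableType d) (R : realType) (f g : T -> R) :
  measurable_fun setT f -> measurable_fun setT g ->
  measurable [set w | f w < g w].
Proof.
move=> mf mg; rewrite -[X in measurable X]setTI.
rewrite (_ : [set w | _] = (fun w => f w < g w) @^-1` [set true]).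
  by apply: measurable_fun_ltr.
by apply/seteqP; split=> w /= ->.
Qed.

Lemma measurable_forall_seq d (T : measurableType d) (I : eqType) (s : seq I)
    (B : I -> set T) : (forall t, t \in s -> measurable (B t)) ->
  measurable [set w | forall t, t \in s -> B t w].
Proof.
move=> mB; rewrite (_ : [set w | _] = \bigcap_(t in [set` s]) B t)//.
by apply: fin_bigcap_measurable.
Qed.

Lemma markov_le d (T : measurableType d) (R : realType) (P : probability T R)
    (f : T -> R) (e : R) : measurable_fun setT f -> (forall w, 0 <= f w) -> 0 < e ->
  (e%:E * P [set w | (e <= f w)%R] <= \int[P]_w (f w)%:E)%E.
Proof.
move=> mf f0 e0.
have mE : measurable [set w | e <= f w].
  exact: measurable_set_ler.
have -> : (e%:E * P [set w | (e <= f w)%R] =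
    \int[P]_w (e * \1_[set w | (e <= f w)%R] w)%:E)%E.
  under eq_integral do rewrite EFinM.
  rewrite ge0_integralZl//; last 2 first.
  - by apply/measurable_EFinP; exact: measurable_indic.
  - by rewrite lee_fin ltW.
  by rewrite integral_indic// setIT.
apply: ge0_le_integral => //.
- by move=> w _; rewrite lee_fin mulr_ge0// ltW.
- by apply/measurable_EFinP; apply: measurable_funM => //; exact: measurable_indic.
- exact/measurable_EFinP.
- move=> w _; rewrite lee_fin indicE; case: (asboolP (e <= f w)) => efw.
    by rewrite mem_set// mulr1.
  by rewrite memNset// mulr0.
Qed.

Section tail_bound.
Context d (T : measurableType d) d0 (T0 : measurableType d0) (R : realType)
  (P : probability T R) (P0 : probability T0 R) (V : {RV P0 >-> R})
  (Y : seq bool -> T -> R).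
Hypothesis iY : iid_family P (distribution P0 V) Y.
Hypothesis V0 : forall w, 0 <= V w.
Hypothesis EV : (\int[P0]_w (V w)%:E = 1)%E.
Variables (q M : R).
Hypothesis q1 : 1 < q.
Hypothesis VqM : (\int[P0]_w (V w `^ q)%:E <= M%:E)%E.

Let mY v : measurable_fun setT (Y v). Proof. by have [] := iY. Qed.

Let iV : P0.-integrable setT (EFin \o V).
Proof.
apply/integrableP; split; first exact/measurable_EFinP.
under eq_integral => w _ do rewrite /= ger0_norm//.
by rewrite EV ltry.
Qed.

Let mVq : measurable_fun setT (fun w => V w `^ q).
Proof. exact: (measurableT_comp (measurable_powR q)). Qed.

Let iVq : P0.-integrable setT (fun w => (V w `^ q)%:E).
Proof.
apply/integrableP; split; first exact/measurable_EFinP.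
under eq_integral => w _ do rewrite /= ger0_norm ?powR_ge0//.
by rewrite (le_lt_trans VqM)// ltry.
Qed.

Let M0 : 0 <= M.
Proof.
rewrite -lee_fin (le_trans _ VqM)// integral_ge0// => w _.
by rewrite lee_fin powR_ge0.
Qed.

Let truncated (a b c h x : R) := if a * x <= b then expR (c * (a * x) / h) else 0.

Let mtruncated a b c h : measurable_fun setT (truncated a b c h).
Proof.
apply: measurable_fun_ifT => //.
- apply: measurable_fun_ler => //; exact: measurable_funM.
- apply: measurableT_comp => //; do 2 apply: measurable_funM => //.
Qed.

Let truncated_expectation a b c h : 0 <= a -> 0 < b -> `|c| <= 1 -> 2 * b <= h ->
  (\int[P0]_w (truncated a b c h (V w))%:E <=
   (expR (c * a / h + 2 * c ^+ 2 * b * a / h ^+ 2 +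
          M * a `^ q * b `^ (1 - q) / h))%:E)%E.
Proof.
move=> a0 b0 c1 bh.
have h0 : 0 < h by apply: lt_le_trans bh; rewrite mulr_gt0.
set k1 := c * a / h + 2 * c ^+ 2 * b * a / h ^+ 2.
set k2 := a `^ q * b `^ (1 - q) / h.
have k20 : 0 <= k2 by rewrite divr_ge0 ?mulr_ge0 ?powR_ge0// ltW.
pose g w := (1 + k1%:E * (V w)%:E + k2%:E * (V w `^ q)%:E)%E.
have i1 : P0.-integrable setT (fun=> 1%E : \bar R).
  exact: (finite_measure_integrable_cst P0 1).
have ik1 : P0.-integrable setT (fun w => (k1%:E * (V w)%:E)%E) by exact: integrableZl.
have ik2 : P0.-integrable setT (fun w => (k2%:E * (V w `^ q)%:E)%E) by exact: integrableZl.
have i12 : P0.-integrable setT (fun w => (1 + k1%:E * (V w)%:E)%E) by exact: integrableD.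
have ig : P0.-integrable setT g by exact: integrableD.
have fg w : ((truncated a b c h (V w))%:E <= g w)%E.
  rewrite /truncated /g -!EFinM -!EFinD lee_fin.
  apply: le_trans (expR_truncated_le b0 c1 bh q1 (mulr_ge0 a0 (V0 w))) _.
  rewrite powRM// /k1 /k2 le_eqVlt; apply/orP; left; apply/eqP.
  by field; rewrite gt_eqF.
have f0 w : (0 <= (truncated a b c h (V w))%:E)%E.
  by rewrite lee_fin /truncated; case: ifP => // _; exact: expR_ge0.
have mf : measurable_fun setT (fun w => (truncated a b c h (V w))%:E).
  by apply/measurable_EFinP; apply: measurableT_comp.
apply: (@le_trans _ _ (\int[P0]_w g w)%E).
  apply: le_integral => //.
  apply: le_integrable ig => // w _.
  by rewrite (gee0_abs (f0 w)) (gee0_abs (le_trans (f0 w) (fg w))).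
rewrite /g integralD//= integralD//= !integralZl// EV integral_cst_prob mule1.
apply: (@le_trans _ _ (1 + k1%:E + k2%:E * M%:E)%E).
  by rewrite leeD2l// lee_wpmul2l// lee_fin.
rewrite -EFinM -!EFinD lee_fin.
apply: le_trans (expR_ge1Dx _).
rewrite le_eqVlt; apply/orP; left; apply/eqP; rewrite /k1 /k2.
by field; rewrite gt_eqF.
Qed.

(** Markov's inequality for the product of the truncated exponentials at parameter [1 / h]. This
    product vanishes as soon as one term exceeds [b], whence the first half of the event. In the
    threshold, [lam * h] comes from Markov, the middle term from the quadratic part, and [M * b] is
    the price of the truncation: [b ^ (1 - q)] times the sum of the [a t ^ q] is at most [b]. *)
Lemma bernstein_tail (s : seq (seq bool)) (a c : seq bool -> R) (b h lam : R) :
  uniq s -> [::] \notin s -> 0 < b -> 2 * b <= h ->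
  (forall t, 0 <= a t) -> (forall t, `|c t| <= 1) ->
  \sum_(t <- s) a t `^ q <= b `^ q ->
  (P [set w | (forall t, t \in s -> a t * Y t w <= b)%R /\
     (lam * h + 2 * b * (\sum_(t <- s) a t * c t ^+ 2) / h + M * b <
      \sum_(t <- s) c t * (a t * (Y t w - 1)))%R] <= (expR (- lam))%:E)%E.
Proof.
move=> us s0 b0 bh a0 c1 aq.
have h0 : 0 < h by apply: lt_le_trans bh; rewrite mulr_gt0.
pose kt t := c t * a t / h + 2 * c t ^+ 2 * b * a t / h ^+ 2 +
          M * a t `^ q * b `^ (1 - q) / h.
pose k := \sum_(t <- s) kt t.
pose Z w := \prod_(t <- s) truncated (a t) b (c t) h (Y t w).
have mZ : measurable_fun setT Z.
  by apply: measurable_prod => t _; exact: measurableT_comp.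
have Z0 w : 0 <= Z w.
  by apply: prodr_ge0 => t _; rewrite /truncated; case: ifP => // _; exact: expR_ge0.
have EZ : (\int[P]_w (Z w)%:E <= (expR k)%:E)%E.
  rewrite (iid_integral_prod iY (f := fun t => truncated (a t) b (c t) h))//; last first.
    by move=> t x; rewrite /truncated; case: ifP => // _; exact: expR_ge0.
  rewrite /k expR_sum -prodEFin.
  elim: (s) => [|t s' IH]; first by rewrite !big_nil.
  rewrite !big_cons lee_pmul//.
  - apply: integral_ge0 => w _; rewrite lee_fin /truncated.
    by case: ifP => // _; exact: expR_ge0.
  - apply: prode_ge0 => t' _; apply: integral_ge0 => w _; rewrite lee_fin /truncated.
    by case: ifP => // _; exact: expR_ge0.
  - exact: truncated_expectation.
have := @markov_le _ _ _ P Z _ mZ Z0 (expR_gt0 (lam + k)).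
move=> /le_trans /(_ EZ).
have -> : expR k = expR (lam + k) * expR (- lam) by rewrite -expRD; congr expR; ring.
rewrite EFinM lee_pmul2l ?lte_fin ?expR_gt0//.
apply: le_trans; apply: le_measure; rewrite ?inE.
- apply: measurableI.
    apply: measurable_forall_seq => t _.
    by apply: measurable_set_ler => //; exact: measurable_funM.
  apply: measurable_set_ltr => //; apply: measurable_sum => t.
  by do 2 apply: measurable_funM => //; exact: measurable_funB.
- exact: measurable_set_ler.
move=> w /= [sb hw]; rewrite /Z.
have -> : \prod_(t <- s) truncated (a t) b (c t) h (Y t w) =
    expR (\sum_(t <- s) c t * (a t * Y t w) / h).
  rewrite expR_sum big_seq [RHS]big_seq; apply: eq_bigr => t ts.
  by rewrite /truncated sb.
rewrite ler_expR.
have kE : forall s', \sum_(t <- s') kt t = (\sum_(t <- s') c t * a t) / h +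
    2 * b * (\sum_(t <- s') a t * c t ^+ 2) / h ^+ 2 +
    M * b `^ (1 - q) * (\sum_(t <- s') a t `^ q) / h.
  elim=> [|t s' IH]; first by rewrite !big_nil; field; rewrite gt_eqF.
  by rewrite !big_cons IH /kt; field; rewrite gt_eqF.
have -> : \sum_(t <- s) c t * (a t * Y t w) / h =
    (\sum_(t <- s) c t * (a t * (Y t w - 1))) / h + (\sum_(t <- s) c t * a t) / h.
  by rewrite -mulrDl -big_split/= mulr_suml; apply: eq_bigr => t _; ring.
rewrite /k kE; move: hw.
set S1 := \sum_(t <- s) a t * _; set S2 := \sum_(t <- s) a t `^ q.
set S3 := \sum_(t <- s) c t * (_ * _); set S4 := \sum_(t <- s) c t * a t.
move=> hw.
suff : lam + 2 * b * S1 / h ^+ 2 + M * b `^ (1 - q) * S2 / h <= S3 / h by lra.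
rewrite ler_pdivlMr// ltW//; apply: le_lt_trans hw.
have bq : b `^ (1 - q) * S2 <= b.
  have bE : b `^ (1 - q) * b `^ q = b.
    by rewrite -powRD ?subrK ?powRr1 ?(ltW b0)// (gt_eqF b0) implybT.
  by rewrite -[leRHS]bE ler_wpM2l ?powR_ge0.
have -> : (lam + 2 * b * S1 / h ^+ 2 + M * b `^ (1 - q) * S2 / h) * h =
    lam * h + 2 * b * S1 / h + M * (b `^ (1 - q) * S2).
  by field; rewrite gt_eqF.
by rewrite lerD2l ler_wpM2l.
Qed.

End tail_bound.

(** * Level masses of the cascade *)

Fixpoint words (n : nat) : seq (seq bool) :=
  if n is n'.+1 then map (rcons^~ false) (words n') ++ map (rcons^~ true) (words n')
  else [:: [::]].

Lemma mem_words n v : (v \in words n) = (size v == n).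
Proof.
elim: n v => [|n IHn] v; first by rewrite inE size_eq0.
rewrite mem_cat; apply/orP/eqP => [[]/mapP[u]|].
- by rewrite IHn => /eqP <- ->; rewrite size_rcons.
- by rewrite IHn => /eqP <- ->; rewrite size_rcons.
case: (lastP v) => // u b; rewrite size_rcons => -[un].
by case: b; [right|left]; apply/mapP; exists u => //; rewrite IHn un.
Qed.

Lemma uniq_words n : uniq (words n).
Proof.
elim: n => //= n IHn; rewrite cat_uniq !map_inj_uniq ?IHn ?andbT//=; last 2 first.
- exact: rcons_injl.
- exact: rcons_injl.
apply/hasPn => _ /mapP[u _ ->]; apply/negP => /mapP[u' _ /eqP].
by rewrite eqseq_rcons andbC.
Qed.

Lemma size_words n : size (words n) = (2 ^ n)%N.
Proof. by elim: n => //= n IHn; rewrite size_cat !size_map IHn expnS mul2n addnn. Qed.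

Section sums_over_words.
Context (R : realType).
Implicit Types F : seq bool -> R.

Lemma sum_words0 F : \sum_(v <- words 0) F v = F [::].
Proof. by rewrite /= big_seq1. Qed.

Lemma sum_wordsS n F : \sum_(v <- words n.+1) F v =
  \sum_(v <- words n) (F (rcons v false) + F (rcons v true)).
Proof. by rewrite /= big_cat !big_map big_split. Qed.

Lemma sum_words_cat l k F : \sum_(v <- words (l + k)) F v =
  \sum_(u <- words l) \sum_(t <- words k) F (u ++ t).
Proof.
elim: k F => [|k IHk] F.
  by rewrite addn0; apply: eq_bigr => u _; rewrite sum_words0 cats0.
rewrite addnS sum_wordsS IHk; apply: eq_bigr => u _.
by rewrite sum_wordsS; apply: eq_bigr => t _; rewrite !rcons_cat.
Qed.

Lemma sum_tuple_words n F : \sum_(v : n.-tuple bool) F v = \sum_(v <- words n) F v.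
Proof.
rewrite [RHS](perm_big (map (@tval n bool) (index_enum (n.-tuple bool)))) ?big_map//.
apply: uniq_perm; [exact: uniq_words|by rewrite map_inj_uniq ?index_enum_uniq//; exact: val_inj|].
move=> v; rewrite mem_words; apply/eqP/mapP => [vn|[t _ ->]]; last by rewrite size_tuple.
by exists (Tuple (introT eqP vn)) => //; rewrite mem_index_enum.
Qed.

End sums_over_words.

Section weights.
Context d (T : measurableType d) (R : realType) (Y : seq bool -> T -> R).

Lemma cascade_weight_nil w : cascade_weight Y [::] w = 1.
Proof. by rewrite /cascade_weight big_geq. Qed.

Lemma cascade_weight_rcons v b w :
  cascade_weight Y (rcons v b) w = cascade_weight Y v w * Y (rcons v b) w.
Proof.
rewrite /cascade_weight size_rcons big_nat_recr//=; congr (_ * _).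
  apply: eq_big_nat => j /andP[_ jv]; congr (Y _ w).
  by rewrite -cats1 takel_cat.
by rewrite take_oversize// size_rcons.
Qed.

Lemma cascade_weight_cat u v w : cascade_weight Y (u ++ v) w =
  cascade_weight Y u w * cascade_weight (fun t => Y (u ++ t)) v w.
Proof.
elim/last_ind: v => [|v b IHv].
  by rewrite cats0 /cascade_weight [X in _ = _ * X]big_geq// mulr1.
rewrite -rcons_cat cascade_weight_rcons IHv -mulrA; congr (_ * _).
rewrite {2}/cascade_weight size_rcons big_nat_recr//= take_oversize ?size_rcons//.
rewrite rcons_cat; congr (_ * _); rewrite /cascade_weight.
apply: eq_big_nat => j /andP[_ jv]; congr (Y (_ ++ _) w).
by rewrite -cats1 takel_cat.
Qed.

Lemma cascade_weight_ge0 v w : (forall v w, 0 <= Y v w) -> 0 <= cascade_weight Y v w.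
Proof. by move=> Y0; apply: prodr_ge0. Qed.

End weights.

Lemma measurable_weight d (T : measurableType d) (R : realType)
    (Y : seq bool -> T -> R) v :
  (forall j, (0 < j <= size v)%N -> measurable_fun setT (Y (take j v))) ->
  measurable_fun setT (cascade_weight Y v).
Proof.
move=> mY; apply: measurable_prod => j; rewrite mem_index_iota ltnS; exact: mY.
Qed.

Arguments words : simpl never.

Lemma measurable_sum_seq d (T : measurableType d) (R : realType) (I : eqType)
    (s : seq I) (h : I -> T -> R) :
  (forall i, i \in s -> measurable_fun setT (h i)) ->
  measurable_fun setT (fun x => \sum_(i <- s) h i x).
Proof.
move=> mh; rewrite (_ : (fun x => _) =
    fun x => \sum_(i <- s) (if i \in s then h i x else 0)).
  apply: measurable_sum => i.
  by case: (boolP (i \in s)) => [/mh //|_]; exact: measurable_cst.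
by apply/funext => x; rewrite [LHS]big_seq [RHS]big_seq; apply: eq_bigr => i ->.
Qed.

Section conditional_tail_bound.
Context d (T : measurableType d) d0 (T0 : measurableType d0) (R : realType)
  (P : probability T R) (P0 : probability T0 R) (V : {RV P0 >-> R})
  (Y : seq bool -> T -> R).
Hypothesis iY : iid_family P (distribution P0 V) Y.
Hypothesis V0 : forall w, 0 <= V w.
Hypothesis Y0 : forall v w, 0 <= Y v w.
Hypothesis EV : (\int[P0]_w (V w)%:E = 1)%E.
Variables (q M : R).
Hypothesis q1 : 1 < q.
Hypothesis VqM : (\int[P0]_w (V w `^ q)%:E <= M%:E)%E.

Let mY v : measurable_fun setT (Y v). Proof. by have [] := iY. Qed.

(** For [v] of length [n + 1], the coefficient of [Y v] in the mass of [v]: half of the mass of its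
    parent, a function of the first [n] levels. *)
Definition parent_mass n v w := 2 ^- n.+1 * cascade_weight Y (take n v) w.

Definition deviation n (c : seq bool -> R) w :=
  \sum_(v <- words n.+1) c v * (parent_mass n v w * (Y v w - 1)).

(** The coefficients [a] and the weights [y] are parameters so that one formula describes the event
    both on the probability space and on a product of two path spaces. *)
Let tail n (c : seq bool -> R) (b h lam : R) (a y : seq bool -> R) : Prop :=
  [/\ \sum_(v <- words n.+1) a v `^ q <= b `^ q,
   (forall v, v \in words n.+1 -> a v * y v <= b) &
   lam * h + 2 * b * (\sum_(v <- words n.+1) a v * c v ^+ 2) / h + M * b
     < \sum_(v <- words n.+1) c v * (a v * (y v - 1))].

Definition exceptional n c b h lam : set T :=
  [set w | tail n c b h lam (parent_mass n ^~ w) (Y ^~ w)].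

Let D n : set (seq bool) := [set v | v != [::] /\ (size v <= n)%N].
Let D' n : set (seq bool) := [set v | size v = n.+1].

(** Points of the path space may have negative coordinates; the absolute value restores the sign
    condition of [bernstein_tail] there and changes nothing on the nonnegative weights [Y]. *)
Let ax n (v : seq bool) (x : path_space R (D n)) :=
  `|2 ^- n.+1 * cascade_weight (fun t (x : path_space R (D n)) => x t) (take n v) x|.

Let max n v : measurable_fun setT (@ax n v).
Proof.
apply: measurableT_comp => //; apply: measurable_funM => //.
apply: measurable_weight => j /andP[j0 jn]; apply: measurable_coord; split.
  rewrite -size_eq0 size_take; case: ifP => [_|]; first by rewrite -lt0n.
  by rewrite -lt0n => _; apply: leq_trans jn.
by rewrite size_take_min (leq_trans (geq_minr _ _))// size_take_min geq_minl.
Qed.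

Let axE n v w : @ax n v (path_of Y (D n) w) = parent_mass n v w.
Proof.
rewrite /ax /parent_mass ger0_norm//; apply: mulr_ge0.
  by rewrite invr_ge0 exprn_ge0.
by apply: prodr_ge0 => j _; exact: Y0.
Qed.

Let bad n c b h lam : set (path_space R (D n) * path_space R (D' n)) :=
  [set z | tail n c b h lam (fun v => ax v z.1) z.2].

Let mbad n c b h lam : measurable (@bad n c b h lam).
Proof.
have m1 v : measurable_fun [set: path_space R (D n) * path_space R (D' n)]
    (fun z => ax v z.1) by exact: measurableT_comp (max v) measurable_fst.
have m2 v : v \in words n.+1 ->
    measurable_fun [set: path_space R (D n) * path_space R (D' n)] (fun z => z.2 v).
  rewrite mem_words => /eqP vn.
  by apply: (measurableT_comp (measurable_coord (D := D' n) vn) measurable_snd).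
rewrite (_ : bad _ _ _ _ = [set z | \sum_(v <- words n.+1) ax v z.1 `^ q <= b `^ q] `&`
  [set z | forall v, v \in words n.+1 -> ax v z.1 * z.2 v <= b] `&`
  [set z | lam * h + 2 * b * (\sum_(v <- words n.+1) ax v z.1 * c v ^+ 2) / h + M * b
     < \sum_(v <- words n.+1) c v * (ax v z.1 * (z.2 v - 1))]); last first.
  by apply/seteqP; split=> z /=; [case=> *; split; [split|]|case=> -[]; split].
apply: measurableI; first apply: measurableI.
- apply: measurable_set_ler => //; apply: measurable_sum => v.
  exact: measurableT_comp (measurable_powR q) (m1 v).
- apply: measurable_forall_seq => v vs; apply: measurable_set_ler => //.
  by apply: measurable_funM => //; exact: m2.
- apply: measurable_set_ltr.
    apply: measurable_funD => //; apply: measurable_funD => //.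
    apply: measurable_funM => //; apply: measurable_funM => //.
    by apply: measurable_sum => v; apply: measurable_funM.
  apply: measurable_sum_seq => v vs.
  apply: measurable_funM => //; apply: measurable_funM => //.
  by apply: measurable_funB => //; exact: m2.
Qed.

Let exceptionalE n c b h lam : exceptional n c b h lam =
  [set w | bad c b h lam (path_of Y (D n) w, path_of Y (D' n) w)].
Proof.
apply/funext => w; rewrite /exceptional /bad/=.
by congr (tail _ _ _ _ _ _ _); apply/funext => v; rewrite axE.
Qed.

Lemma measurable_exceptional n c b h lam : measurable (exceptional n c b h lam).
Proof.
rewrite exceptionalE -[X in measurable X]setTI; apply: measurable_fun_pair => //.
- exact: (measurable_path_of iY (D:=_)).
- exact: (measurable_path_of iY (D:=_)).
Qed.

(** With the first [n] levels frozen, the coefficients become deterministic and [bernstein_tail]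
    applies to the words of length [n + 1]. *)
Lemma exceptional_le n c b h lam : 0 < b -> 2 * b <= h ->
  (forall t, `|c t| <= 1) ->
  (P (exceptional n c b h lam) <= (expR (- lam))%:E)%E.
Proof.
move=> b0 bh c1.
rewrite exceptionalE.
apply: (independent2_prob_le (measurable_path_of iY (D:=_))
  (measurable_path_of iY (D:=_)) _ (mbad c b h lam)).
  apply: (path_independent iY).
  - by move=> v [].
  - by move=> v /= vn; rewrite /nonnil/= -size_eq0 vn.
  - by apply/seteqP; split => v //= [[_ +] vn]; rewrite vn ltnn.
move=> x.
have [aq|aq] := leP (\sum_(v <- words n.+1) ax v x `^ q) (b `^ q); last first.
  rewrite (_ : [set _ | _] = set0) ?measure0 ?lee_fin ?expR_ge0//.
  by apply/seteqP; split=> // w [] /=; rewrite leNgt aq.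
have nw : [::] \notin words n.+1 by rewrite mem_words.
have := @bernstein_tail _ T _ T0 R P P0 V Y iY V0 EV q M q1 VqM
  (words n.+1) (fun v => ax v x) c b h lam (uniq_words _) nw b0 bh.
move=> /(_ (fun t => normr_ge0 _) c1 aq).
congr (P _ <= _)%E; apply/seteqP; split=> w /= => [[]//|[]//].
Qed.

End conditional_tail_bound.

(** * Almost sure bounds for masses and increments *)

Lemma geometric_sum_le (R : realType) (r : R) N : 0 <= r < 1 ->
  \sum_(i < N) r ^+ i <= (1 - r)^-1.
Proof.
move=> /andP[r0 r1]; have r1' : 0 < 1 - r by rewrite subr_gt0.
rewrite -[leRHS]mul1r ler_pdivlMr// mulrC.
have <- : 1 - r ^+ N = (1 - r) * \sum_(i < N) r ^+ i.
  by rewrite -[LHS]opprB subrX1 -mulNr opprB.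
by rewrite gerBl exprn_ge0.
Qed.

Lemma borel_cantelli_geometric d (T : measurableType d) (R : realType)
    (P : probability T R) (F : nat -> set T) (C r : R) :
  0 <= C -> 0 <= r < 1 -> (forall n, measurable (F n)) ->
  (forall n, (P (F n) <= (C * r ^+ n)%:E)%E) ->
  {ae P, forall w, exists N, forall n, (N <= n)%N -> ~ F n w}.
Proof.
move=> C0 r01 mF PF.
have : P (lim_sup_set F) = 0%E.
  apply: lim_sup_set_cvg0 => //.
  apply: (@le_lt_trans _ _ (C * (1 - r)^-1)%:E); last exact: ltry.
  apply: lime_le; first by apply: is_cvg_nneseries => n _ _; exact: measure_ge0.
  apply: nearW => n.
  apply: (@le_trans _ _ (\sum_(0 <= i < n) (C * r ^+ i)%:E)%E).
    by apply: lee_sum => i _; exact: PF.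
  rewrite sumEFin lee_fin -mulr_sumr ler_wpM2l// big_mkord.
  exact: geometric_sum_le.
move=> H; exists (lim_sup_set F); split => //.
  by apply: bigcapT_measurable => n; apply: bigcup_measurable.
move=> w /= nw n _ /=; apply: contrapT => nF; apply: nw; exists n => k nk Fk.
by apply: nF; exists k.
Qed.

Lemma powR_exprn (R : realType) (x q : R) n : 0 <= x ->
  (x ^+ n) `^ q = (x `^ q) ^+ n.
Proof.
move=> x0; elim: n => [|n IH]; first by rewrite !expr0 powR1.
by rewrite !exprS powRM ?exprn_ge0// IH.
Qed.

Section partition_sums.
Context d (T : measurableType d) d0 (T0 : measurableType d0) (R : realType)
  (P : probability T R) (P0 : probability T0 R) (V : {RV P0 >-> R})
  (Y : seq bool -> T -> R).
Hypothesis iY : iid_family P (distribution P0 V) Y.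

Let mY v : measurable_fun setT (Y v). Proof. by have [] := iY. Qed.

(** The prefixes of [v] have distinct lengths, hence are distinct nonempty words carrying
    independent weights. *)
Lemma branch_integral (g : R -> R) (v : seq bool) (m : R) :
  measurable_fun setT g -> (forall x, 0 <= g x) ->
  (\int[P0]_w (g (V w))%:E = m%:E)%E ->
  (\int[P]_w (\prod_(1 <= j < (size v).+1) g (Y (take j v) w))%:E =
   (m ^+ size v)%:E)%E.
Proof.
move=> mg g0 Em.
pose s := [seq take j v | j <- iota 1 (size v)].
have us : uniq s.
  rewrite map_inj_in_uniq ?iota_uniq// => i j; rewrite !mem_iota !add1n !ltnS.
  move=> /andP[_ iv] /andP[_ jv] /(congr1 size).
  by rewrite !size_takel.
have s0 : [::] \notin s.
  apply/negP => /mapP[j]; rewrite mem_iota => /andP[j0 jv] /(congr1 size).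
  by rewrite size_takel// => /esym j0'; rewrite j0' in j0.
have := iid_integral_prod iY (f := fun _ => g) us s0 (fun _ => mg) (fun _ => g0).
rewrite Em prodEFin big_const_seq count_predT size_map size_iota -Monoid.iteropE.
rewrite [X in _ = X%:E -> _](_ : _ = m ^+ size v); last first.
  by elim: (size v) => //= k ->; rewrite exprS.
move=> <-; apply: eq_integral => w _; congr (_%:E).
by rewrite /s big_map /index_iota subSS subn0.
Qed.

Hypothesis Y0 : forall v w, 0 <= Y v w.
Variables (q M : R).
Hypothesis VqM : (\int[P0]_w (V w `^ q)%:E = M%:E)%E.

Definition mass v w := 2 ^- size v * cascade_weight Y v w.

Lemma mass_ge0 v w : 0 <= mass v w.
Proof.
by apply: mulr_ge0; [rewrite invr_ge0 exprn_ge0|exact: cascade_weight_ge0].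
Qed.

Definition partition_sum n w := \sum_(v <- words n) mass v w `^ q.

Lemma measurable_mass v : measurable_fun setT (mass v).
Proof. by apply: measurable_funM => //; apply: measurable_weight. Qed.

Lemma partition_sum_integral n :
  (\int[P]_w (partition_sum n w)%:E = ((2 * (2^-1 `^ q * M)) ^+ n)%:E)%E.
Proof.
have mp v : measurable_fun setT (fun w => (mass v w `^ q)).
  exact: (measurableT_comp (measurable_powR q) (measurable_mass v)).
under eq_integral do rewrite /partition_sum -sumEFin.
rewrite ge0_integral_sum//; last 2 first.
- by move=> v; exact/measurable_EFinP.
- by move=> v w _; rewrite lee_fin powR_ge0.
transitivity (\sum_(v <- words n) ((2^-1 `^ q * M) ^+ n)%:E)%E; last first.
  rewrite sumEFin big_const_seq count_predT size_words iter_addr addr0.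
  by rewrite [(2 * _) ^+ n]exprMn -natrX mulr_natl.
rewrite big_seq [RHS]big_seq; apply: eq_bigr => v.
rewrite mem_words => /eqP vn.
pose g (x : R) := 2^-1 `^ q * x `^ q.
have -> : (2^-1 `^ q * M) ^+ n = (2^-1 `^ q * M) ^+ size v by rewrite vn.
rewrite -(@branch_integral g)//; last 3 first.
- by apply: measurable_funM => //; exact: measurable_powR.
- by move=> x; rewrite mulr_ge0// powR_ge0.
- rewrite /g; under eq_integral do rewrite EFinM.
  rewrite ge0_integralZl// ?VqM//.
    by apply/measurable_EFinP; apply: (measurableT_comp (measurable_powR q)).
  by move=> w _; rewrite lee_fin powR_ge0.
apply: eq_integral => w _; congr (_%:E).
rewrite /mass /cascade_weight.
have -> : 2 ^- size v = \prod_(1 <= j < (size v).+1) 2^-1 :> R.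
  by rewrite prodr_const_nat subn1 exprVn.
rewrite -big_split/=; elim: (index_iota _ _) => [|j s IH].
  by rewrite !big_nil powR1.
rewrite !big_cons powRM ?IH ?mulr_ge0 ?invr_ge0// /g ?powRM ?invr_ge0//.
by apply: prodr_ge0 => i _; rewrite mulr_ge0 ?invr_ge0.
Qed.

(** The mean of the partition sum is the [n]-th power of the left side, so Markov and Borel-Cantelli
    apply. For [rho = 2 ^ (- s)] the hypothesis reads [(q - 1 - log2 M) / q > s]; this is how the
    endpoint exponent enters. *)
Lemma partition_sum_eventually (rho : R) : 0 < rho ->
  2 * (2^-1 `^ q * M) < rho `^ q ->
  {ae P, forall w, exists N, forall n, (N <= n)%N ->
     partition_sum n w <= (rho ^+ n) `^ q}.
Proof.
move=> rho0 Mrho.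
have M0 : 0 <= M.
  by rewrite -lee_fin -VqM integral_ge0// => w _; rewrite lee_fin powR_ge0.
set k := 2 * _ in Mrho *.
have k0 : 0 <= k by rewrite !mulr_ge0 ?powR_ge0.
have rq0 : 0 < rho `^ q by rewrite powR_gt0.
have mS n : measurable_fun setT (partition_sum n).
  apply: measurable_sum => v.
  exact: (measurableT_comp (measurable_powR q) (measurable_mass v)).
have S0 n w : 0 <= partition_sum n w by apply: sumr_ge0 => v _; exact: powR_ge0.
have := @borel_cantelli_geometric _ _ _ P
  (fun n => [set w | (rho ^+ n) `^ q <= partition_sum n w]) 1 (k / rho `^ q).
rewrite ler01 divr_ge0 ?(ltW rq0)//= ltr_pdivrMr// mul1r => /(_ isT Mrho) bc.
have {bc} := bc (fun n => measurable_set_ler (measurable_cst _) (mS n)).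
have e n : (rho ^+ n) `^ q = (rho `^ q) ^+ n.
  by rewrite powR_exprn// ltW.
have PF n : (P [set w | ((rho ^+ n) `^ q <= partition_sum n w)%R] <=
    (1 * (k / rho `^ q) ^+ n)%:E)%E.
  have rn0 : 0 < (rho ^+ n) `^ q by rewrite powR_gt0// exprn_gt0.
  have := @markov_le _ _ _ P _ _ (mS n) (S0 n) rn0.
  rewrite partition_sum_integral -/k.
  rewrite -lee_pdivlMl// => /le_trans; apply.
  by rewrite -EFinM lee_fin mul1r expr_div_n mulrC e.
move=> /(_ PF); apply: filterS => w [N HN]; exists N => n Nn.
by rewrite leNgt; apply/negP => h; apply: (HN n Nn) => /=; exact: ltW.
Qed.

End partition_sums.

Lemma measure_bigsetU_le d (T : measurableType d) (R : realType)
    (P : {measure set T -> \bar R}) (I : Type) (s : seq I) (E : I -> set T) :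
  (forall i, measurable (E i)) ->
  (P (\big[setU/set0]_(i <- s) E i) <= \sum_(i <- s) P (E i))%E.
Proof.
move=> mE; elim: s => [|i s IH]; first by rewrite !big_nil measure0.
rewrite !big_cons (le_trans (measureU2 _ _ _))// ?leeD2l//.
exact: bigsetU_measurable.
Qed.

Section concentration.
Context d (T : measurableType d) d0 (T0 : measurableType d0) (R : realType)
  (P : probability T R) (P0 : probability T0 R) (V : {RV P0 >-> R})
  (Y : seq bool -> T -> R).
Hypothesis iY : iid_family P (distribution P0 V) Y.
Hypothesis V0 : forall w, 0 <= V w.
Hypothesis Y0 : forall v w, 0 <= Y v w.
Hypothesis EV : (\int[P0]_w (V w)%:E = 1)%E.
Variables (q M : R).
Hypothesis q1 : 1 < q.
Hypothesis VqM : (\int[P0]_w (V w `^ q)%:E = M%:E)%E.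
Variable rho : R.
Hypothesis rho01 : 0 < rho <= 1.
Hypothesis Mrho : 2 * (2^-1 `^ q * M) < rho `^ q.

Local Notation mass := (mass Y).
Local Notation parent_mass := (parent_mass Y).
Local Notation partition_sum := (partition_sum Y q).

Definition level_mass n (c : seq bool -> R) w := \sum_(v <- words n) mass v w * c v.

Lemma parent_mass_rcons n u b w : size u = n ->
  parent_mass n (rcons u b) w = mass u w / 2.
Proof.
move=> un; rewrite /parent_mass /mass un -cats1 take_size_cat//.
by rewrite exprS invfM; ring.
Qed.

Lemma parent_massY n v w : size v = n.+1 -> parent_mass n v w * Y v w = mass v w.
Proof.
case/lastP: v => // u b; rewrite size_rcons => -[un].
rewrite parent_mass_rcons// /mass cascade_weight_rcons size_rcons exprS invfM.
by ring.
Qed.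

Lemma sum_parent_mass n (F : seq bool -> R) w :
  \sum_(v <- words n.+1) parent_mass n v w * F v =
  \sum_(u <- words n) mass u w * ((F (rcons u false) + F (rcons u true)) / 2).
Proof.
rewrite sum_wordsS big_seq [RHS]big_seq; apply: eq_bigr => u.
by rewrite mem_words => /eqP un; rewrite !parent_mass_rcons//; ring.
Qed.

Lemma deviationE n c w : deviation Y n c w = level_mass n.+1 c w -
  \sum_(u <- words n) mass u w * ((c (rcons u false) + c (rcons u true)) / 2).
Proof.
rewrite -sum_parent_mass /level_mass -sumrB /deviation big_seq [RHS]big_seq.
apply: eq_bigr => v; rewrite mem_words => /eqP vn.
by rewrite -(parent_massY _ vn); ring.
Qed.

Lemma parent_mass_ge0 n v w : 0 <= parent_mass n v w.
Proof.
by apply: mulr_ge0; [rewrite invr_ge0 exprn_ge0|exact: cascade_weight_ge0].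
Qed.

(** Each parent contributes [2 * 2 ^ (- q) <= 1] times the power of its own mass. *)
Lemma sum_parent_mass_powR n w :
  \sum_(v <- words n.+1) parent_mass n v w `^ q <= partition_sum n w.
Proof.
rewrite sum_wordsS big_seq [leRHS]big_seq; apply: ler_sum => u.
rewrite mem_words => /eqP un; rewrite !parent_mass_rcons//.
have m0 := mass_ge0 Y0 u w.
rewrite powRM// -mulrDr -[leRHS]mulr1 ler_wpM2l ?powR_ge0//.
have : (2^-1 : R) `^ q <= 2^-1.
  rewrite -[leRHS]powRr1//; apply: ger_powR; last exact: ltW.
  by rewrite invr_gt0 ltr0n/= invf_le1 ?ler1n.
move: (2^-1 `^ q) => x; lra.
Qed.

Lemma mass_le_partition_sum n v w (b : R) : 0 < b -> size v = n ->
  partition_sum n w <= b `^ q -> mass v w <= b.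
Proof.
move=> b0 vn Sb.
have q0 : 0 < q := lt_trans ltr01 q1.
have mv0 := mass_ge0 Y0 v w.
have : mass v w `^ q <= b `^ q.
  apply: le_trans Sb; rewrite /partition_sum (bigD1_seq v) ?mem_words ?vn ?uniq_words//=.
  by rewrite lerDl; apply: sumr_ge0 => u _; exact: powR_ge0.
apply: contraTT; rewrite -!ltNge => bm.
by rewrite gt0_ltr_powR// nnegrE// ltW.
Qed.

(** The choice [lam = n ^ 2] makes the failure probability beat every family of test functions whose
    size is exponential in [n]; the price is the polynomial factor in front of [h]. *)
Lemma concentration (I : nat -> finType) (c : forall n, I n -> seq bool -> R)
    (h : forall n, I n -> R) (C r : R) :
  (forall n i v, `|@c n i v| <= 1) -> (forall n i, 2 * rho ^+ n <= @h n i) ->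
  0 <= C -> 0 <= r < 1 ->
  (forall n, #|I n|%:R * expR (- (n%:R ^+ 2)) <= C * r ^+ n) ->
  {ae P, forall w, exists N, forall n, (N <= n)%N -> forall i : I n,
     deviation Y n (c n i) w <= n%:R ^+ 2 * h n i +
       2 * rho ^+ n * (\sum_(v <- words n.+1) parent_mass n v w * c n i v ^+ 2) / h n i
       + M * rho ^+ n}.
Proof.
move=> c1 rh C0 r01 IC; have /andP[rho0 rho1] := rho01.
have VqM' : (\int[P0]_w (V w `^ q)%:E <= M%:E)%E by rewrite VqM.
pose F n := \big[setU/set0]_(i : I n)
  exceptional Y q M n (c n i) (rho ^+ n) (h n i) (n%:R ^+ 2).
have mE n i : measurable (exceptional Y q M n (c n i) (rho ^+ n) (h n i) (n%:R ^+ 2)).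
  exact: (measurable_exceptional iY Y0).
have mF n : measurable (F n) by apply: bigsetU_measurable => i _; exact: mE.
have PF n : (P (F n) <= (C * r ^+ n)%:E)%E.
  apply: (@le_trans _ _ (\sum_(i : I n) P (exceptional Y q M n (c n i) (rho ^+ n) (h n i) (n%:R ^+ 2)))%E).
    exact: measure_bigsetU_le.
  apply: (@le_trans _ _ (\sum_(i : I n) (expR (- n%:R ^+ 2))%:E)%E).
    apply: lee_sum => i _; apply: (exceptional_le iY) => //.
    by rewrite exprn_gt0.
  by rewrite sumEFin sumr_const lee_fin -[leLHS]mulr_natl; exact: IC.
have := borel_cantelli_geometric C0 r01 mF PF.
have := partition_sum_eventually iY Y0 VqM rho0 Mrho.
apply: filterS2 => w [N1 HN1] [N2 HN2].
exists (maxn N1 N2) => n; rewrite geq_max => /andP[n1 n2] i.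
rewrite leNgt; apply/negP => dev; apply: (HN2 n n2).
rewrite /F -bigcup_seq; exists i; first by rewrite /= mem_index_enum.
split => //=.
- by apply: le_trans (sum_parent_mass_powR n w) _; exact: HN1.
(* The truncation does not act: the partition sum one level further bounds the masses by
   [rho ^ (n + 1) <= rho ^ n]. *)
- move=> v; rewrite mem_words => /eqP vn; rewrite parent_massY//.
  apply: (@le_trans _ _ (rho ^+ n.+1)); last by rewrite ler_wiXn2l// ltW.
  apply: (mass_le_partition_sum _ vn); first by rewrite exprn_gt0.
  by apply: HN1; rewrite (leq_trans n1).
Qed.

End concentration.

Section polynomial_times_geometric.
Context (R : realType).

Lemma nat_mul_expr_le (y : R) n : 0 <= y < 1 -> n%:R * y ^+ n <= (1 - y)^-1.
Proof.
move=> /andP[y0 y1]; apply: le_trans (@geometric_sum_le R y n _); last by rewrite y0.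
have -> : n%:R * y ^+ n = \sum_(i < n) y ^+ n by rewrite sumr_const card_ord mulr_natl.
apply: ler_sum => i _.
by apply: ler_wiXn2l; [|exact: ltW|exact: ltnW].
Qed.

Lemma quadratic_geometric (K a b : R) : 0 <= K -> 0 <= a < b ->
  exists2 C, 0 <= C & forall n, K * (n%:R ^+ 2 + 1) * a ^+ n <= C * b ^+ n.
Proof.
move=> K0 /andP[a0 ab]; have b0 : 0 < b by exact: le_lt_trans ab.
(* Since [(a / b) ^ n] is [(y ^ n) ^ 2], each of the two factors [n] is absorbed by one factor
   [y ^ n]. *)
pose y := Num.sqrt (a / b).
have y0 : 0 <= y by exact: sqrtr_ge0.
have y1 : y < 1.
  by rewrite -sqrtr1 ltr_sqrt// ltr_pdivrMr// mul1r.
have y2 : y ^+ 2 = a / b by rewrite sqr_sqrtr// divr_ge0// ltW.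
have y1' : 0 < (1 - y)^-1 by rewrite invr_gt0 subr_gt0.
exists (K * ((1 - y)^-1 ^+ 2 + 1)).
  by rewrite mulr_ge0// addr_ge0// sqr_ge0.
move=> n; have -> : a ^+ n = (y ^+ n) ^+ 2 * b ^+ n.
  by rewrite exprAC y2 -exprMn divfK// gt_eqF.
rewrite mulrA ler_pM2r ?exprn_gt0// -mulrA ler_wpM2l// mulrDl mul1r -exprMn.
apply: lerD.
  have ny0 : 0 <= n%:R * y ^+ n by rewrite mulr_ge0// exprn_ge0.
  rewrite ler_pXn2r// ?nnegrE ?ny0 ?(ltW y1')//.
  by apply: nat_mul_expr_le; rewrite y0.
by rewrite -exprM exprn_ile1// ltW.
Qed.

(** With [2 <= e] the claim reduces to [(k + 1) n - n^2 <= (k + 1)^2]. *)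
Lemma exp2n_gauss (k : nat) : exists2 C : R, 0 <= C &
  forall n, (2 ^ (k * n))%:R * expR (- n%:R ^+ 2) <= C * 2^-1 ^+ n.
Proof.
exists (expR (k.+1%:R ^+ 2)); first exact: expR_ge0.
move=> n; rewrite exprVn ler_pdivlMr ?exprn_gt0// mulrAC natrX -exprD.
have e2 : (2 : R) <= expR 1 by have := expR_ge1Dx (1 : R); rewrite -natr1.
apply: (@le_trans _ _ (expR 1 ^+ (k * n + n) * expR (- n%:R ^+ 2))).
  by rewrite ler_wpM2r ?expR_ge0//; apply: lerXn2r; rewrite ?nnegrE ?expR_ge0.
rewrite -expRM_natl mulr1 -expRD ler_expR -mulSnr natrM.
set x : R := k.+1%:R; set y : R := n%:R.
have : 0 <= (x - y / 2) ^+ 2 by exact: sqr_ge0.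
have : 0 <= y ^+ 2 by exact: sqr_ge0.
nra.
Qed.

End polynomial_times_geometric.

(** * The Frostman bound for cells *)

Section frostman.
Context d (T : measurableType d) d0 (T0 : measurableType d0) (R : realType)
  (P : probability T R) (P0 : probability T0 R) (V : {RV P0 >-> R})
  (Y : seq bool -> T -> R).
Hypothesis iY : iid_family P (distribution P0 V) Y.
Hypothesis V0 : forall w, 0 <= V w.
Hypothesis Y0 : forall v w, 0 <= Y v w.
Hypothesis EV : (\int[P0]_w (V w)%:E = 1)%E.
Variables (q M : R).
Hypothesis q1 : 1 < q.
Hypothesis VqM : (\int[P0]_w (V w `^ q)%:E = M%:E)%E.
Variable r : R.
Hypothesis r01 : 0 < r < 1.
Hypothesis Mr : 2 * (2^-1 `^ q * M) < (r ^+ 2) `^ q.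

Definition below (u t : seq bool) : R := (take (size u) t == u)%:R.

Lemma below_rcons u t b : (size u <= size t)%N -> below u (rcons t b) = below u t.
Proof. by move=> ut; rewrite /below -cats1 takel_cat. Qed.

Lemma level_mass_below n l u w : size u = l -> (l <= n)%N ->
  level_mass Y n (below u) w = \sum_(t <- words (n - l)) mass Y (u ++ t) w.
Proof.
move=> ul ln; rewrite /level_mass -{1}(subnKC ln) sum_words_cat.
rewrite (bigD1_seq u) ?uniq_words ?mem_words ?ul//= [X in _ + X]big1_seq ?addr0; last first.
  move=> u' /andP[u'u]; rewrite mem_words => /eqP u'l.
  apply: big1_seq => t _; rewrite /below ul -u'l take_size_cat//.
  by rewrite (negbTE u'u) mulr0.
by apply: eq_bigr => t _; rewrite /below take_size_cat// eqxx mulr1.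
Qed.

Lemma level_mass_below_le n l k (u : seq bool) w : size u = k -> (l <= k <= n)%N ->
  level_mass Y n (below u) w <= level_mass Y n (below (take l u)) w.
Proof.
move=> uk /andP[lk kn]; apply: ler_sum => t _; apply: ler_wpM2l; first exact: mass_ge0.
rewrite /below size_takel ?uk//; case: eqP => [tu|_]; last by rewrite ler0n.
by rewrite -tu take_takel// eqxx.
Qed.

Let gronwall (e : nat -> R) (m : nat -> R) (k : nat) : (forall i, 0 <= e i) ->
  (forall i, m i.+1 <= (1 + r ^+ i) * m i + e i) -> (forall i, 0 <= m i) ->
  m k <= expR (\sum_(i < k) r ^+ i) * (m 0 + \sum_(i < k) e i).
Proof.
move=> e0 mS m0; elim: k => [|k IH]; first by rewrite !big_ord0 expR0 mul1r addr0.
have r0 : 0 <= r by have /andP[/ltW] := r01.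
have rk0 : 0 <= r ^+ k by rewrite exprn_ge0.
apply: le_trans (mS k) _.
rewrite !big_ord_recr/= expRD addrA mulrDr lerD//.
  rewrite mulrC [leRHS]mulrAC ler_pM ?addr_ge0//; exact: expR_ge1Dx.
apply: ler_peMl => //; rewrite -expRD -expR0 ler_expR addr_ge0// sumr_ge0// => i _.
by rewrite exprn_ge0.
Qed.

(** The test function is the indicator of a cell of length [l], with Bernstein scale
    [2 r ^ (n + l)]. The quadratic term then is [r ^ (n - l)] times the current mass and the other
    errors are of order [n^2 r ^ (n + l)]. Starting from a mass at most [r ^ (2 l)], a discrete
    Gronwall argument with the summable rates [r ^ (n - l)] keeps this order; [r1 > r] absorbs the
    polynomial. *)
Lemma frostman (r1 : R) : r < r1 < 1 ->
  {ae P, forall w, exists C N, 0 <= C /\ forall n l u, (N <= n)%N -> (l <= n)%N ->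
    size u = l -> level_mass Y n (below u) w <= C * r1 ^+ (2 * l)}.
Proof.
move=> /andP[rr1 r11]; have /andP[r0 r_1] := r01.
have r10 : 0 < r1 by apply: lt_trans rr1.
have M0 : 0 <= M.
  by rewrite -lee_fin -VqM integral_ge0// => w _; rewrite lee_fin powR_ge0.
(* The pair of a length [l <= n] and a word of length [n] encodes the prefix of length [l]; every
   word of length at most [n] occurs. *)
pose I n : finType := ('I_n.+1 * n.-tuple bool)%type.
pose c n (i : I n) := below (take i.1 i.2).
pose h n (i : I n) := 2 * r ^+ (n + i.1).
have r2 : 0 < r ^+ 2 <= 1 by rewrite exprn_gt0//= exprn_ile1// ltW.
have [C C0 hC] := exp2n_gauss R 2.
have hI n : #|I n|%:R * expR (- n%:R ^+ 2) <= C * 2^-1 ^+ n.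
  apply: le_trans (hC n); rewrite ler_wpM2r ?expR_ge0// ler_nat.
  by rewrite card_prod card_ord card_tuple card_bool mul2n -addnn expnD leq_mul// ltn_expl.
have c1 n i v : `|@c n i v| <= 1.
  by rewrite /c /below; case: eqP => _; rewrite ?normr0 ?normr1.
have hh n i : 2 * (r ^+ 2) ^+ n <= @h n i.
  rewrite /h ler_wpM2l// -exprM mul2n -addnn ler_wiXn2l ?ltW//.
  by rewrite leq_add2l -ltnS ltn_ord.
have half : 0 <= (2^-1 : R) < 1 by rewrite invr_ge0 ler0n/= invf_lt1// ltr1n.
have := concentration iY V0 Y0 EV q1 VqM r2 Mr c1 hh C0 half hI.
have /andP[r20 _] := r2.
have := partition_sum_eventually iY Y0 VqM r20 Mr.
have rr10 : 0 <= r < r1 by rewrite (ltW r0).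
have [C1 C10 hC1] := quadratic_geometric (addr_ge0 (ler0n R 2) M0) rr10.
have r1m : 0 < 1 - r1 by rewrite subr_gt0.
pose K := expR ((1 - r)^-1) * (1 + C1 / (1 - r1)).
have K0 : 0 <= K.
  by rewrite mulr_ge0 ?expR_ge0// addr_ge0// divr_ge0// ltW.
apply: filterS2 => w [N1 HN1] [N2 HN2].
pose N := maxn N1 N2.
have step l i u : (N <= l)%N -> size u = l ->
    level_mass Y (l + i).+1 (below u) w <=
    (1 + r ^+ i) * level_mass Y (l + i) (below u) w +
    (2 * (l + i)%:R ^+ 2 + M) * r ^+ (l + i + l).
  rewrite geq_max => /andP[_ Nl] ul.
  have szt : size (u ++ nseq i false) == (l + i)%N by rewrite size_cat size_nseq ul.
  have ln : (l < (l + i).+1)%N by rewrite ltnS leq_addr.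
  have := HN2 _ (leq_trans Nl (leq_addr i l)) (Ordinal ln, Tuple szt).
  rewrite /c /h /= take_size_cat//.
  rewrite deviationE.
  have -> : \sum_(t <- words (l + i)) mass Y t w *
      ((below u (rcons t false) + below u (rcons t true)) / 2) =
      level_mass Y (l + i) (below u) w.
    rewrite /level_mass big_seq [RHS]big_seq; apply: eq_bigr => t.
    rewrite mem_words => /eqP tn; rewrite !below_rcons ?ul ?tn ?leq_addr//.
    by field.
  have -> : \sum_(v <- words (l + i).+1) parent_mass Y (l + i) v w * below u v ^+ 2 =
      level_mass Y (l + i) (below u) w.
    rewrite (@sum_parent_mass _ _ _ Y (l + i) (fun v => below u v ^+ 2)).
    rewrite /level_mass big_seq [RHS]big_seq; apply: eq_bigr => t.
    rewrite mem_words => /eqP tn; rewrite !below_rcons ?ul ?tn ?leq_addr//.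
    congr (_ * _); rewrite /below.
    by case: eqP => _; rewrite /= ?mulr1n ?mulr0n; field.
  set m := level_mass _ (l + i) _ _; set m' := level_mass _ _.+1 _ _.
  have rn : 0 < r ^+ (l + i + l) by rewrite exprn_gt0.
  have -> : 2 * r ^+ 2 ^+ (l + i) * m / (2 * r ^+ (l + i + l)) = r ^+ i * m.
    have -> : r ^+ 2 ^+ (l + i) = r ^+ i * r ^+ (l + i + l).
      by rewrite -exprM -exprD; congr (_ ^+ _); clear; lia.
    by field; rewrite gt_eqF.
  have Mle : M * r ^+ 2 ^+ (l + i) <= M * r ^+ (l + i + l).
    by rewrite ler_wpM2l// -exprM ler_wiXn2l ?ltW//; clear; lia.
  move: ((l + i)%:R ^+ 2) => x; nra.
have main n l u : (N <= l)%N -> (l <= n)%N -> size u = l ->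
    level_mass Y n (below u) w <= K * r1 ^+ (2 * l).
  move=> Nl ln ul; rewrite -(subnKC ln).
  pose e i := (2 * (l + i)%:R ^+ 2 + M) * r ^+ (l + i + l).
  have e0 i : 0 <= e i.
    by rewrite mulr_ge0 ?exprn_ge0 ?(ltW r0)// addr_ge0// mulr_ge0// sqr_ge0.
  pose m i := level_mass Y (l + i) (below u) w.
  have m0 i : 0 <= m i.
    apply: sumr_ge0 => t _; apply: mulr_ge0; first exact: mass_ge0.
    by rewrite /below ler0n.
  have mS i : m i.+1 <= (1 + r ^+ i) * m i + e i by rewrite /m addnS; exact: step.
  apply: le_trans (gronwall (n - l) e0 mS m0) _.
  rewrite /K -mulrA ler_pM ?expR_ge0//.
  - by rewrite addr_ge0// sumr_ge0.
  - by rewrite ler_expR; apply: geometric_sum_le; rewrite (ltW r0).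
  rewrite mulrDl mul1r lerD//.
    rewrite /m addn0 (level_mass_below w ul (leqnn l)) subnn sum_words0 cats0.
    apply: (@le_trans _ _ (r ^+ (2 * l))); last first.
      by apply: lerXn2r; rewrite ?nnegrE ?ltW.
    rewrite exprM; apply: (mass_le_partition_sum Y0 q1 _ ul); first by rewrite exprn_gt0.
    by apply: HN1; rewrite (leq_trans _ Nl)// leq_maxl.
  apply: (@le_trans _ _ (\sum_(i < n - l) C1 * r1 ^+ (2 * l) * r1 ^+ i)).
    apply: ler_sum => i _; rewrite /e exprD mulrA.
    have -> : C1 * r1 ^+ (2 * l) * r1 ^+ i = C1 * r1 ^+ (l + i) * r1 ^+ l.
      by rewrite -mulrA -exprD -[RHS]mulrA -exprD; congr (_ * _ ^+ _); clear; lia.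
    rewrite ler_pM ?exprn_ge0 ?(ltW r0)//.
    - by rewrite mulr_ge0 ?exprn_ge0 ?(ltW r0)// addr_ge0// mulr_ge0// sqr_ge0.
    - apply: le_trans (hC1 _); rewrite ler_wpM2r ?exprn_ge0 ?(ltW r0)//.
      have : 0 <= (l + i)%:R ^+ 2 :> R by exact: sqr_ge0.
      move: ((l + i)%:R ^+ 2) => x x0; nra.
    - by apply: lerXn2r; rewrite ?nnegrE ?ltW.
  rewrite -mulr_sumr -[leRHS]mulrA [_^-1 * _]mulrC mulrA.
  rewrite ler_wpM2l ?mulr_ge0 ?exprn_ge0 ?(ltW r10)//.
  by apply: geometric_sum_le; rewrite (ltW r10).
clearbody K.
(* Words shorter than [N] are bounded by the total mass, which is at most [2 ^ N] cells of level [N]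
   times [K]; the division makes the bound fit [r1 ^ (2 l)]. *)
have X0 : 0 <= (2 ^ N)%:R * K / r1 ^+ (2 * N).
  by apply: divr_ge0; [exact: mulr_ge0|rewrite exprn_ge0// ltW].
exists ((2 ^ N)%:R * K / r1 ^+ (2 * N) + K), N; split; first by rewrite addr_ge0.
move=> n l u Nn ln ul; rewrite mulrDl.
have [Nl|lN] := leqP N l.
  by apply: le_trans (main _ _ _ Nl ln ul) _; rewrite lerDr mulr_ge0// exprn_ge0// ltW.
apply: (@le_trans _ _ ((2 ^ N)%:R * K)); last first.
  have r1l : 0 <= K * r1 ^+ (2 * l) by rewrite mulr_ge0// exprn_ge0// ltW.
  apply: ler_wpDr => //; rewrite -[leRHS]mulrA ler_peMr ?mulr_ge0//.
  rewrite mulrC ler_pdivlMr ?exprn_gt0// mul1r ler_wiXn2l ?ltW//; clear -lN; lia.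
apply: le_trans (level_mass_below_le w ul (l := 0) _) _; first by rewrite ln.
rewrite take0 (level_mass_below (u := [::]) w erefl (leq0n n)) subn0 -(subnKC Nn) sum_words_cat.
apply: (@le_trans _ _ (\sum_(t <- words N) K)); last first.
  by rewrite big_const_seq count_predT size_words iter_addr addr0 mulr_natl.
rewrite big_seq [leRHS]big_seq; apply: ler_sum => t; rewrite mem_words => /eqP tN.
have := main n N t (leqnn _) Nn tN; rewrite (level_mass_below w tN Nn).
move=> /le_trans; apply; rewrite ler_piMr// exprn_ile1// ltW//.
Qed.

End frostman.

Section arithmetic.
Context (R : realType).
Implicit Types x y z M : R.

Lemma addr1_le_quadratic x : x + 1 <= 2 * (x ^+ 2 + 1).
Proof.
have : 0 <= (2 * x - 1) ^+ 2 by exact: sqr_ge0.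
nra.
Qed.

Lemma increment_arith x y z M : 0 <= x -> 0 <= y -> 0 <= M ->
  y * (2 * x) + z * (2 * (y + 1)) * x + M * x <= (2 + 2 * z + M) * (y + 1) * x.
Proof.
move=> x0 y0 M0; rewrite -subr_ge0.
have -> : (2 + 2 * z + M) * (y + 1) * x - (y * (2 * x) + z * (2 * (y + 1)) * x + M * x) =
  x * (2 + M * y) by ring.
by rewrite mulr_ge0// addr_ge0// mulr_ge0.
Qed.

Lemma base_arith x y M : 0 <= x -> 0 <= y -> 0 <= M ->
  y * (x + 1) <= (2 + 2 * y + M) * (x ^+ 2 + 1).
Proof.
move=> x0 y0 M0; have := ler_wpM2l y0 (addr1_le_quadratic x).
have : 0 <= (2 + M) * (x ^+ 2 + 1) by rewrite mulr_ge0// addr_ge0// sqr_ge0.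
nra.
Qed.

End arithmetic.

(** * Decay of coefficients at scale m, uniformly over exponentially many frequencies *)

Section uniform_decay.
Context d (T : measurableType d) d0 (T0 : measurableType d0) (R : realType)
  (P : probability T R) (P0 : probability T0 R) (V : {RV P0 >-> R})
  (Y : seq bool -> T -> R).
Hypothesis iY : iid_family P (distribution P0 V) Y.
Hypothesis V0 : forall w, 0 <= V w.
Hypothesis Y0 : forall v w, 0 <= Y v w.
Hypothesis EV : (\int[P0]_w (V w)%:E = 1)%E.
Variables (q M : R).
Hypothesis q1 : 1 < q.
Hypothesis VqM : (\int[P0]_w (V w `^ q)%:E = M%:E)%E.
Variables r r1 r2 : R.
Hypothesis r0 : 0 < r.
Hypothesis rr1 : r < r1.
Hypothesis r12 : r1 < r2.
Hypothesis r21 : r2 < 1.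
Hypothesis Mr : 2 * (2^-1 `^ q * M) < (r ^+ 2) `^ q.

Variables (J : nat -> finType) (K0 k0 : nat).
Hypothesis cardJ : forall m, (#|J m| <= K0 * 2 ^ (k0 * m))%N.
Variable c : forall m, J m -> nat -> seq bool -> R.
Hypothesis c_avg : forall m j n v, size v = n ->
  (@c m j n.+1 (rcons v false) + c j n.+1 (rcons v true)) / 2 = c j n v.
Hypothesis c1 : forall m j n v, `|@c m j n v| <= 1.
Variable C0 : R.
Hypothesis C0ge0 : 0 <= C0.
(* [2 * m - n] is truncated: from level [2 * m] on, the only block is the whole interval. *)
Hypothesis c_block : forall m j n, (m <= n)%N -> exists2 g : seq bool -> R,
  (forall v, size v = n.+1 -> `|@c m j n.+1 v| <= g (take (2 * m - n) v)) &
  \sum_(u <- words (2 * m - n)) g u <= C0 * (2 * m - n).+1%:R.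

Let r10 : 0 < r1. Proof. exact: lt_trans rr1. Qed.
Let r20 : 0 < r2. Proof. exact: lt_trans r12. Qed.
Let r11 : r1 < 1. Proof. exact: lt_trans r21. Qed.

(** Level [n] serves all scales [m <= n] at once; the boolean is a sign, which turns one-sided
    bounds into bounds of absolute values. *)
Let I n : finType := ({m : 'I_n.+1 & J m} * bool)%type.
Let cI n (i : I n) (v : seq bool) : R := (-1) ^+ i.2 * c (tagged i.1) n.+1 v.
(** The exponent is the maximum of [n] and [2 m]. With [k = 2 m - n], the variance is of order
    [r1 ^ (2 n)] times the block energy [r1 ^ (2 k)], up to polynomial factors, so [r1 ^ (n + k)] is
    the size of the standard deviation. *)
Let hI n (i : I n) : R := 2 * r1 ^+ (n + (2 * tag i.1 - n)).

Let cardI n : (#|I n| <= 2 * K0 * 2 ^ (k0.+1 * n))%N.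
Proof.
rewrite /I card_prod card_bool mulnC -mulnA leq_mul2l/= card_tagged.
rewrite sumnE big_map big_enum/=.
apply: (@leq_trans (\sum_(m < n.+1) K0 * 2 ^ (k0 * n))).
  apply: leq_sum => m _; apply: leq_trans (cardJ m) _.
  by rewrite leq_mul2l leq_exp2l// leq_mul2l -ltnS ltn_ord !orbT.
rewrite sum_nat_const card_ord mulnCA leq_mul2l; apply/orP; right.
by rewrite [(k0.+1 * n)%N]mulSn expnD leq_mul// ltn_expl.
Qed.

(** As coefficients are at most 1, their squares are bounded by [g], which depends on the block
    only. Each block of level [k = 2 m - n] has mass at most [CF r1 ^ (2 k)], and [g] sums to a
    multiple of [k + 1]. *)
Let block_energy w CF N m (j : J m) n : 0 <= CF -> (m <= n)%N -> (N <= n)%N ->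
  (forall n l u, (N <= n)%N -> (l <= n)%N ->
    size u = l -> level_mass Y n (below R u) w <= CF * r1 ^+ (2 * l)) ->
  \sum_(v <- words n.+1) parent_mass Y n v w * c j n.+1 v ^+ 2 <=
    CF * C0 * (2 * m - n).+1%:R * r1 ^+ (2 * (2 * m - n)).
Proof.
move=> CF0 mn Nn HF; have [g cg sg] := c_block j mn.
set k := (2 * m - n)%N in cg sg *.
have kn : (k <= n)%N by rewrite /k; clear -mn; lia.
apply: (@le_trans _ _ (\sum_(v <- words n.+1) parent_mass Y n v w * g (take k v))).
  rewrite big_seq [leRHS]big_seq; apply: ler_sum => v; rewrite mem_words => /eqP vn.
  apply: ler_wpM2l; first exact: parent_mass_ge0.
  apply: le_trans (cg _ vn); rewrite -real_normK ?num_real// expr2.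
  by rewrite ler_piMr.
rewrite sum_parent_mass.
have -> : \sum_(t <- words n) mass Y t w *
    ((g (take k (rcons t false)) + g (take k (rcons t true))) / 2) =
    \sum_(t <- words n) mass Y t w * g (take k t).
  rewrite big_seq [RHS]big_seq; apply: eq_bigr => t; rewrite mem_words => /eqP tn.
  by rewrite -!cats1 !takel_cat ?tn//; field.
rewrite -{1}(subnKC kn) sum_words_cat.
have -> : \sum_(u <- words k) \sum_(s <- words (n - k)) mass Y (u ++ s) w * g (take k (u ++ s)) =
    \sum_(u <- words k) level_mass Y n (below R u) w * g u.
  rewrite big_seq [RHS]big_seq; apply: eq_bigr => u; rewrite mem_words => /eqP uk.
  rewrite (level_mass_below Y w uk kn) mulr_suml; apply: eq_bigr => s _.
  by rewrite take_size_cat.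
have g0 u : size u = k -> 0 <= g u.
  move=> uk; have := cg (u ++ nseq (n.+1 - k) false).
  rewrite size_cat size_nseq uk subnKC ?(leq_trans kn)// take_size_cat//.
  by move=> /(_ erefl); apply: le_trans.
apply: (@le_trans _ _ (\sum_(u <- words k) CF * r1 ^+ (2 * k) * g u)).
  rewrite big_seq [leRHS]big_seq; apply: ler_sum => u; rewrite mem_words => /eqP uk.
  by rewrite ler_wpM2r ?g0//; exact: HF.
rewrite -mulr_sumr.
have -> : CF * C0 * k.+1%:R * r1 ^+ (2 * k) = CF * r1 ^+ (2 * k) * (C0 * k.+1%:R) by ring.
by rewrite ler_wpM2l// mulr_ge0// exprn_ge0// ltW.
Qed.

(** At level [m] the Frostman bound alone suffices, summed against [g]; from there on, the
    increments of the levels [n >= m] are summed. No cancellation is used at or before level [m]. *)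
Lemma uniform_decay :
  {ae P, forall w, exists C N, forall m (j : J m) p, (N <= m)%N -> (m <= p)%N ->
     `|level_mass Y p (c j p) w| <= C * r2 ^+ (2 * m)}.
Proof.
have M0 : 0 <= M.
  by rewrite -lee_fin -VqM integral_ge0// => w _; rewrite lee_fin powR_ge0.
have r_1 : r < 1 by exact: lt_trans r11.
have rho01 : 0 < r ^+ 2 <= 1 by rewrite exprn_gt0//= exprn_ile1// ltW.
have [Cg Cg0 hCg] := exp2n_gauss R k0.+1.
have hcard n : #|I n|%:R * expR (- n%:R ^+ 2) <= (2 * K0)%:R * Cg * 2^-1 ^+ n.
  rewrite -mulrA; apply: (@le_trans _ _ ((2 * K0)%:R * ((2 ^ (k0.+1 * n))%:R * expR (- n%:R ^+ 2)))).
    by rewrite mulrA ler_wpM2r ?expR_ge0// -natrM ler_nat.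
  by rewrite ler_wpM2l.
have cI1 n i v : `|@cI n i v| <= 1.
  by rewrite /cI normrM normrX normrN1 expr1n mul1r.
have hh n (i : I n) : 2 * (r ^+ 2) ^+ n <= hI i.
  rewrite /hI ler_wpM2l// -exprM.
  apply: (@le_trans _ _ (r1 ^+ (2 * n))); first by apply: lerXn2r; rewrite ?nnegrE ?ltW.
  rewrite ler_wiXn2l ?(ltW r10) ?(ltW r11)//.
  have := ltn_ord (tag i.1); move: (tag i.1 : nat) => m; clear; lia.
have half : 0 <= (2^-1 : R) < 1 by rewrite invr_ge0 ler0n/= invf_lt1// ltr1n.
have hconc := concentration iY V0 Y0 EV q1 VqM rho01 Mr cI1 hh
  (mulr_ge0 (ler0n R (2 * K0)) Cg0) half hcard.
have r01 : 0 < r < 1 by rewrite r0.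
have rr11 : r < r1 < 1 by rewrite rr1.
have hfrost := frostman iY V0 Y0 EV q1 VqM r01 Mr rr11.
apply: filterS2 hconc hfrost => w [N1 HN1] [CF [N2 [CF0 HF]]].
pose K := 2 + 2 * (CF * C0) + M.
have CC0 : 0 <= CF * C0 by exact: mulr_ge0.
have K0' : 0 <= K by rewrite /K !addr_ge0// mulr_ge0.
(* The gap between [r1] and [r2] is spent twice: from [r1] to [r3] on polynomial factors, and from
   [r3] to [r2] on the factor [s ^ n] that makes the increments summable. *)
pose r3 := (r1 + r2) / 2.
have [r13' r32] := midf_lt r12; rewrite -/r3 in r13' r32.
have r13 : 0 <= r1 < r3 by rewrite (ltW r10).
have r30 : 0 < r3 by case/andP: r13; apply: le_lt_trans.
have [Cq Cq0 hCq] := quadratic_geometric K0' r13.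
pose s := r3 / r2.
have s01 : 0 <= s < 1 by rewrite divr_ge0 ?(ltW r30) ?(ltW r20)//= ltr_pdivrMr// mul1r.
have /andP[s0 s1] := s01.
have main_r m n : (m <= n)%N -> K * (n%:R ^+ 2 + 1) * r1 ^+ (n + (2 * m - n)) <=
    Cq * r2 ^+ (2 * m) * s ^+ n.
  move=> mn; set N' := (n + (2 * m - n))%N.
  have nN' : (n <= N')%N by exact: leq_addr.
  have mN' : (2 * m <= N')%N by rewrite /N'; clear; lia.
  apply: (@le_trans _ _ (K * (N'%:R ^+ 2 + 1) * r1 ^+ N')).
    rewrite ler_wpM2r ?exprn_ge0 ?(ltW r10)// ler_wpM2l// lerD2r.
    by apply: lerXn2r; rewrite ?nnegrE ?ler_nat.
  apply: le_trans (hCq _) _; rewrite -mulrA ler_wpM2l//.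
  have -> : r3 = r2 * s by rewrite /s mulrCA divff ?mulr1// gt_eqF.
  rewrite exprMn ler_pM ?exprn_ge0 ?(ltW r20)//.
  - by rewrite ler_wiXn2l ?(ltW r20) ?(ltW r21).
  - by rewrite ler_wiXn2l ?(ltW s1).
pose N := maxn N1 N2.
have incr m (j : J m) n : (N <= m)%N -> (m <= n)%N ->
    `|level_mass Y n.+1 (c j n.+1) w - level_mass Y n (c j n) w| <=
    Cq * r2 ^+ (2 * m) * s ^+ n.
  rewrite geq_max => /andP[n1 n2] mn.
  apply: le_trans (main_r _ _ mn).
  have mo : (m < n.+1)%N by [].
  have HI b := HN1 n (leq_trans n1 mn) (Tagged (fun m : 'I_n.+1 => J m) (j : J (Ordinal mo)), b).
  set k := (2 * m - n)%N in HI *.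
  have -> : level_mass Y n (c j n) w = \sum_(t <- words n) mass Y t w *
      ((c j n.+1 (rcons t false) + c j n.+1 (rcons t true)) / 2).
    rewrite /level_mass big_seq [RHS]big_seq; apply: eq_bigr => t.
    by rewrite mem_words => /eqP tn; rewrite c_avg.
  rewrite -(deviationE Y n (c j n.+1) w).
  have energy b : \sum_(v <- words n.+1) parent_mass Y n v w *
      @cI n (Tagged (fun m : 'I_n.+1 => J m) (j : J (Ordinal mo)), b) v ^+ 2 <=
      CF * C0 * k.+1%:R * r1 ^+ (2 * k).
    apply: le_trans (block_energy j CF0 mn (leq_trans n2 mn) HF).
    rewrite le_eqVlt; apply/orP; left; apply/eqP; apply: eq_bigr => v _.
    by rewrite /cI/= exprMn -exprM mulnC exprM sqrrN expr1n expr1n mul1r.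
  have dev b : deviation Y n (@cI n (Tagged (fun m : 'I_n.+1 => J m) (j : J (Ordinal mo)), b)) w =
      (-1) ^+ b * deviation Y n (c j n.+1) w.
    by rewrite /deviation mulr_sumr; apply: eq_bigr => v _; rewrite /cI/= -mulrA.
  have bound (b : bool) : (-1) ^+ b * deviation Y n (c j n.+1) w <=
      K * (n%:R ^+ 2 + 1) * r1 ^+ (n + k).
    rewrite -dev; apply: le_trans (HI b) _; rewrite /hI/= -/k.
    have rk0 : 0 < r1 ^+ (n + k) by rewrite exprn_gt0.
    have e2 : (r ^+ 2) ^+ n <= r1 ^+ (2 * n).
      by rewrite -exprM; apply: lerXn2r; rewrite ?nnegrE ?ltW.
    have e3 : r1 ^+ (2 * n) <= r1 ^+ (n + k).
      by rewrite ler_wiXn2l ?(ltW r10) ?(ltW r11)// /k; clear -mn; lia.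
    have e4 : r1 ^+ (2 * n) * r1 ^+ (2 * k) = r1 ^+ (n + k) * r1 ^+ (n + k).
      by rewrite -!exprD; congr (_ ^+ _); clear; lia.
    have nk : (k.+1%:R : R) <= 2 * (n%:R ^+ 2 + 1).
      have h1 : (k.+1 <= n.+1)%N by rewrite /k; clear -mn; lia.
      apply: (@le_trans _ _ n.+1%:R); first by rewrite ler_nat.
      by rewrite -natr1; exact: addr1_le_quadratic.
    have n20 : (0 : R) <= n%:R ^+ 2 by exact: sqr_ge0.
    set E := \sum_(v <- _) _.
    have hE : 2 * (r ^+ 2) ^+ n * E / (2 * r1 ^+ (n + k)) <=
        CF * C0 * (2 * (n%:R ^+ 2 + 1)) * r1 ^+ (n + k).
      have -> : 2 * (r ^+ 2) ^+ n * E / (2 * r1 ^+ (n + k)) = (r ^+ 2) ^+ n * E / r1 ^+ (n + k).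
        by field; rewrite gt_eqF.
      rewrite ler_pdivrMr//.
      have E0 : 0 <= E.
        by apply: sumr_ge0 => v _; rewrite mulr_ge0 ?sqr_ge0// parent_mass_ge0.
      apply: (@le_trans _ _ (r1 ^+ (2 * n) * (CF * C0 * k.+1%:R * r1 ^+ (2 * k)))).
        by apply: ler_pM => //; [apply: exprn_ge0; exact: sqr_ge0|exact: energy].
      have -> : r1 ^+ (2 * n) * (CF * C0 * k.+1%:R * r1 ^+ (2 * k)) =
          CF * C0 * k.+1%:R * (r1 ^+ (2 * n) * r1 ^+ (2 * k)) by ring.
      rewrite e4 -[leRHS]mulrA; apply: ler_wpM2r; first by apply: mulr_ge0; exact: ltW.
      by rewrite ler_wpM2l.
    apply: le_trans (lerD (lerD (lexx _) hE) (ler_wpM2l M0 (le_trans e2 e3))) _.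
    by apply: increment_arith => //; exact: ltW.
  by rewrite ler_norml lerNl -mulN1r (bound true) -[leLHS]mul1r (bound false).
exists (Cq + Cq / (1 - s)), N => m j p Nm mp.
have n2 : (N2 <= m)%N by rewrite (leq_trans _ Nm)// leq_maxr.
have base : `|level_mass Y m (c j m) w| <= Cq * r2 ^+ (2 * m).
  have [g cg sg] := c_block j (leqnn m).
  have em : (2 * m - m = m)%N by clear; lia.
  rewrite em in cg sg.
  (* The block hypothesis speaks of level [m + 1]; level [m] inherits the bound, a coefficient being
     the average of its two children. *)
  have cgm u : size u = m -> `|c j m u| <= g u.
    move=> um; rewrite -c_avg// normrM [`|2^-1|]ger0_norm ?invr_ge0//.
    rewrite ler_pdivrMr// mulr_natr mulr2n.
    apply: le_trans (ler_normD _ _) _; apply: lerD.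
      by have := cg (rcons u false); rewrite size_rcons um -cats1 take_size_cat//; apply.
    by have := cg (rcons u true); rewrite size_rcons um -cats1 take_size_cat//; apply.
  apply: (@le_trans _ _ (\sum_(u <- words m) CF * r1 ^+ (2 * m) * g u)).
    apply: le_trans (ler_norm_sum _ _ _) _.
    rewrite big_seq [leRHS]big_seq; apply: ler_sum => u; rewrite mem_words => /eqP um.
    rewrite normrM (ger0_norm (mass_ge0 Y0 u w)) ler_pM ?mass_ge0 ?cgm//.
    have := HF m m u n2 (leqnn m) um; rewrite (level_mass_below Y w um (leqnn m)).
    by rewrite subnn sum_words0 cats0.
  rewrite -mulr_sumr.
  apply: (@le_trans _ _ (CF * r1 ^+ (2 * m) * (C0 * m.+1%:R))).
    by rewrite ler_wpM2l// mulr_ge0// exprn_ge0// ltW.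
  have := main_r m m (leqnn m); rewrite em addnn -mul2n => h.
  apply: (@le_trans _ _ (Cq * r2 ^+ (2 * m) * s ^+ m)); last first.
    by rewrite ler_piMr ?mulr_ge0 ?exprn_ge0 ?(ltW r20)// exprn_ile1// ltW.
  apply: le_trans h.
  have -> : CF * r1 ^+ (2 * m) * (C0 * m.+1%:R) = CF * C0 * m.+1%:R * r1 ^+ (2 * m) by ring.
  rewrite ler_wpM2r ?exprn_ge0 ?(ltW r10)// -natr1 /K.
  exact: base_arith.
have tele : `|level_mass Y p (c j p) w - level_mass Y m (c j m) w| <=
    Cq * r2 ^+ (2 * m) * \sum_(i < p) s ^+ i.
  rewrite -(subnKC mp); elim: (p - m)%N => [|i IH].
    rewrite addn0 subrr normr0 mulr_ge0 ?mulr_ge0 ?exprn_ge0 ?(ltW r20)//.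
    by apply: sumr_ge0 => ? _; rewrite exprn_ge0.
  rewrite addnS big_ord_recr/= mulrDr.
  have -> : level_mass Y (m + i).+1 (c j (m + i).+1) w - level_mass Y m (c j m) w =
    (level_mass Y (m + i) (c j (m + i)) w - level_mass Y m (c j m) w) +
    (level_mass Y (m + i).+1 (c j (m + i).+1) w - level_mass Y (m + i) (c j (m + i)) w).
    by ring.
  apply: le_trans (ler_normD _ _) (lerD IH _).
  by apply: incr => //; exact: leq_addr.
have -> : level_mass Y p (c j p) w = level_mass Y m (c j m) w +
    (level_mass Y p (c j p) w - level_mass Y m (c j m) w) by ring.
apply: le_trans (ler_normD _ _) _; rewrite mulrDl lerD//.
apply: le_trans tele _; rewrite [leRHS]mulrAC; apply: ler_wpM2l.
  by rewrite mulr_ge0// exprn_ge0// ltW.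
exact: geometric_sum_le.
Qed.

End uniform_decay.

(** * Oscillatory averages along the arc *)

Definition position (v : seq bool) : nat := 
  foldl (fun (p : nat) (b : bool) => (p.*2 + b)%N) 0%N v.

Lemma position_rcons v b : position (rcons v b) = ((position v).*2 + b)%N.
Proof. by rewrite /position foldl_rcons. Qed.

Lemma position_lt v : (position v < 2 ^ size v)%N.
Proof.
elim/last_ind: v => // v b IH; rewrite position_rcons size_rcons expnS mul2n.
by case: b; move: IH; move: (position v) (2 ^ size v)%N => x y; lia.
Qed.

Section dyadic.
Context (R : realType).

Lemma cascade_left_position v : cascade_left R v = (position v)%:R / 2 ^+ size v.
Proof.
elim/last_ind: v => [|v b IH]; first by rewrite /cascade_left big_ord0 mul0r.
rewrite /cascade_left size_rcons big_ord_recr/= nth_rcons ltnn eqxx position_rcons.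
have -> : \sum_(i < size v) (nth false (rcons v b) i : nat)%:R / 2 ^+ i.+1 =
    cascade_left R v.
  by apply: eq_bigr => i _; rewrite nth_rcons ltn_ord.
by rewrite IH natrD -mul2n natrM exprS; field; rewrite expf_neq0// pnatr_eq0.
Qed.

Lemma sum_words_position k (F : nat -> R) :
  \sum_(u <- words k) F (position u) = \sum_(p < 2 ^ k) F p.
Proof.
elim: k F => [|k IH] F; first by rewrite sum_words0 expn0 big_ord1.
rewrite sum_wordsS.
under eq_bigr => u _ do rewrite !position_rcons addn0 addn1.
rewrite (IH (fun p => F p.*2 + F p.*2.+1)).
have H n : \sum_(p < n) (F p.*2 + F p.*2.+1) = \sum_(p < n.*2) F p.
  elim: n => [|n IHn]; first by rewrite !big_ord0.
  by rewrite big_ord_recr doubleS !big_ord_recr/= IHn addrA.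
by rewrite H expnS mul2n.
Qed.

Definition harmonic_sum n : R := \sum_(i < n) i.+1%:R^-1.

Lemma harmonic_sum_le k : harmonic_sum (2 ^ k) <= k.+1%:R.
Proof.
elim: k => [|k IH]; first by rewrite /harmonic_sum expn0 big_ord1 invr1.
rewrite /harmonic_sum expnS mul2n -addnn big_split_ord/= -[k.+2%:R]natr1 lerD//.
apply: (@le_trans _ _ (\sum_(i < 2 ^ k) (2 ^ k)%:R^-1)).
  apply: ler_sum => i _; rewrite lef_pV2 ?posrE ?ltr0n ?expn_gt0// ler_nat.
  by rewrite -addnS leq_addr.
by rewrite sumr_const card_ord -[_ *+ _]mulr_natl mulfV// pnatr_eq0 expn_eq0.
Qed.

Lemma harmonic_sum_nat n m i0 : (m <= n)%N ->
  \sum_(i0 <= p < i0 + m) (p - i0).+1%:R^-1 <= harmonic_sum n.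
Proof.
move=> mn; rewrite -{1}[i0]add0n big_addn addKn big_mkord.
under eq_bigr => i _ do rewrite addnK.
rewrite /harmonic_sum -(subnKC mn) big_split_ord/= lerDl.
by apply: sumr_ge0 => i _; rewrite invr_ge0.
Qed.

(** Both sides of the integer part of [x] are compared with the harmonic sum of [2 ^ k] terms, which
    is at most [k + 1]. The right side loses a factor 2 because [x] may lie beyond its integer
    part. *)
Lemma inv_distance_sum_le k (x : R) :
  \sum_(p < 2 ^ k) (1 + `|p%:R - x|)^-1 <= 4 * k.+1%:R.
Proof.
pose i0 := Num.trunc x; set K := (2 ^ k)%N.
have xi0 : x < i0.+1%:R by exact: truncnS_gt.
have right_le (p : nat) : (i0 <= p)%N -> (1 + `|p%:R - x|)^-1 <= 2 * (p - i0).+1%:R^-1.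
  move=> ip; rewrite -[2]invrK -invfM lef_pV2 ?posrE ?mulr_gt0//.
  have e : p%:R = i0%:R + (p - i0)%:R :> R by rewrite -natrD subnKC.
  have h1 := ler_norm (p%:R - x); have h2 := normr_ge0 (p%:R - x).
  rewrite e in h1 h2 *; move: xi0; rewrite -[i0.+1%:R]natr1 -[(p - i0).+1%:R]natr1.
  move: (`|i0%:R + (p - i0)%:R - x|) h1 h2 => y h1 h2 h3; lra.
(* For negative [x] the value of [Num.trunc] is 0 and there is no such [p]. *)
have left_le (p : nat) : (p < i0)%N -> (1 + `|p%:R - x|)^-1 <= (i0 - p).+1%:R^-1.
  move=> pi; have x0 : i0%:R <= x.
    rewrite truncn_le; apply: contraLR pi => x0; rewrite -leqNgt.
    by rewrite /i0 truncn_floor (negbTE x0).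
  rewrite lef_pV2 ?posrE//.
  have e : i0%:R = p%:R + (i0 - p)%:R :> R by rewrite -natrD subnKC// ltnW.
  have := ler_norm (- (p%:R - x)); rewrite normrN -[(i0 - p).+1%:R]natr1.
  by rewrite e in x0; move: (`|p%:R - x|) => y h; lra.
have H0 : harmonic_sum K <= k.+1%:R by exact: harmonic_sum_le.
have sumR : \sum_(minn i0 K <= p < K) (1 + `|p%:R - x|)^-1 <= 2 * harmonic_sum K.
  have [iK|Ki] := leqP i0 K; last first.
    by rewrite big_geq// mulr_ge0// sumr_ge0// => i _; rewrite invr_ge0.
  apply: (@le_trans _ _ (2 * \sum_(i0 <= p < i0 + (K - i0)) (p - i0).+1%:R^-1)); last first.
    by rewrite ler_wpM2l// harmonic_sum_nat// leq_subr.
  rewrite mulr_sumr subnKC// big_nat [leRHS]big_nat; apply: ler_sum => p /andP[ip _].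
  exact: right_le.
have sumL : \sum_(0 <= p < minn i0 K) (1 + `|p%:R - x|)^-1 <= harmonic_sum K.
  set L := minn i0 K.
  apply: (@le_trans _ _ (\sum_(0 <= p < L) (L - p).+1%:R^-1)).
    rewrite big_nat [leRHS]big_nat; apply: ler_sum => p /andP[_ pL].
    have pi : (p < i0)%N by apply: leq_trans pL (geq_minl _ _).
    apply: le_trans (left_le _ pi) _; rewrite lef_pV2 ?posrE// ler_nat ltnS.
    by rewrite leq_sub2r// geq_minl.
  rewrite big_nat_rev/= add0n.
  apply: (@le_trans _ _ (\sum_(0 <= p < 0 + L) (p - 0).+1%:R^-1)); last first.
    by apply: harmonic_sum_nat; exact: geq_minr.
  rewrite add0n big_nat [leRHS]big_nat; apply: ler_sum => p /andP[_ pL].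
  by rewrite lef_pV2 ?posrE// ler_nat subn0; lia.
rewrite -(big_mkord xpredT (fun p => (1 + `|p%:R - x|)^-1)).
rewrite (big_cat_nat (n := minn i0 K)) ?geq_minr//=.
apply: le_trans (lerD sumL sumR) _.
apply: (@le_trans _ _ (3 * harmonic_sum K)); first by lra.
apply: (@le_trans _ _ (3 * k.+1%:R)); first by rewrite ler_wpM2l.
by rewrite ler_wpM2r// ler_nat.
Qed.

End dyadic.

Section arc.
Context (R : realType).
Implicit Types (f g h : R -> R) (t : R).

Definition clamp t : R := Num.max 0 (Num.min t 1).

Lemma clamp_itv t : clamp t \in `[0, 1].
Proof.
by rewrite in_itv/= /clamp le_max lexx/= ge_max ler01 ge_min lexx orbT.
Qed.

Lemma clamp_id t : t \in `[0, 1] -> clamp t = t.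
Proof.
rewrite in_itv/= => /andP[t0 t1].
by rewrite /clamp min_l// max_r.
Qed.

Lemma clamp_lipschitz s t : `|clamp s - clamp t| <= `|s - t|.
Proof.
have H (a b : R) : a <= b -> 0 <= clamp b - clamp a <= b - a.
  move=> ab; rewrite /clamp /Num.min /Num.max.
  by repeat case: ifPn; rewrite -?leNgt => *; apply/andP; split; lra.
wlog st : s t / s <= t => [hw|].
  by have [/hw//|/ltW/hw] := leP s t; rewrite distrC [leRHS]distrC.
rewrite distrC [leRHS]distrC; have /andP[h0 h1] := H _ _ st.
by rewrite !ger0_norm// subr_ge0.
Qed.

Definition derivative01 h (h' : R -> R) : Prop := forall t, t \in `[0, 1] ->
  forall e, 0 < e -> exists2 d, 0 < d & forall s, s \in `[0, 1] -> s != t ->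
    `|s - t| < d -> `|h' t - (s - t)^-1 * (h s - h t)| < e.

Definition continuous01 h : Prop := forall t, t \in `[0, 1] ->
  forall e, 0 < e -> exists2 d, 0 < d & forall s, s \in `[0, 1] ->
    `|s - t| < d -> `|h s - h t| < e.

Lemma derivative01_continuous h h' : derivative01 h h' -> continuous01 h.
Proof.
move=> hh t t01 e e0; have [d d0 hd] := hh t t01 1 ltr01.
pose K := `|h' t| + 1.
have K0 : 0 < K by rewrite ltr_wpDl.
exists (Num.min d (e / K)); first by rewrite lt_min d0 divr_gt0.
move=> s s01; rewrite lt_min => /andP[sd se].
have [->|st] := eqVneq s t; first by rewrite subrr normr0.
have := hd s s01 st sd; set q := (s - t)^-1 * _ => hq.
have -> : h s - h t = (s - t) * q by rewrite /q mulVKf// subr_eq0.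
have qK : `|q| <= K.
  have -> : q = h' t - (h' t - q) by ring.
  by apply: le_trans (ler_normB _ _) _; rewrite lerD2l ltW.
rewrite normrM; apply: (@le_lt_trans _ _ (`|s - t| * K)); first by rewrite ler_wpM2l.
by rewrite -ltr_pdivlMr.
Qed.

Lemma continuous01_clamp h : continuous01 h -> continuous (h \o clamp).
Proof.
move=> hc t; apply/cvgrPdist_lt => e e0.
have [d d0 hd] := hc (clamp t) (clamp_itv t) e e0.
near=> s; rewrite distrC; apply: hd; first exact: clamp_itv.
apply: le_lt_trans (clamp_lipschitz _ _) _.
by rewrite distrC; near: s; exact: cvgr_dist_lt.
Unshelve. all: end_near. Qed.

Lemma derivative01_is_derive h h' t : derivative01 h h' -> t \in `]0, 1[ ->
  is_derive t 1 (h \o clamp) (h' (clamp t)).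
Proof.
move=> hh t01; have t01' : t \in `[0, 1] by apply: subset_itv_oo_cc.
rewrite (clamp_id t01').
have lim : (e^-1 *: (((h \o clamp) \o shift t) (e *: (1 : R)) - (h \o clamp) t))
    @[e --> 0^'] --> h' t.
  apply/cvgrPdist_lt => e e0; have [d d0 hd] := hh t t01' e e0.
  have := t01; rewrite in_itv/= => /andP[t0 t1].
  have t1' : 0 < 1 - t by rewrite subr_gt0.
  near=> s.
  have s0 : s != 0 by near: s; exact: nbhs_dnbhs_neq.
  have sd : `|s| < d by near: s; exact: dnbhs0_lt.
  have st1 : `|s| < t by near: s; exact: dnbhs0_lt.
  have st2 : `|s| < 1 - t by near: s; exact: dnbhs0_lt.
  have /andP[sl sr] : - t < s < 1 - t.
    move: st1 st2; rewrite !ltr_norml => /andP[-> _] /andP[_ ->] //.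
  have st : s + t \in `[0, 1] by rewrite in_itv/=; apply/andP; split; lra.
  have := hd (s + t) st.
  rewrite addrK; rewrite -subr_eq0 addrK => /(_ s0 sd).
  by rewrite /= /GRing.scale/= mulr1 !clamp_id.
split; first by apply/cvg_ex; exists (h' t).
exact/cvg_lim.
Unshelve. all: end_near. Qed.

Lemma derivative_on01_components (g g' : R -> R * R) : derivative_on01 g g' ->
  derivative01 (fun t => (g t).1) (fun t => (g' t).1) /\
  derivative01 (fun t => (g t).2) (fun t => (g' t).2).
Proof.
move=> gg'; have H t : t \in `[0, 1] -> forall e, 0 < e ->
    exists2 d, 0 < d & forall s, s \in `[0, 1] -> s != t -> `|s - t| < d ->
    `|g' t - (s - t)^-1 *: (g s - g t)| < e.
  move=> t01 e e0; have /cvgrPdist_lt/(_ e e0) := gg' t t01.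
  rewrite near_withinE near_withinE => /nbhs_ballP[d /= d0 hd].
  exists d => // s s01 st sd; apply: hd => //=.
  by rewrite /ball/= distrC.
split=> t t01 e e0; have [d d0 hd] := H t t01 e e0; exists d => // s s01 st sd;
  by apply: le_lt_trans (hd s s01 st sd); rewrite prod_normE/= le_max lexx ?orbT.
Qed.

Lemma within_continuous01_components (g : R -> R * R) :
  {within `[0, 1], continuous g} ->
  continuous01 (fun t => (g t).1) /\ continuous01 (fun t => (g t).2).
Proof.
move=> /subspace_continuousP gc; have H t : t \in `[0, 1] -> forall e, 0 < e ->
    exists2 d, 0 < d & forall s, s \in `[0, 1] -> `|s - t| < d -> `|g s - g t| < e.
  move=> t01 e e0; have /cvgrPdist_lt/(_ e e0) := gc t t01.
  rewrite near_withinE => /nbhs_ballP[d /= d0 hd].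
  exists d => // s s01 sd; rewrite distrC; apply: hd => //=.
  by rewrite /ball/= distrC.
split=> t t01 e e0; have [d d0 hd] := H t t01 e e0; exists d => // s s01 sd;
  by apply: le_lt_trans (hd s s01 sd); rewrite prod_normE/= le_max lexx ?orbT.
Qed.

(* Components of the arc and of its derivatives, extended to the line by composition with
   [clamp], so that no one-sided statement is needed any more. *)
Record regular_arc (g : R -> R * R) (x y dx dy ddx ddy : R -> R) (c : R) : Prop := {
  arc_cont : [/\ continuous x, continuous y, continuous dx & continuous dy];
  arc_cont2 : continuous ddx /\ continuous ddy;
  arc_dx : forall t, t \in `]0, 1[ -> is_derive t 1 x (dx t);
  arc_dy : forall t, t \in `]0, 1[ -> is_derive t 1 y (dy t);
  arc_ddx : forall t, t \in `]0, 1[ -> is_derive t 1 dx (ddx t);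
  arc_ddy : forall t, t \in `]0, 1[ -> is_derive t 1 dy (ddy t);
  arc_eq : forall t, t \in `[0, 1] -> g t = (x t, y t);
  arc_gt0 : 0 < c;
  arc_speed : forall t, t \in `[0, 1] -> c <= Num.sqrt (dx t ^+ 2 + dy t ^+ 2);
  arc_det : forall t, t \in `[0, 1] -> c <= `|dx t * ddy t - dy t * ddx t| }.

Lemma regular_arc_exists (g : R -> R * R) : nondegenerate_C2_arc g ->
  exists x y dx dy ddx ddy c, regular_arc g x y dx dy ddx ddy c.
Proof.
move=> [g' [g'' [[gg' g'g'' g''c] [_ speed det]]]].
have [D1x D1y] := derivative_on01_components gg'.
have [D2x D2y] := derivative_on01_components g'g''.
have [C2x C2y] := within_continuous01_components g''c.
pose c1 := inf [set norm2 (g' t) | t in `[0, 1]].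
pose c2 := inf [set `|det2 (g' t) (g'' t)| | t in `[0, 1]].
exists (fun t => (g (clamp t)).1), (fun t => (g (clamp t)).2),
  (fun t => (g' (clamp t)).1), (fun t => (g' (clamp t)).2),
  (fun t => (g'' (clamp t)).1), (fun t => (g'' (clamp t)).2), (Num.min c1 c2).
split.
- split.
  + exact: (continuous01_clamp (derivative01_continuous D1x)).
  + exact: (continuous01_clamp (derivative01_continuous D1y)).
  + exact: (continuous01_clamp (derivative01_continuous D2x)).
  + exact: (continuous01_clamp (derivative01_continuous D2y)).
- split; [exact: (continuous01_clamp C2x)|exact: (continuous01_clamp C2y)].
- by move=> t; exact: (derivative01_is_derive D1x).
- by move=> t; exact: (derivative01_is_derive D1y).
- by move=> t; exact: (derivative01_is_derive D2x).
- by move=> t; exact: (derivative01_is_derive D2y).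
- by move=> t t01; rewrite clamp_id//; case: (g t).
- by rewrite lt_min; apply/andP.
- move=> t t01; rewrite clamp_id// ge_min; apply/orP; left.
  apply: ge_inf; last by exists t.
  by exists 0 => _ [s _ <-]; exact: sqrtr_ge0.
- move=> t t01; rewrite clamp_id// ge_min; apply/orP; right.
  apply: ge_inf; last by exists t.
  by exists 0 => _ [s _ <-]; exact: normr_ge0.
Qed.

End arc.

Section oscillation.
Context (R : realType).
Implicit Types (f F h k p : R -> R) (t : R).

Lemma uniform_continuity01 h (e : R) : continuous h -> 0 < e ->
  exists j : nat, forall s t, t \in `[0, 1] -> `|s - t| <= 2 ^- j -> `|h s - h t| < e.
Proof.
move=> hc e0.
have e20 : 0 < e / 2 by rewrite divr_gt0.
pose Q (j : nat) t := forall s, `|s - t| <= 2 ^- j -> `|h s - h t| < e.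
have /compact_near_coveringP/(_ nat \oo Q _) := @segment_compact R 0 1.
case=> [t _|j _ hj]; last first.
  by exists j => s t t01; exact: (hj j (leqnn j)).
have /cvgrPdist_lt/(_ _ e20)/nbhs_ballP[d /= d0 hd] := hc t.
have d20 : 0 < d / 2 by rewrite divr_gt0.
have jd : \forall j \near \oo, 2 ^- j < d / 2.
  have half : `|2^-1 : R| < 1 by rewrite ger0_norm ?invr_ge0// invf_lt1// ltr1n.
  have /cvgrPdist_lt/(_ _ d20) := @cvg_geometric R 1 _ half.
  apply: filterS => j; rewrite sub0r normrN /geometric/= mul1r exprVn.
  by rewrite ger0_norm// invr_ge0 exprn_ge0.
exists (ball t (d / 2), [set j | 2 ^- j < d / 2]) => /=.
  by split => //; exact: nbhsx_ballx.
move=> [t' j] [/= tt' jd'] s st'.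
have -> : h s - h t' = (h t - h t') - (h t - h s) by ring.
apply: le_lt_trans (ler_normB _ _) _; rewrite [e]splitr ltrD//; apply: hd; rewrite /ball/=.
  by apply: lt_trans tt' _; rewrite gtr_pMr// invf_lt1// ltr1n.
have -> : t - s = (t - t') - (s - t') by ring.
apply: le_lt_trans (ler_normB _ _) _; rewrite [d]splitr ltrD//.
exact: le_lt_trans st' jd'.
Qed.

Lemma primitive01 f : continuous f -> exists F, forall t, t \in `[0, 1] ->
  is_derive t 1 F (f t).
Proof.
(* Integrating from -1, and up to 2 below, makes 0 and 1 interior points, where the derivative is
   two-sided. *)
move=> fc; exists (fun x => \int[lebesgue_measure]_(t in `[(-1), x]) f t) => t.
rewrite in_itv/= => /andP[t0 t1].
have t2 : t < 2 by apply: le_lt_trans t1 _; rewrite ltr1n.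
have t_1 : -1 < t by apply: lt_le_trans t0; rewrite ltrN10.
have fi : lebesgue_measure.-integrable `[-1, 2] (EFin \o f).
  apply: continuous_compact_integrable; first exact: segment_compact.
  exact: continuous_subspaceT.
have [d e] := continuous_FTC1_closed t2 fi t_1 (fc t).
split; [exact: d|rewrite -derive1E; exact: e].
Qed.

(* With [G = sin (2 pi p - be) / (2 pi k)], the derivative of [F - G] involves no oscillating
   term of size 1: this replaces an integration by parts. *)
Lemma oscillation_bound F p k dk (s1 s2 eta L be : R) : s1 < s2 ->
  (forall t, t \in `[s1, s2] -> is_derive t 1 F (cos (2 * pi * p t - be))) ->
  (forall t, t \in `]s1, s2[ -> is_derive t 1 p (k t)) ->
  (forall t, t \in `]s1, s2[ -> is_derive t 1 k (dk t)) ->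
  continuous p -> continuous k -> 0 < eta ->
  (forall t, t \in `[s1, s2] -> eta <= `|k t|) ->
  (forall t, t \in `[s1, s2] -> `|dk t| <= L) ->
  `|F s2 - F s1| <= eta^-1 + (s2 - s1) * L / eta ^+ 2.
Proof.
move=> s12 dF dp dk' pc kc eta0 keta dkL.
have p2 : 1 <= 2 * pi :> R by have := @pi_ge2 R; lra.
have p20 : 0 < 2 * pi :> R by apply: lt_le_trans p2.
have k0 t : t \in `[s1, s2] -> k t != 0.
  by move=> /keta kt; rewrite -normr_gt0 (lt_le_trans eta0).
have pk0 t : t \in `[s1, s2] -> 2 * pi * k t != 0.
  by move=> ts; rewrite mulf_neq0 ?k0// gt_eqF.
pose G t := sin (2 * pi * p t - be) * (2 * pi * k t)^-1.
pose dG t := sin (2 * pi * p t - be) * (- (2 * pi * k t) ^- 2 *: (2 * pi * dk t)) +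
   (2 * pi * k t)^-1 * (cos (2 * pi * p t - be) * (2 * pi * k t)).
have G_le t : t \in `[s1, s2] -> `|G t| <= 2^-1 * eta^-1.
  move=> ts; rewrite /G normrM normfV.
  have sin1 : `|sin (2 * pi * p t - be)| <= 1 by rewrite ler_norml sin_geN1 sin_le1.
  rewrite -[leRHS]mul1r ler_pM// -invfM lef_pV2 ?posrE ?mulr_gt0// ?normr_gt0 ?pk0//.
  rewrite normrM ger0_norm ?(ltW p20)//; apply: ler_pM => //; first exact: ltW.
    by have := @pi_ge2 R; lra.
  exact: keta.
have dH t : t \in `]s1, s2[ -> is_derive t 1 (F \- G) (cos (2 * pi * p t - be) - dG t).
  move=> ts; have ts' : t \in `[s1, s2] by exact: subset_itv_oo_cc.
  have dpt := dp t ts; have dkt := dk' t ts; have dFt := dF t ts'.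
  apply: is_deriveB.
  have d1 : is_derive t 1 (fun s => 2 * pi * p s - be) (2 * pi * k t).
    rewrite -[2 * pi * k t]subr0; apply: is_deriveB; exact: is_deriveZ.
  have d2 : is_derive t 1 (fun s => sin (2 * pi * p s - be))
      (cos (2 * pi * p t - be) * (2 * pi * k t)).
    exact: (is_derive1_comp (f := sin)).
  have d3 : is_derive t 1 (fun s => (2 * pi * k s)^-1) (- (2 * pi * k t) ^- 2 *: (2 * pi * dk t)).
    by apply: is_deriveV; exact: pk0.
  exact: is_deriveM.
have Hc : {within `[s1, s2], continuous (F \- G)}.
  apply: continuous_in_subspaceT => t; rewrite inE => ts.
  apply: cvgB.
    have := dF t ts => - [dFt _]; apply: differentiable_continuous.
    exact/derivable1_diffP.
  apply: cvgM.
    apply: (continuous_comp (f := fun s => 2 * pi * p s - be)); last exact: continuous_sin.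
    apply: cvgB; last exact: cvg_cst.
    by apply: cvgM; [exact: cvg_cst|exact: pc].
  apply: cvgV; first exact: pk0.
  by apply: cvgM; [exact: cvg_cst|exact: kc].
have [t ts] := MVT s12 dH Hc.
have ts' : t \in `[s1, s2] by exact: subset_itv_oo_cc.
have -> : cos (2 * pi * p t - be) - dG t =
    sin (2 * pi * p t - be) * dk t / (2 * pi * k t ^+ 2).
  rewrite /dG /GRing.scale/=; have := k0 t ts'; move: p20.
  move: (2 * pi) (k t) => P K P0 K0; field.
  by rewrite K0 gt_eqF.
rewrite /= => hm.
have -> : F s2 - F s1 = (G s2 - G s1) +
   sin (2 * pi * p t - be) * dk t / (2 * pi * k t ^+ 2) * (s2 - s1) by rewrite -hm; ring.
apply: le_trans (ler_normD _ _) _; apply: lerD.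
  apply: le_trans (ler_normB _ _) _.
  have s2i : s2 \in `[s1, s2] by rewrite in_itv/= lexx (ltW s12).
  have s1i : s1 \in `[s1, s2] by rewrite in_itv/= lexx (ltW s12).
  apply: le_trans (lerD (G_le _ s2i) (G_le _ s1i)) _; move: eta^-1 => z; lra.
rewrite normrM [X in _ * X]ger0_norm ?subr_ge0 ?(ltW s12)//.
rewrite -[leRHS]mulrA [leRHS]mulrC ler_wpM2r ?subr_ge0 ?(ltW s12)//.
rewrite !normrM normfV.
have sin1 : `|sin (2 * pi * p t - be)| <= 1 by rewrite ler_norml sin_geN1 sin_le1.
apply: ler_pM => //.
  by rewrite -[leRHS]mul1r; apply: ler_pM => //; exact: dkL.
rewrite lef_pV2 ?posrE ?normr_gt0 ?exprn_gt0//; last first.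
  by rewrite mulf_neq0 ?expf_neq0 ?k0// gt_eqF.
rewrite normrM (ger0_norm (ltW p20)) normrX -[leLHS]mul1r; apply: ler_pM => //.
  by rewrite exprn_ge0// ltW.
by apply: lerXn2r; rewrite ?nnegrE ?(ltW eta0)//; exact: keta.
Qed.

End oscillation.

Lemma position_cat u t : position (u ++ t) = (position u * 2 ^ size t + position t)%N.
Proof.
elim/last_ind: t => [|t b IH]; first by rewrite cats0 muln1 addn0.
rewrite -rcons_cat !position_rcons IH size_rcons expnS -!mul2n mulnDr.
by rewrite addnA [(2 * (_ * _))%N]mulnCA mulnA.
Qed.

Section dyadic_intervals.
Context (R : realType).
Local Notation left := (cascade_left R).

Lemma cascade_left_ge0 v : 0 <= left v.
Proof. by rewrite cascade_left_position divr_ge0// exprn_ge0. Qed.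

Lemma cascade_right_le1 v : left v + 2 ^- size v <= 1.
Proof.
rewrite cascade_left_position -[X in _ + X]mul1r -mulrDl ler_pdivrMr ?exprn_gt0//.
by rewrite mul1r natr1 -natrX ler_nat position_lt.
Qed.

Lemma cascade_left_cat u t : left (u ++ t) = left u + 2 ^- size u * left t.
Proof.
rewrite !cascade_left_position position_cat size_cat exprD natrD natrM natrX.
by field; rewrite !expf_neq0// pnatr_eq0.
Qed.

Lemma cascade_subinterval j v : (j <= size v)%N ->
  left (take j v) <= left v /\ left v + 2 ^- size v <= left (take j v) + 2 ^- j.
Proof.
move=> jv; have sj : size (take j v) = j by rewrite size_takel.
rewrite -{2 3 4}(cat_take_drop j v) cascade_left_cat sj size_cat sj exprD invfM.
have p0 : 0 <= 2 ^- j :> R by rewrite invr_ge0 exprn_ge0.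
split; first by rewrite lerDl mulr_ge0// cascade_left_ge0.
rewrite -addrA lerD2l -mulrDr -[leRHS]mulr1 ler_wpM2l//.
exact: cascade_right_le1.
Qed.

End dyadic_intervals.

Section anchors.
Context (R : realType).
Implicit Types (f F h k p : R -> R) (t : R).

Lemma bounded01 h : continuous h -> exists2 B, 1 <= B & forall t, t \in `[0, 1] -> `|h t| <= B.
Proof.
move=> hc; have [||s s01 hs] := @EVT_max R (fun t => `|h t|) 0 1; first exact: ler01.
  apply: continuous_subspaceT => t; apply: cvg_norm; exact: hc.
exists (1 + `|h s|); first by rewrite lerDl.
by move=> t t01; apply: le_trans (hs t t01) _; rewrite lerDr.
Qed.

(** The anchor [t0] is the zero of [h], or the end point where [h] is closest to 0 if [h] keeps its
    sign; away from it the lower bound of the slope accumulates. *)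
Lemma increasing_anchor h dh (a b eta : R) : a <= b -> continuous h -> 0 <= eta ->
  (forall t, t \in `]a, b[ -> is_derive t 1 h (dh t)) ->
  (forall t, t \in `]a, b[ -> eta <= dh t) ->
  exists t0, forall s, s \in `[a, b] -> eta * `|s - t0| <= `|h s|.
Proof.
move=> ab hc eta0 hd dh_ge.
have incr s t : s \in `[a, b] -> t \in `[a, b] -> s <= t -> eta * (t - s) <= h t - h s.
  rewrite !in_itv/= => /andP[as_ sb] /andP[at_ tb]; rewrite le_eqVlt => /orP[/eqP ->|st].
    by rewrite !subrr mulr0.
  have sub x : x \in `]s, t[ -> x \in `]a, b[.
    rewrite !in_itv/= => /andP[sx xt].
    by rewrite (le_lt_trans as_ sx) (lt_le_trans xt tb).
  have [x xst ->] := MVT st (fun x xst => hd x (sub x xst)) (continuous_subspaceT hc).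
  by rewrite ler_wpM2r ?subr_ge0 ?(ltW st)// dh_ge// sub.
have aa : a \in `[a, b] by rewrite in_itv/= lexx.
have bb : b \in `[a, b] by rewrite in_itv/= lexx andbT.
suff [t0 t0ab [hl hr]] : exists2 t0, t0 \in `[a, b] &
    (forall s, s \in `[a, b] -> s < t0 -> h t0 <= 0) /\
    (forall s, s \in `[a, b] -> t0 < s -> 0 <= h t0).
  exists t0 => s sab; case: (ltgtP s t0) => [st|ts|->].
  - have := hl s sab st; have := incr s t0 sab t0ab (ltW st).
    rewrite ltr0_norm ?subr_lt0// opprB => h1 h2.
    have := ler_norm (- h s); rewrite normrN; move: `|h s| (eta * _) h1 => y z h1 h3; lra.
  - have := hr s sab ts; have := incr t0 s t0ab sab (ltW ts).
    rewrite gtr0_norm ?subr_gt0// => h1 h2.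
    have := ler_norm (h s); move: `|h s| (eta * _) h1 => y z h1 h3; lra.
  - by rewrite subrr normr0 mulr0.
have [ha|ha] := leP 0 (h a).
  exists a => //; split => // s; rewrite in_itv/= => /andP[as_ _] sa.
  by rewrite ltNge as_ in sa.
have [hb|hb] := leP (h b) 0.
  exists b => //; split => // s; rewrite in_itv/= => /andP[_ sb] bs.
  by rewrite ltNge sb in bs.
have [|t0 t0ab h0] := @IVT R h a b 0 ab (continuous_subspaceT hc).
  by rewrite ge_min le_max (ltW ha) (ltW hb) orbT.
by exists t0 => //; rewrite h0.
Qed.

Lemma primitive_increment F p be (a b : R) :
  (forall t, t \in `[a, b] -> is_derive t 1 F (cos (2 * pi * p t - be))) -> a <= b ->
  `|F b - F a| <= b - a.
Proof.
move=> dF; rewrite le_eqVlt => /orP[/eqP ->|ab]; first by rewrite !subrr normr0.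
have Fc : {within `[a, b], continuous F}.
  apply: continuous_in_subspaceT => t; rewrite inE => tab.
  have [dFt _] := dF t tab; apply: differentiable_continuous.
  exact/derivable1_diffP.
have [t tab ->] := MVT ab (fun x xab => dF x (subset_itv_oo_cc xab)) Fc.
rewrite normrM [X in _ * X]ger0_norm ?subr_ge0 ?(ltW ab)// ler_piMl ?subr_ge0 ?(ltW ab)//.
by rewrite ler_norml cos_geN1 cos_le1.
Qed.

End anchors.

Section arc_coefficients.
Context (R : realType) (g : R -> R * R) (x y dx dy ddx ddy : R -> R) (c : R).
Hypothesis A : regular_arc g x y dx dy ddx ddy c.
Local Notation left := (cascade_left R).
Implicit Types a b be t : R.

Let k a b t := a * dx t + b * dy t.
Let dk a b t := a * ddx t + b * ddy t.
Let N a b := `|a| + `|b|.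

Lemma continuous_comb (h1 h2 : R -> R) a b : continuous h1 -> continuous h2 ->
  continuous (fun t => a * h1 t + b * h2 t).
Proof.
move=> c1 c2 t; apply: cvgD; (apply: cvgM; first exact: cvg_cst); [exact: c1|exact: c2].
Qed.

Let kc a b : continuous (k a b).
Proof. by case: (arc_cont A) => _ _ ? ?; exact: continuous_comb. Qed.

Let is_derive_comb (h1 h2 dh1 dh2 : R -> R) a b t :
  is_derive t 1 h1 (dh1 t) -> is_derive t 1 h2 (dh2 t) ->
  is_derive t 1 (fun t => a * h1 t + b * h2 t) (a * dh1 t + b * dh2 t).
Proof. by move=> d1 d2; apply: is_deriveD; exact: is_deriveZ. Qed.

Let k_derive a b t : t \in `]0, 1[ -> is_derive t 1 (k a b) (dk a b t).
Proof. by move=> t01; apply: is_derive_comb; [exact: (arc_ddx A)|exact: (arc_ddy A)]. Qed.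

Lemma arc_bounded : exists2 B, 1 <= B & forall t, t \in `[0, 1] ->
  [/\ `|dx t| <= B, `|dy t| <= B, `|ddx t| <= B & `|ddy t| <= B].
Proof.
have [_ _ c1 c2] := arc_cont A; have [c3 c4] := arc_cont2 A.
have [B1 B11 h1] := bounded01 c1; have [B2 B21 h2] := bounded01 c2.
have [B3 B31 h3] := bounded01 c3; have [B4 B41 h4] := bounded01 c4.
exists (B1 + B2 + B3 + B4); first lra.
move=> t t01; have := h1 t t01; have := h2 t t01; have := h3 t t01; have := h4 t t01.
by split; lra.
Qed.

Lemma comb_le (u v B a b : R) : `|u| <= B -> `|v| <= B -> `|a * u + b * v| <= N a b * B.
Proof.
move=> uB vB; apply: le_trans (ler_normD _ _) _.
by rewrite !normrM mulrDl lerD// ler_wpM2l.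
Qed.

(* A nonzero frequency cannot be orthogonal to both [gamma'] and [gamma'']. *)
Lemma arc_nondegenerate : exists2 kappa, 0 < kappa & forall a b t, t \in `[0, 1] ->
  kappa * N a b <= `|k a b t| + `|dk a b t|.
Proof.
have [B B1 hB] := arc_bounded; have c0 := arc_gt0 A.
have B0 : 0 < B by apply: lt_le_trans B1.
exists (c / (2 * B)); first by rewrite divr_gt0// mulr_gt0.
move=> a b t t01; have [b1 b2 b3 b4] := hB t t01; have cD := arc_det A t01.
set D := dx t * ddy t - dy t * ddx t in cD.
(* Cramer's rule recovers the frequency from its products with the two derivatives of the arc. *)
have e1 : a * D = k a b t * ddy t + dk a b t * (- dy t) by rewrite /D /k /dk; ring.
have e2 : b * D = k a b t * (- ddx t) + dk a b t * dx t by rewrite /D /k /dk; ring.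
have h1 : c * `|a| <= (`|k a b t| + `|dk a b t|) * B.
  rewrite mulrC; apply: (@le_trans _ _ `|a * D|); first by rewrite normrM ler_wpM2l.
  by rewrite e1; apply: comb_le; rewrite ?normrN.
have h2 : c * `|b| <= (`|k a b t| + `|dk a b t|) * B.
  rewrite mulrC; apply: (@le_trans _ _ `|b * D|); first by rewrite normrM ler_wpM2l.
  by rewrite e2; apply: comb_le; rewrite ?normrN.
rewrite mulrAC ler_pdivrMr ?mulr_gt0// /N.
by move: h1 h2; move: (_ + `|dk a b t|) => z h1 h2; lra.
Qed.

(** On a block so short that [k] and [dk] vary by at most [kappa / 8] times the frequency, either
    [|k|] is large everywhere and any anchor serves, or [dk] is large with constant sign and [k] is
    monotone. By homogeneity [j0] and [eta] do not depend on the frequency. *)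
Lemma block_anchor : exists j0 eta, 0 < eta /\ forall a b u, size u = j0 ->
  exists t0, forall s, s \in `[left u, left u + 2 ^- j0] ->
    eta * N a b * `|s - t0| <= `|k a b s|.
Proof.
have [kappa kappa0 hk] := arc_nondegenerate.
have [_ _ c1 c2] := arc_cont A; have [c3 c4] := arc_cont2 A.
have e0 : 0 < kappa / 8 by rewrite divr_gt0.
have [j1 h1] := uniform_continuity01 c1 e0; have [j2 h2] := uniform_continuity01 c2 e0.
have [j3 h3] := uniform_continuity01 c3 e0; have [j4 h4] := uniform_continuity01 c4 e0.
pose j0 := maxn (maxn j1 j2) (maxn j3 j4).
exists j0, (kappa / 4); split; first by rewrite divr_gt0.
move=> a b u uj; set al := left u; set ar := al + _.
have j_le i : (i <= j0)%N -> 2 ^- j0 <= 2 ^- i :> R.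
  by move=> ij; rewrite lef_pV2 ?posrE ?exprn_gt0// ler_weXn2l// ler1n.
have p0 : 0 < 2 ^- j0 :> R by rewrite invr_gt0 exprn_gt0.
have al0 : 0 <= al by exact: cascade_left_ge0.
have ar1 : ar <= 1 by rewrite /ar -uj; exact: cascade_right_le1.
have al01 : al \in `[0, 1] by rewrite in_itv/= al0/=; move: ar1; rewrite /ar; lra.
have N0 : 0 <= N a b by rewrite addr_ge0.
have close s : s \in `[al, ar] -> `|s - al| <= 2 ^- j0.
  rewrite in_itv/= => /andP[s1 s2]; rewrite ger0_norm ?subr_ge0//.
  by move: s2; rewrite /ar; lra.
have [m1 m2 m3 m4] : [/\ (j1 <= j0)%N, (j2 <= j0)%N, (j3 <= j0)%N & (j4 <= j0)%N].
  by rewrite /j0 !leq_max !leqnn ?orbT.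
have k_close s : s \in `[al, ar] -> `|k a b s - k a b al| <= kappa / 8 * N a b.
  move=> /close sal; have -> : k a b s - k a b al = a * (dx s - dx al) + b * (dy s - dy al).
    by rewrite /k; ring.
  rewrite [leRHS]mulrC; apply: comb_le; apply: ltW; [apply: h1|apply: h2] => //.
    exact: le_trans sal (j_le _ m1).
  exact: le_trans sal (j_le _ m2).
have dk_close s : s \in `[al, ar] -> `|dk a b s - dk a b al| <= kappa / 8 * N a b.
  move=> /close sal; have -> : dk a b s - dk a b al = a * (ddx s - ddx al) + b * (ddy s - ddy al).
    by rewrite /dk; ring.
  rewrite [leRHS]mulrC; apply: comb_le; apply: ltW; [apply: h3|apply: h4] => //.
    exact: le_trans sal (j_le _ m3).
  exact: le_trans sal (j_le _ m4).
have kN0 : 0 <= kappa * N a b by rewrite mulr_ge0// ltW.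
have [kal|kal] := leP (kappa * N a b / 2) `|k a b al|.
  exists al => s sI; have s_al : `|s - al| <= 1.
    by apply: le_trans (close s sI) _; rewrite invf_le1 ?exprn_gt0// exprn_ege1// ler1n.
  apply: (@le_trans _ _ (kappa / 4 * N a b)).
    by rewrite ler_piMr// mulr_ge0// divr_ge0// ltW.
  have := k_close s sI; have := ler_normB (k a b s) (k a b s - k a b al).
  rewrite opprB addrC subrK.
  move: `|k a b s| `|k a b s - _| => z1 z2 h5 h6.
  have := kal; move: `|k a b al| => z3 h7; lra.
have dkal : kappa * N a b / 2 <= `|dk a b al|.
  by have := hk a b al al01; move: `|k a b al| `|dk a b al| kal => z1 z2; lra.
have al_ar : al <= ar by rewrite /ar lerDl ltW.
have sub t : t \in `]al, ar[ -> (t \in `]0, 1[) /\ (t \in `[al, ar]).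
  rewrite !in_itv/= => /andP[t1 t2].
  by rewrite (le_lt_trans al0 t1) (lt_le_trans t2 ar1) (ltW t1) (ltW t2).
have eta0 : 0 <= kappa / 4 * N a b by rewrite mulr_ge0// divr_ge0// ltW.
have dd a' b' t : t \in `]al, ar[ -> is_derive t 1 (k a' b') (dk a' b' t).
  by move=> /sub[t01 _]; exact: k_derive.
have [dk0|dk0] := leP 0 (dk a b al).
  have dk_ge t : t \in `]al, ar[ -> kappa / 4 * N a b <= dk a b t.
    move=> /sub[t01 tI]; have := dk_close t tI; rewrite ger0_norm// in dkal.
    by rewrite ler_norml => /andP[+ _]; lra.
  have [t0 ht0] := increasing_anchor al_ar (@kc a b) eta0 (dd a b) dk_ge.
  by exists t0 => s sI; exact: (ht0 s sI).
(* A decreasing [k] is replaced by the increasing one at the opposite frequency. *)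
have dk_ge t : t \in `]al, ar[ -> kappa / 4 * N a b <= dk (- a) (- b) t.
  move=> /sub[t01 tI]; have := dk_close t tI; rewrite ltr0_norm// in dkal.
  have -> : dk (- a) (- b) t = - dk a b t by rewrite /dk; ring.
  by rewrite ler_norml => /andP[_]; lra.
have [t0 ht0] := increasing_anchor al_ar (@kc (- a) (- b)) eta0 (dd (- a) (- b)) dk_ge.
exists t0 => s sI; apply: le_trans (ht0 s sI) _.
by rewrite le_eqVlt -[`|k a b s|]normrN; apply/orP; left; apply/eqP; congr `|_|; rewrite /k; ring.
Qed.

End arc_coefficients.

Section coefficients.
Context (R : realType) (g : R -> R * R) (x y dx dy ddx ddy : R -> R) (c : R).
Hypothesis A : regular_arc g x y dx dy ddx ddy c.
Local Notation left := (cascade_left R).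
Implicit Types (a b be t : R) (F : R -> R).

(** The mean, over the dyadic cell of [v], of the function whose primitive is [F]. *)
Definition average F (v : seq bool) : R :=
  2 ^+ size v * (F (left v + 2 ^- size v) - F (left v)).

Lemma average_split F n v : size v = n ->
  (average F (rcons v false) + average F (rcons v true)) / 2 = average F v.
Proof.
move=> vn; have l0 : left (rcons v false) = left v.
  by rewrite -cats1 cascade_left_cat [left [:: _]]cascade_left_position [position _]/= mul0r mulr0 addr0.
have l1 : left (rcons v true) = left v + 2 ^- (size v).+1.
  rewrite -cats1 cascade_left_cat [left [:: _]]cascade_left_position [position _]/= mul1r expr1.
  by rewrite exprS invfM mulrC.
rewrite /average !size_rcons l0 l1.
have -> : left v + 2 ^- (size v).+1 + 2 ^- (size v).+1 = left v + 2 ^- size v.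
  by rewrite -addrA; congr (_ + _); rewrite exprS invfM; field; rewrite expf_neq0// pnatr_eq0.
by rewrite exprS; field.
Qed.

Let N a b := `|a| + `|b|.

Definition phase_primitive F a b be := forall t, t \in `[0, 1] ->
  is_derive t 1 F (cos (2 * pi * (a * x t + b * y t) - be)).

Lemma word_itv v : `[left v, left v + 2 ^- size v] `<=` `[0, 1].
Proof.
move=> t /=; rewrite !in_itv/= => /andP[t1 t2].
by rewrite (le_trans (cascade_left_ge0 R v) t1) (le_trans t2 (cascade_right_le1 R v)).
Qed.

Lemma average_le1 F a b be v : phase_primitive F a b be -> `|average F v| <= 1.
Proof.
move=> dF; have p0 : 0 < 2 ^+ size v :> R by rewrite exprn_gt0.
rewrite /average normrM ger0_norm ?(ltW p0)// mulrC -ler_pdivlMr// mul1r.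
have := @primitive_increment R F (fun t => a * x t + b * y t) be (left v) (left v + 2 ^- size v).
rewrite addrAC subrr add0r; apply; last by rewrite lerDl invr_ge0 ltW.
by move=> t tv; apply: dF; exact: word_itv tv.
Qed.

Let is_derive_combination (h1 h2 dh1 dh2 : R -> R) a b t :
  is_derive t 1 h1 (dh1 t) -> is_derive t 1 h2 (dh2 t) ->
  is_derive t 1 (fun t => a * h1 t + b * h2 t) (a * dh1 t + b * dh2 t).
Proof. by move=> d1 d2; apply: is_deriveD; exact: is_deriveZ. Qed.

(** Let [X] be the distance of a block of level [k = 2 m - n] to its anchor, in block lengths. On
    the block the phase derivative is at least [eta N 2 ^ (- k) (X - 1)] with
    [N 2 ^ (- k) >= 2 ^ n], so on a cell of length [2 ^ (- n - 1)] the average is at most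
    [E / (X - 1)]. In [E], the first term is the boundary term and the second comes from the second
    derivative, using [k <= n]. The sum over the blocks is harmonic, hence linear in [k]. *)
Lemma coefficient_block : exists2 C0, 0 <= C0 & forall a b be F m n,
  phase_primitive F a b be -> (m <= n)%N -> 2 ^+ (2 * m) <= N a b ->
  exists2 h : seq bool -> R,
    (forall v, size v = n.+1 -> `|average F v| <= h (take (2 * m - n) v)) &
    \sum_(u <- words (2 * m - n)) h u <= C0 * (2 * m - n).+1%:R.
Proof.
have [B B1 hB] := arc_bounded A; have [j0 [eta [eta0 hj0]]] := block_anchor A.
have B0 : 0 < B by apply: lt_le_trans B1.
have [c1 c2 c3 c4] := arc_cont A.
pose E := 2 / eta + B / eta ^+ 2.
have E0 : 0 <= E by rewrite addr_ge0// divr_ge0 ?exprn_ge0// ltW.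
(* The 4 serves the blocks with [X <= 3], where averages are just bounded by 1; [2 E] serves the
   others, where [1 + X <= 2 (X - 1)]. *)
pose C2 := 4 + 2 * E.
have C20 : 0 <= C2 by rewrite addr_ge0// mulr_ge0.
pose C0 : R := (2 ^ j0)%:R * (1 + 4 * C2).
have C00 : 0 <= C0 by rewrite mulr_ge0// addr_ge0// mulr_ge0.
exists C0 => // a b be F m n dF mn mN; set k := (2 * m - n)%N.
have [kj|jk] := leqP k j0.
  (* With [k <= j0] there are at most [2 ^ j0] blocks; this is the origin of that factor in [C0]. *)
  exists (fun=> 1) => [v vn|]; first exact: average_le1 dF.
  rewrite big_const_seq count_predT size_words iter_addr addr0.
  apply: (@le_trans _ _ ((2 ^ j0)%:R * 1 * 1)).
    by rewrite !mulr1 ler_nat leq_exp2l.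
  by rewrite ler_pM ?mulr_ge0// ?ler_wpM2l ?lerDl ?mulr_ge0// ler1n.
have nE : n = (2 * m - k)%N by rewrite /k; clear -jk; lia.
have kn : (k <= n)%N by rewrite /k; clear -mn; lia.
have knm : (k + n = 2 * m)%N by rewrite /k; clear -jk; lia.
have [t0 ht0] : exists t0 : seq bool -> R, forall u, size u = j0 ->
    forall s, s \in `[left u, left u + 2 ^- j0] ->
    eta * N a b * `|s - t0 u| <= `|a * dx s + b * dy s|.
  have /choice[t0 ht0] : forall u, exists t0, size u = j0 ->
      forall s, s \in `[left u, left u + 2 ^- j0] ->
      eta * N a b * `|s - t0| <= `|a * dx s + b * dy s|.
    move=> u; have [uj|uj] := eqVneq (size u) j0.
      by have [t0 h] := hj0 a b u uj; exists t0.
    by exists 0 => uj'; rewrite uj' eqxx in uj.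
  by exists t0.
pose h u := C2 / (1 + `|(position u)%:R - 2 ^+ k * t0 (take j0 u)|).
exists h; last first.
  apply: (@le_trans _ _ (\sum_(u <- words k) \sum_(u0 <- words j0)
      C2 / (1 + `|(position u)%:R - 2 ^+ k * t0 u0|))).
    rewrite big_seq [leRHS]big_seq; apply: ler_sum => u; rewrite mem_words => /eqP uk.
    rewrite (bigD1_seq (take j0 u)) ?uniq_words ?mem_words ?size_takel ?uk ?(ltnW jk)//=.
    rewrite lerDl; apply: sumr_ge0 => u0 _; rewrite divr_ge0//.
  rewrite exchange_big/=.
  apply: (@le_trans _ _ (\sum_(u0 <- words j0) C2 * (4 * k.+1%:R))).
    apply: ler_sum => u0 _; rewrite -mulr_sumr ler_wpM2l//.
    rewrite (sum_words_position k (fun p => (1 + `|p%:R - 2 ^+ k * t0 u0|)^-1)).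
    exact: inv_distance_sum_le.
  rewrite big_const_seq count_predT size_words iter_addr addr0 -[_ *+ _]mulr_natl /C0.
  rewrite -[(2 ^ j0)%:R * (1 + _) * _]mulrA.
  apply: ler_wpM2l => //; have -> : (1 + 4 * C2) * k.+1%:R = C2 * (4 * k.+1%:R) + k.+1%:R by ring.
  by rewrite lerDl.
move=> v vn; set u := take k v.
have uk : size u = k by rewrite size_takel// vn; apply: leq_trans kn _.
rewrite /h; set X := `|(position u)%:R - _|.
have X0 : 0 <= X by exact: normr_ge0.
have X1 : 0 < 1 + X by rewrite ltr_wpDr.
rewrite ler_pdivlMr//; have [X3|X3] := leP X 3.
  apply: (@le_trans _ _ (1 * 4)); last by rewrite mul1r /C2 lerDl mulr_ge0.
  by rewrite ler_pM ?(average_le1 _ dF)// ?addr_ge0//; move: X3; lra.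
have X11 : 1 <= X - 1 by move: X3; lra.
have X10 : 0 < X - 1 by apply: lt_le_trans X11.
have N0 : 0 < N a b by apply: lt_le_trans mN; rewrite exprn_gt0.
have p2k : 0 < 2 ^- k :> R by rewrite invr_gt0 exprn_gt0.
have p2n : 0 < 2 ^+ n.+1 :> R by rewrite exprn_gt0.
have kv : (k <= size v)%N by rewrite vn; exact: leqW.
have [l1 r1] := @cascade_subinterval R k v kv.
have j0u : (j0 <= size u)%N by rewrite uk; exact: ltnW.
have [l2 r2] := @cascade_subinterval R j0 u j0u.
have u0j : size (take j0 u) = j0 by rewrite size_takel// uk ltnW.
have M_ge : 2 ^+ n <= N a b * 2 ^- k.
  by rewrite ler_pdivlMr ?exprn_gt0// -exprD addnC knm.
have M0 : 0 < N a b * 2 ^- k by rewrite mulr_gt0.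
pose eta' := eta * (N a b * 2 ^- k) * (X - 1).
have eta'0 : 0 < eta' by rewrite !mulr_gt0.
set s1 := left v; set s2 := s1 + 2 ^- size v.
have s12 : s1 < s2 by rewrite /s2 ltrDl invr_gt0 exprn_gt0.
have s01 t : t \in `[s1, s2] -> t \in `[0, 1] by exact: (@word_itv v).
have s01o t : t \in `]s1, s2[ -> t \in `]0, 1[.
  rewrite !in_itv/= => /andP[t1 t2].
  by rewrite (le_lt_trans (cascade_left_ge0 R v) t1) (lt_le_trans t2 (cascade_right_le1 R v)).
have k_ge t : t \in `[s1, s2] -> eta' <= `|a * dx t + b * dy t|.
  rewrite in_itv/= => /andP[t1 t2].
  have tu1 : left u <= t by apply: le_trans l1 t1.
  have tu2 : t <= left u + 2 ^- k by apply: le_trans t2 r1.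
  apply: le_trans (ht0 _ u0j t _); last first.
    by rewrite in_itv/= (le_trans l2 tu1)/= (le_trans tu2)// -uk.
  rewrite /eta' -!mulrA ler_wpM2l ?(ltW eta0)// ler_wpM2l ?(ltW N0)//.
  rewrite mulrC ler_pdivrMr ?exprn_gt0// mulrC.
  have pk0 : 0 < 2 ^+ k :> R by rewrite exprn_gt0.
  rewrite -[X in X * `|_|]gtr0_norm// -normrM.
  have luE : left u = (position u)%:R / 2 ^+ k by rewrite cascade_left_position uk.
  have th0 : 0 <= 2 ^+ k * t - (position u)%:R.
    by rewrite subr_ge0 mulrC -ler_pdivrMr// -luE.
  have th1 : 2 ^+ k * t - (position u)%:R <= 1.
    rewrite lerBlDr mulrC -ler_pdivlMr// (le_trans tu2)// luE mulrDl mul1r addrC.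
    exact: lexx.
  rewrite mulrBr /X; move: th0 th1; move: (2 ^+ k * t) (2 ^+ k * t0 (take j0 u)).
  move: ((position u)%:R : R) => z3 z1 z2 h1 h2.
  have := ler_normB (z1 - z2) (z1 - z3); have -> : z1 - z2 - (z1 - z3) = z3 - z2 by ring.
  by rewrite (ger0_norm h1); move: `|_| `|_| => y1 y2; lra.
have BN : forall t, t \in `[s1, s2] -> `|a * ddx t + b * ddy t| <= N a b * B.
  by move=> t /s01 t01; have [_ _ b3 b4] := hB t t01; exact: comb_le.
have osc := @oscillation_bound R F (fun t => a * x t + b * y t)
  (fun t => a * dx t + b * dy t) (fun t => a * ddx t + b * ddy t) s1 s2 eta'
  (N a b * B) be s12 (fun t ts => dF t (s01 t ts)).
have {osc} osc := osc (fun t ts => is_derive_combination a b (arc_dx A (s01o t ts)) (arc_dy A (s01o t ts)))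
  (fun t ts => is_derive_combination a b (arc_ddx A (s01o t ts)) (arc_ddy A (s01o t ts)))
  (continuous_comb c1 c2) (continuous_comb c3 c4) eta'0 k_ge BN.
have avg : `|average F v| <= E / (X - 1).
  rewrite /average normrM ger0_norm ?exprn_ge0// vn -/s1 -vn -/s2.
  apply: le_trans (ler_wpM2l _ osc) _; first exact: exprn_ge0.
  rewrite /s2 addrAC subrr add0r vn mulrDr /E [leRHS]mulrDl; apply: lerD; rewrite /eta'.
    have -> : 2 ^+ n.+1 * (eta * (N a b * 2 ^- k) * (X - 1))^-1 =
        2 / eta / (X - 1) * (2 ^+ n / (N a b * 2 ^- k)).
      rewrite exprS; move: M0 X10; move: (N a b * _) (X - 1) (2 ^+ n) => M Z p M0' Z0.
      by field; rewrite !gt_eqF.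
    rewrite ler_piMr ?divr_ge0 ?(ltW X10) ?(ltW eta0)//.
    by rewrite ler_pdivrMr// mul1r.
  have -> : 2 ^+ n.+1 * (2 ^- n.+1 * (N a b * B) / (eta * (N a b * 2 ^- k) * (X - 1)) ^+ 2) =
      B / eta ^+ 2 / (X - 1) * (2 ^+ k / (N a b * 2 ^- k) / (X - 1)).
    have : 2 ^+ k != 0 :> R by rewrite gt_eqF// exprn_gt0.
    move: N0 X10 p2n; move: (N a b) (X - 1) (2 ^+ n.+1) (2 ^+ k) => M Z p p' M0' Z0 p0 p'0.
    by field; rewrite p'0 !gt_eqF.
  rewrite ler_piMr ?divr_ge0 ?exprn_ge0 ?(ltW X10) ?(ltW B0) ?(ltW eta0)//.
  rewrite -mulrA -invfM ler_pdivrMr ?mulr_gt0// mul1r.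
  apply: (@le_trans _ _ (N a b * 2 ^- k)); last by rewrite ler_peMr// ltW.
  by apply: le_trans M_ge; rewrite ler_weXn2l// ler1n.
apply: le_trans (ler_wpM2r (ltW X1) avg) _.
rewrite mulrAC ler_pdivrMr// /C2 -subr_ge0.
have -> : (4 + 2 * E) * (X - 1) - E * (1 + X) = 4 * (X - 1) + E * (X - 3) by ring.
by rewrite addr_ge0// mulr_ge0// ?(ltW X10)// subr_ge0 ltW.
Qed.

End coefficients.

(** * Decay on the frequency grid *)

Section grid_decay.
Context d (T : measurableType d) d0 (T0 : measurableType d0) (R : realType)
  (P : probability T R) (P0 : probability T0 R) (V : {RV P0 >-> R})
  (Y : seq bool -> T -> R).
Hypothesis iY : iid_family P (distribution P0 V) Y.
Hypothesis V0 : forall w, 0 <= V w.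
Hypothesis Y0 : forall v w, 0 <= Y v w.
Hypothesis EV : (\int[P0]_w (V w)%:E = 1)%E.
Variables (q M : R).
Hypothesis q1 : 1 < q.
Hypothesis VqM : (\int[P0]_w (V w `^ q)%:E = M%:E)%E.
Variables r r1 r2 : R.
Hypothesis r0 : 0 < r.
Hypothesis rr1 : r < r1.
Hypothesis r12 : r1 < r2.
Hypothesis r21 : r2 < 1.
Hypothesis Mr : 2 * (2^-1 `^ q * M) < (r ^+ 2) `^ q.
Variables (g : R -> R * R) (x y dx dy ddx ddy : R -> R) (c : R).
Hypothesis A : regular_arc g x y dx dy ddx ddy c.
Variable Phi : R -> R -> R -> R -> R.
Hypothesis dPhi : forall a b be, phase_primitive x y (Phi a b be) a b be.

(** For [i < 2 ^ (4 m + 4)], the points of mesh [2 ^ (- 2 m)] that fill [[- 2 ^ (2 m + 3), 2 ^ (2 m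
    + 3)[]. *)
Definition grid (m i : nat) : R := (i%:R - 2 ^+ (4 * m + 3)) / 2 ^+ (2 * m).

(** The two phases produce the cosine and the sine, that is, the real and imaginary parts of the
    transform up to sign. *)
Definition quarter_turn (s : bool) : R := if s then pi / 2 else 0.

Lemma grid_decay : {ae P, forall w, exists C N, forall m (i j : nat) s p,
  (i < 2 ^ (4 * m + 4))%N -> (j < 2 ^ (4 * m + 4))%N -> (N <= m)%N -> (m <= p)%N ->
  2 ^+ (2 * m) <= `|grid m i| + `|grid m j| ->
  `|level_mass Y p (average (Phi (grid m i) (grid m j) (quarter_turn s))) w| <= C * r2 ^+ (2 * m)}.
Proof.
pose J m : finType := ('I_(2 ^ (4 * m + 4)) * 'I_(2 ^ (4 * m + 4)) * bool)%type.
(* Grid points of small norm get coefficient 0, so that the block hypothesis holds for every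
   index. *)
pose cf m (j : J m) (n : nat) (v : seq bool) : R :=
  if 2 ^+ (2 * m) <= `|grid m j.1.1| + `|grid m j.1.2| then
    average (Phi (grid m j.1.1) (grid m j.1.2) (quarter_turn j.2)) v else 0.
have [C0 C00 hC0] := coefficient_block A.
have cardJ m : (#|J m| <= 512 * 2 ^ (8 * m))%N.
  rewrite !card_prod !card_ord card_bool -expnD -(expnSr 2) -[512%N]/(2 ^ 9)%N -expnD.
  by rewrite leq_exp2l//; clear; lia.
have cf_avg m j n v : size v = n ->
    (@cf m j n.+1 (rcons v false) + cf m j n.+1 (rcons v true)) / 2 = cf m j n v.
  rewrite /cf; case: ifP => _ vn; first exact: average_split vn.
  by rewrite addr0 mul0r.
have cf1 m j n v : `|@cf m j n v| <= 1.
  rewrite /cf; case: ifP => _; last by rewrite normr0.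
  exact: (average_le1 _ (@dPhi _ _ _)).
have cf_block m j n : (m <= n)%N -> exists2 h : seq bool -> R,
    (forall v, size v = n.+1 -> `|@cf m j n.+1 v| <= h (take (2 * m - n) v)) &
    \sum_(u <- words (2 * m - n)) h u <= C0 * (2 * m - n).+1%:R.
  move=> mn; rewrite /cf; have [le|_] := boolP (2 ^+ (2 * m) <= `|grid m j.1.1| + `|grid m j.1.2|).
    exact: (hC0 _ _ _ _ _ _ (@dPhi _ _ _) mn le).
  exists (fun=> 0) => [v _|]; first by rewrite normr0.
  by rewrite big1// mulr_ge0.
have := uniform_decay iY V0 Y0 EV q1 VqM r0 rr1 r12 r21 Mr cardJ cf_avg cf1 C00 cf_block.
apply: filterS => w [C [N h]]; exists C, N => m i j s p im jm Nm mp le.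
by have := h m (Ordinal im, Ordinal jm, s) p Nm mp; rewrite /cf/= le.
Qed.

End grid_decay.

(** * Weak limits and Fourier decay *)

Section set_function_integral.
Import HBNNSimple.

(* [eq_measure_integral] for set functions that need not be measures. *)
Lemma eq_set_function_integral d (T : measurableType d) (R : realType)
    (m1 m2 : set T -> \bar R) (f : T -> \bar R) :
  (forall A, measurable A -> m1 A = m2 A) ->
  (\int[m1]_x f x = \int[m2]_x f x)%E.
Proof.
move=> m12.
have sE (h : {nnsfun T >-> R}) : sintegral m1 h = sintegral m2 h.
  by apply: eq_fsbigr => r _; rewrite m12.
rewrite /integral; congr (ereal_sup _ - ereal_sup _)%E; apply/seteqP.
  by split=> _ [h hf <-]; exists h.
by split=> _ [h hf <-]; exists h.
Qed.

End set_function_integral.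

Lemma ge0_integral_mrestr d (T : measurableType d) (R : realType)
    (m : {measure set T -> \bar R}) (D : set T) (mD : measurable D) (f : T -> \bar R) :
  measurable_fun setT f -> (forall x, 0 <= f x)%E ->
  (\int[mrestr m mD]_x f x = \int[m]_(x in D) f x)%E.
Proof.
move=> mf f0; have mDc : measurable (~` D) by exact: measurableC.
have mf' E : measurable_fun E f by exact: measurable_funTS.
rewrite -(setUv D) ge0_integral_setU//; last by rewrite disj_set2E setICr.
rewrite [X in (_ + X)%E]null_set_integral ?adde0//; last by rewrite /= /mrestr setICl measure0.
apply: eq_measure_integral => A mA AD.
by rewrite /= /mrestr setIidl.
Qed.

Section cascade_integrals.
Context d (T : measurableType d) (R : realType) (Y : seq bool -> T -> R).
Hypothesis Y0 : forall v w, 0 <= Y v w.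
Local Notation left := (cascade_left R).
Local Notation itv := (@cascade_itv R).
Implicit Types (f F : R -> R) (t : R).

Lemma measurable_cascade_itv v : measurable (itv v).
Proof. by rewrite /cascade_itv; case: ifP => _; exact: measurable_itv. Qed.

Lemma cascade_approxE n w A : measurable A -> cascade_approx Y n w A =
  (\sum_(v <- words n) (cascade_weight Y v w)%:E * lebesgue_measure (itv v `&` A))%E.
Proof.
move=> mA; rewrite /cascade_approx.
under eq_integral do rewrite /cascade_density
  (sum_tuple_words n (fun v => cascade_weight Y v w * \1_(itv v) _)) -sumEFin.
rewrite ge0_integral_sum//; last 2 first.
- move=> v; apply/measurable_EFinP; apply: measurable_funM => //.
  by apply: measurable_indic; exact: measurable_cascade_itv.
- by move=> v x _; rewrite lee_fin mulr_ge0// cascade_weight_ge0.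
apply: eq_bigr => v _; under eq_integral do rewrite EFinM.
rewrite ge0_integralZl_EFin//; last 2 first.
- apply/measurable_EFinP; apply: measurable_indic; exact: measurable_cascade_itv.
- by rewrite cascade_weight_ge0.
by rewrite integral_indic//; exact: measurable_cascade_itv.
Qed.

(** [cascade_approx] is a mere set function, so additivity of its integral is not at hand. It is
    exchanged for a finite sum of scaled restrictions of Lebesgue measure that agrees with it on
    measurable sets. *)
Lemma cascade_approx_integral n w f : continuous f -> (forall t, 0 <= f t) ->
  (\int[cascade_approx Y n w]_t (f t)%:E =
   \sum_(v <- words n) (cascade_weight Y v w)%:E * \int[lebesgue_measure]_(t in itv v) (f t)%:E)%E.
Proof.
move=> fc f0.
have mf : measurable_fun setT (EFin \o f).
  by apply/measurable_EFinP; exact: continuous_measurable_fun.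
(* Lebesgue measure is declared on [measurableTypeR R]; the identity carries it to [R]. *)
pose idR : measurableTypeR R -> R := idfun.
have midR : measurable_fun setT idR by exact: (@measurable_id _ (measurableTypeR R) setT).
pose idm : {mfun measurableTypeR R >-> R} := HB.pack idR
  (@isMeasurableFun.Build _ _ (measurableTypeR R) R idR midR).
pose m_ (i : nat) : {measure set R -> \bar R} :=
  mscale (NngNum (cascade_weight_ge0 (nth [::] (words n) i) w Y0))
    (mrestr (image_measure lebesgue_measure idm) (measurable_cascade_itv (nth [::] (words n) i))).
have approxE A : measurable A -> cascade_approx Y n w A = msum m_ (size (words n)) A.
  move=> mA; rewrite cascade_approxE; last exact: mA.
  rewrite /msum (big_nth [::]) big_mkord; apply: eq_bigr => i _.
  by rewrite /m_/= /mscale/= /mrestr setIC.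
transitivity (\int[msum m_ (size (words n))]_t (f t)%:E)%E.
  exact: eq_set_function_integral.
rewrite ge0_integral_measure_sum//; last by move=> x _; rewrite lee_fin.
rewrite [RHS](big_nth [::]) big_mkord; apply: eq_bigr => i _.
rewrite ge0_integral_mscale//; last by move=> x _; rewrite lee_fin.
rewrite ge0_integral_mrestr//.
congr (_ * _)%E; rewrite (@ge0_integral_pushforward _ _ (measurableTypeR R) R R idR midR)//.
- exact: measurable_cascade_itv.
- exact: measurable_funTS.
- by move=> x _; rewrite lee_fin.
Qed.

Lemma cascade_itv_integral f F v : continuous f -> (forall t, 0 <= f t) ->
  (forall t, t \in `[0, 1] -> is_derive t 1 F (f t)) ->
  (\int[lebesgue_measure]_(t in itv v) (f t)%:E =
   (2 ^- size v * average F v)%:E)%E.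
Proof.
move=> fc f0 dF.
have mf D : measurable_fun D (EFin \o f).
  by apply: measurable_funTS; apply/measurable_EFinP; exact: continuous_measurable_fun.
have p0 : 0 < 2 ^- size v :> R by rewrite invr_gt0 exprn_gt0.
transitivity (\int[lebesgue_measure]_(t in `[left v, (left v + 2 ^- size v)%R]) (f t)%:E)%E.
  rewrite /cascade_itv; case: ifPn => allv; last first.
    exact: integral_itv_bndo_bndc.
  suff -> : left v + 2 ^- size v = 1 by [].
  rewrite cascade_left_position -[X in _ + X]mul1r -mulrDl natr1.
  suff -> : (position v).+1 = (2 ^ size v)%N by rewrite natrX divff// gt_eqF// exprn_gt0.
  elim/last_ind: v allv {p0} => // v b IH; rewrite all_rcons => /andP[/= -> /IH vE].
  by rewrite position_rcons size_rcons expnS -vE mul2n doubleS addn1.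
have dF' t : t \in `[left v, left v + 2 ^- size v] -> is_derive t 1 F (f t).
  by move=> /word_itv; exact: dF.
have Fc t : t \in `[left v, left v + 2 ^- size v] -> {for t, continuous F}.
  by move=> /dF'[dFt _]; apply: differentiable_continuous; exact/derivable1_diffP.
have lI : left v \in `[left v, left v + 2 ^- size v] by rewrite in_itv/= lexx lerDl ltW.
have rI : left v + 2 ^- size v \in `[left v, left v + 2 ^- size v].
  by rewrite in_itv/= lexx lerDl ltW.
rewrite (@continuous_FTC2 _ f F) ?ltrDl//; last 3 first.
- exact: continuous_subspaceT.
- split; first by move=> t /subset_itv_oo_cc /dF'[].
    by apply: cvg_at_right_filter; exact: Fc.
  by apply: cvg_at_left_filter; exact: Fc.
- by move=> t /subset_itv_oo_cc /dF'[_ <-]; rewrite derive1E.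
by rewrite -EFinB /average mulrA mulVf ?mul1r// expf_neq0// pnatr_eq0.
Qed.

Lemma cascade_approx_level_mass n w f F : continuous f -> (forall t, 0 <= f t) ->
  (forall t, t \in `[0, 1] -> is_derive t 1 F (f t)) ->
  (\int[cascade_approx Y n w]_t (f t)%:E = (level_mass Y n (average F) w)%:E)%E.
Proof.
move=> fc f0 dF; rewrite cascade_approx_integral// -sumEFin; apply: eq_bigr => v _.
rewrite (cascade_itv_integral v fc f0 dF) -EFinM; congr (_%:E).
by rewrite /mass; ring.
Qed.

End cascade_integrals.

Section weak_limits.
Context d (T : measurableType d) (R : realType) (Y : seq bool -> T -> R) (w : T).
Hypothesis Y0 : forall v w, 0 <= Y v w.
Variable m : {finite_measure set R -> \bar R}.
Hypothesis Ym : weak_cvg (fun n => cascade_approx Y n w) m.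
Implicit Types (f F : R -> R) (t : R).

Lemma weak_limit_nonneg f F B : continuous f -> (forall t, 0 <= f t <= B) ->
  (forall t, t \in `[0, 1] -> is_derive t 1 F (f t)) ->
  level_mass Y n (average F) w @[n --> \oo] --> \int[m]_t f t.
Proof.
move=> fc fB dF.
have f0 t : 0 <= f t by have /andP[] := fB t.
have fb : bounded_fun f.
  exists B; split; first exact: num_real.
  by move=> x Bx t _ /=; rewrite ger0_norm// (le_trans _ (ltW Bx))//; have /andP[] := fB t.
have mf : m.-integrable setT (EFin \o f).
  apply: measurable_bounded_integrable => //.
  - by rewrite ltey_eq fin_num_measure.
  - exact: continuous_measurable_fun.
have := Ym fc fb.
rewrite -[X in _ --> X]fineK; last exact: integrable_fin_num mf.
under eq_fun do rewrite (cascade_approx_level_mass Y0 _ _ fc f0 dF).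
by move/fine_cvgP => [_].
Qed.

(** The previous convergence needs a nonnegative test function: it is applied to [1 + cos], whose
    primitive is [t + F t], and to 1. *)
Lemma weak_limit_cos x y a b be F : continuous x -> continuous y ->
  phase_primitive x y F a b be ->
  level_mass Y n (average F) w @[n --> \oo] -->
    \int[m]_t cos (2 * pi * (a * x t + b * y t) - be).
Proof.
move=> xc yc dF; set f := fun t => cos _.
have fc : continuous f.
  move=> t; apply: (continuous_comp (f := fun t => 2 * pi * (a * x t + b * y t) - be)).
    apply: cvgB; last exact: cvg_cst.
    by apply: cvgM; [exact: cvg_cst|exact: continuous_comb].
  exact: continuous_cos.
have h1 : level_mass Y n (average (fun t => t + F t)) w @[n --> \oo] --> \int[m]_t (1 + f t).
  apply: (@weak_limit_nonneg _ _ 2).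
  - by move=> t; apply: cvgD; [exact: cvg_cst|exact: fc].
  - by move=> t; have := cos_le1 (2 * pi * (a * x t + b * y t) - be);
       have := cos_geN1 (2 * pi * (a * x t + b * y t) - be); rewrite /f; move: (cos _) => z; lra.
  - by move=> t t01; apply: is_deriveD; exact: dF.
have h2 : level_mass Y n (average id) w @[n --> \oo] --> \int[m]_t 1.
  apply: (@weak_limit_nonneg (cst 1) id 1).
  - by move=> t; exact: cvg_cst.
  - by move=> t; rewrite ler01 lexx.
have i1 : m.-integrable setT (EFin \o (fun=> 1 : R)).
  by apply: finite_measure_integrable_cst.
have i2 : m.-integrable setT (EFin \o f).
  apply: measurable_bounded_integrable => //.
  - by rewrite ltey_eq fin_num_measure.
  - exact: continuous_measurable_fun.
  - exists 1; split; first exact: num_real.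
    by move=> z z1 t _ /=; rewrite (le_trans _ (ltW z1))// ler_norml cos_geN1 cos_le1.
have -> : \int[m]_t f t = \int[m]_t (1 + f t) - \int[m]_t 1.
  by rewrite RintegralD// addrAC subrr add0r.
have -> : (fun n => level_mass Y n (average F) w) =
    (fun n => level_mass Y n (average (fun t => t + F t)) w - level_mass Y n (average id) w).
  apply/funext => n; rewrite /level_mass -sumrB; apply: eq_bigr => v _.
  by rewrite -mulrBr /average; congr (_ * _); ring.
exact: cvgB.
Qed.

Lemma cascade_itv_sub v : cascade_itv v `<=` (`[0, 1] : set R).
Proof.
have l0 := cascade_left_ge0 R v; have r1 := cascade_right_le1 R v.
rewrite /cascade_itv; case: ifP => _ t /=; rewrite !in_itv/= => /andP[t1 t2].
  by rewrite t2 (le_trans l0).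
by rewrite (le_trans l0 t1) (ltW (lt_le_trans t2 r1)).
Qed.

(** The test function is the distance to [[0, 1]], capped at 1: its integrals against the
    approximations vanish, and it is positive off [[0, 1]]. *)
Lemma weak_limit_support : m (~` `[0, 1]) = 0%E.
Proof.
have clampc : continuous (@clamp R).
  move=> t; apply/cvgrPdist_lt => e e0; near=> s.
  by apply: le_lt_trans (clamp_lipschitz _ _) _; near: s; exact: cvgr_dist_lt.
pose f t := clamp `|t - clamp t|.
have fc : continuous f.
  move=> t; apply: (continuous_comp (f := fun t => `|t - clamp t|)); last exact: clampc.
  by apply: cvg_norm; apply: cvgB; [exact: cvg_id|exact: clampc].
have f0 t : 0 <= f t by have := clamp_itv `|t - clamp t|; rewrite in_itv/= => /andP[].
have fb : bounded_fun f.
  exists 1; split; first exact: num_real.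
  move=> x x1 t _ /=; rewrite ger0_norm// (le_trans _ (ltW x1))//.
  by have := clamp_itv `|t - clamp t|; rewrite in_itv/= => /andP[].
have f01 t : t \in `[0, 1] -> f t = 0.
  by move=> t01; rewrite /f [clamp t]clamp_id// subrr normr0 clamp_id// in_itv/= lexx ler01.
have fm0 : (\int[m]_t (f t)%:E = 0)%E.
  have := Ym fc fb; rewrite (_ : (fun n => _) = cst 0%E).
    by move/cvg_lim => <-//; rewrite lim_cst.
  apply/funext => n /=; rewrite cascade_approx_integral// big1// => v _.
  by rewrite integral0_eq ?mule0// => t /cascade_itv_sub /f01 ->.
have mf : measurable_fun setT (EFin \o f).
  by apply/measurable_EFinP; exact: continuous_measurable_fun.
have /ae_eq_integral_abs : (\int[m]_t `|(f t)%:E| = 0)%E.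
  by under eq_integral do rewrite gee0_abs ?lee_fin//.
move=> /(_ measurableT mf)[N [mN N0 sub]].
apply/eqP; rewrite eq_le measure_ge0 andbT -N0 le_measure ?inE//.
  by apply: measurableC; exact: measurable_itv.
move=> t t01; apply: sub => /= /(_ I)[ft0]; apply: t01.
have [x1|x1] := leP `|t - clamp t| 1.
  move: ft0; rewrite /f clamp_id ?in_itv/= ?normr_ge0// => /eqP.
  by rewrite normr_eq0 subr_eq0 => /eqP ->; exact: clamp_itv.
by move: ft0; rewrite /f /clamp min_r ?(ltW x1)// max_r// => /eqP; rewrite oner_eq0.
Unshelve. all: by end_near. Qed.

End weak_limits.

Section carried.
Context (R : realType) (m : {finite_measure set R -> \bar R}).
Hypothesis m01 : m (~` `[0, 1]) = 0%E.
Implicit Types (f : R -> R) (t B : R).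

Lemma continuous_clamp : continuous (@clamp R).
Proof.
move=> t; apply/cvgrPdist_lt => e e0; near=> s.
by apply: le_lt_trans (clamp_lipschitz _ _) _; near: s; exact: cvgr_dist_lt.
Unshelve. all: by end_near. Qed.

Lemma bounded_integrable f B : continuous f -> (forall t, `|f t| <= B) ->
  m.-integrable setT (EFin \o f).
Proof.
move=> fc fB; apply: measurable_bounded_integrable => //.
- by rewrite ltey_eq fin_num_measure.
- exact: continuous_measurable_fun.
- exists B; split; first exact: num_real.
  by move=> z z1 t _ /=; rewrite (le_trans _ (ltW z1)).
Qed.

Lemma carried_Rintegral (f1 f2 : R -> R) : measurable_fun setT f1 -> measurable_fun setT f2 ->
  (forall t, t \in `[0, 1] -> f1 t = f2 t) -> \int[m]_t f1 t = \int[m]_t f2 t.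
Proof.
move=> mf1 mf2 f12; congr fine; apply: ae_eq_integral => //.
- exact/measurable_EFinP.
- exact/measurable_EFinP.
- exists (~` `[0, 1]); split => //; first by apply: measurableC; exact: measurable_itv.
  by move=> t /= /not_implyP[_ h] t01; apply: h; rewrite f12.
Qed.

Lemma carried_bound f B : continuous f -> (forall t, t \in `[0, 1] -> `|f t| <= B) ->
  `|\int[m]_t f t| <= B * fine (m setT).
Proof.
move=> fc fB.
have fcc : continuous (f \o @clamp R).
  by move=> t; apply: continuous_comp; [exact: continuous_clamp|exact: fc].
rewrite (@carried_Rintegral f (f \o @clamp R)); last 3 first.
- exact: continuous_measurable_fun.
- exact: continuous_measurable_fun.
- by move=> t t01 /=; rewrite clamp_id.
have fB' t : `|(f \o @clamp R) t| <= B by apply: fB; exact: clamp_itv.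
have fi := bounded_integrable fcc fB'.
apply: le_trans (le_normr_Rintegral measurableT fi) _.
rewrite -Rintegral_cst//; apply: le_Rintegral => //.
- have := integrable_norm fi; exact.
- exact: finite_measure_integrable_cst.
Qed.

End carried.

Lemma cos_lipschitz (R : realType) (u v : R) : `|cos u - cos v| <= `|u - v|.
Proof.
wlog uv : u v / v < u.
  move=> H; case: (ltgtP v u) => [|uv|->]; [exact: H| |by rewrite !subrr].
  by rewrite distrC [leRHS]distrC; exact: H.
have [z _ ->] := MVT uv (fun t _ => is_derive_cos t) (continuous_subspaceT (@continuous_cos R)).
by rewrite normrM ler_piMl// normrN ler_norml sin_geN1 sin_le1.
Qed.

Lemma sqrt_sum_sqr_le (R : realType) (a b : R) : Num.sqrt (a ^+ 2 + b ^+ 2) <= `|a| + `|b|.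
Proof.
rewrite -[leRHS]ger0_norm ?addr_ge0// -sqrtr_sqr ler_wsqrtr// sqrrD.
rewrite -[a ^+ 2]real_normK ?num_real// -[b ^+ 2]real_normK ?num_real//.
by rewrite lerD2r lerDl mulrn_wge0// mulr_ge0.
Qed.

Lemma power4_scale (R : realType) (z : R) : 1 <= z ->
  exists k : nat, 4 ^+ k <= z < 4 ^+ k.+1.
Proof.
move=> z1; have z0 : 0 <= z by apply: le_trans z1.
have /andP[t1 t2] := truncn_itv z0.
have t0 : (0 < Num.truncn z)%N by case: (Num.truncn z) t2 => //; lra.
exists (trunc_log 4 (Num.truncn z)).
have /andP[l1 l2] := trunc_log_bounds (isT : (1 < 4)%N) t0.
apply/andP; split; first by apply: le_trans t1; rewrite -natrX ler_nat.
by apply: lt_le_trans t2 _; rewrite -natrX ler_nat.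
Qed.

Section fourier_of_arc.
Context (R : realType) (g : R -> R * R) (x y dx dy ddx ddy : R -> R) (c : R).
Hypothesis A : regular_arc g x y dx dy ddx ddy c.
Variables (m : {finite_measure set R -> \bar R}) (gamma : {mfun R >-> (R * R)%type}).
Hypothesis m01 : m (~` `[0, 1]) = 0%E.
Hypothesis gammaE : g = gamma.
Implicit Types a b be t : R.

Definition phase_integral a b be : R := \int[m]_t cos (2 * pi * (a * x t + b * y t) - be).

Lemma continuous_phase a b be : continuous (fun t => cos (2 * pi * (a * x t + b * y t) - be)).
Proof.
have [xc yc _ _] := arc_cont A.
move=> t; apply: (continuous_comp (f := fun t => 2 * pi * (a * x t + b * y t) - be)).
  apply: cvgB; last exact: cvg_cst.
  by apply: cvgM; [exact: cvg_cst|exact: continuous_comb].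
exact: continuous_cos.
Qed.

Lemma image_cos_integral (xi : R * R) be :
  \int[image_measure m gamma]_p cos (2 * pi * dot2 p xi - be) = phase_integral xi.1 xi.2 be.
Proof.
have md : measurable_fun setT (fun p : R * R => cos (2 * pi * dot2 p xi - be)).
  apply: measurableT_comp; first exact: (continuous_measurable_fun (@continuous_cos R)).
  apply: measurable_funB => //; apply: measurable_funM => //; apply: measurable_funD.
    by apply: measurable_funM => //; exact: measurable_fst.
  by apply: measurable_funM => //; exact: measurable_snd.
have mg : measurable_fun setT (fun t => cos (2 * pi * dot2 (gamma t) xi - be)).
  by apply: (measurableT_comp md).
rewrite /phase_integral -(@carried_Rintegral _ m m01 (fun t => cos (2 * pi * dot2 (gamma t) xi - be))) => [||//|]; last 2 first.
- exact: continuous_measurable_fun (@continuous_phase _ _ _).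
- move=> t t01; rewrite -gammaE (arc_eq A t01) /dot2/=.
  by rewrite [x t * _]mulrC [y t * _]mulrC.
congr fine; rewrite /image_measure integral_pushforward//.
- exact/measurable_EFinP.
- rewrite preimage_setT; apply: measurable_bounded_integrable => //.
  + by rewrite ltey_eq fin_num_measure.
  + exists 1; split; first exact: num_real.
    by move=> z z1 t _ /=; rewrite (le_trans _ (ltW z1))// ler_norml cos_geN1 cos_le1.
exact: mg.
Qed.

Lemma fourier_le (xi : R * R) : Normc.normc (fourier (image_measure m gamma) xi) <=
  `|phase_integral xi.1 xi.2 0| + `|phase_integral xi.1 xi.2 (pi / 2)|.
Proof.
rewrite -!image_cos_integral /fourier.
have -> : (fun p => cos (2 * pi * dot2 p xi - 0)) = (fun p => cos (2 * pi * dot2 p xi)).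
  by apply/funext => p; rewrite subr0.
have -> : (fun p => cos (2 * pi * dot2 p xi - pi / 2)) = (fun p => sin (2 * pi * dot2 p xi)).
  by apply/funext => p; rewrite cosBpihalf.
by rewrite /Normc.normc sqrrN; exact: sqrt_sum_sqr_le.
Qed.

Lemma phase_integral_lipschitz : exists2 K, 0 <= K & forall a b a' b' be,
  `|phase_integral a b be - phase_integral a' b' be| <= K * (`|a - a'| + `|b - b'|).
Proof.
have [xc yc _ _] := arc_cont A.
have [B1 B11 hx] := bounded01 xc; have [B2 B21 hy] := bounded01 yc.
pose B := B1 + B2; have B0 : 0 <= B by rewrite /B; lra.
have p0 : 0 <= 2 * pi :> R by rewrite mulr_ge0// pi_ge0.
exists (2 * pi * B * fine (m setT)); first by rewrite mulr_ge0 ?fine_ge0// mulr_ge0.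
move=> a b a' b' be; rewrite /phase_integral -RintegralB//; last 2 first.
- apply: (@bounded_integrable R m _ 1); first exact: continuous_phase.
  by move=> t; rewrite ler_norml cos_geN1 cos_le1.
- apply: (@bounded_integrable R m _ 1); first exact: continuous_phase.
  by move=> t; rewrite ler_norml cos_geN1 cos_le1.
rewrite mulrAC; apply: (carried_bound m01).
  by move=> t; apply: cvgB; exact: continuous_phase.
move=> t t01; apply: le_trans (cos_lipschitz _ _) _.
have -> : 2 * pi * (a * x t + b * y t) - be - (2 * pi * (a' * x t + b' * y t) - be) =
  2 * pi * ((a - a') * x t + (b - b') * y t) by ring.
rewrite normrM ger0_norm// -[_ * B * _]mulrA ler_wpM2l// [B * _]mulrC.
apply: comb_le.
  by apply: le_trans (hx t t01) _; rewrite /B; lra.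
by apply: le_trans (hy t t01) _; rewrite /B; lra.
Qed.

Lemma grid_approx k a : `|a| < 2 ^+ (2 * k + 3) ->
  exists2 i, (i < 2 ^ (4 * k + 4))%N & `|a - grid R k i| <= 2 ^- (2 * k).
Proof.
move=> ak; have p0 : 0 < 2 ^+ (2 * k) :> R by rewrite exprn_gt0.
pose z := a * 2 ^+ (2 * k) + 2 ^+ (4 * k + 3).
have pE : 2 ^+ (4 * k + 3) = 2 ^+ (2 * k + 3) * 2 ^+ (2 * k) :> R.
  by rewrite -exprD; congr (_ ^+ _); clear; lia.
have zE : z = (a + 2 ^+ (2 * k + 3)) * 2 ^+ (2 * k) by rewrite /z pE mulrDl.
have /andP[a1 a2] : - 2 ^+ (2 * k + 3) < a < 2 ^+ (2 * k + 3) by rewrite -ltr_norml.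
have z0 : 0 <= z by rewrite zE mulr_ge0 ?(ltW p0)//; lra.
have /andP[t1 t2] := truncn_itv z0.
exists (Num.truncn z).
  rewrite -(ltr_nat R); apply: le_lt_trans t1 _.
  rewrite zE natrX; have -> : (4 * k + 4 = (2 * k + 3).+1 + 2 * k)%N by clear; lia.
  have -> : 2 ^+ ((2 * k + 3).+1 + 2 * k) = (2 * 2 ^+ (2 * k + 3)) * 2 ^+ (2 * k) :> R.
    by rewrite exprD exprS.
  rewrite ltr_pM2r//; lra.
have -> : a - grid R k (Num.truncn z) = (z - (Num.truncn z)%:R) / 2 ^+ (2 * k).
  by rewrite /grid /z; field; rewrite gt_eqF.
rewrite normrM normfV (gtr0_norm p0) ger0_norm ?subr_ge0// ler_pdivrMr// mulVf ?gt_eqF//.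
by move: t2; rewrite -natr1; lra.
Qed.

(** Moving to the nearest grid point costs [2 K 2 ^ (- 2 k)] by the Lipschitz bound, which
    [r >= 1/2] keeps below [2 K r ^ (2 k)]. *)
Lemma grid_fourier_decay (s C : R) N0 : 0 <= s -> 2^-1 <= 2 `^ (- (s / 2)) ->
  (forall k i j q, (i < 2 ^ (4 * k + 4))%N -> (j < 2 ^ (4 * k + 4))%N -> (N0 <= k)%N ->
    2 ^+ (2 * k) <= `|grid R k i| + `|grid R k j| ->
    `|phase_integral (grid R k i) (grid R k j) (quarter_turn R q)| <= C * (2 `^ (- (s / 2))) ^+ (2 * k)) ->
  fourier_decay (image_measure m gamma) s.
Proof.
move=> s0; set r := 2 `^ _ => r2 hC.
have r0 : 0 < r by exact: lt_le_trans r2.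
have C0 : 0 <= `|C| by [].
have [K K0 hK] := phase_integral_lipschitz.
(* The norm of [xi] may reach [2 ^ (2 k + 3)], three powers of [r] beyond the scale [2 k]. The
   factor 2 of the constant below adds cosine and sine. *)
pose D := (`|C| + 2 * K) / r ^+ 3.
exists (2 * D), (2 * 4 ^+ (maxn N0 1)) => xi xi_ge.
have n2 : norm2 xi <= `|xi.1| + `|xi.2|.
  exact: sqrt_sum_sqr_le.
(* Choosing [k] from half of the sum leaves room for rounding: the rounded frequency must still have
   size at least [2 ^ (2 k)]. *)
pose z := (`|xi.1| + `|xi.2|) / 2.
have z_ge : 4 ^+ (maxn N0 1) <= z by rewrite /z ler_pdivlMr// mulrC (le_trans xi_ge).
have z1 : 1 <= z by apply: le_trans z_ge; rewrite exprn_ege1// ler1n.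
have [k /andP[k1 k2]] := power4_scale z1.
have kN : (maxn N0 1 <= k)%N.
  by rewrite -ltnS -(ltr_eXn2l (_ : 1 < 4 :> R)) ?ltr1n//; exact: le_lt_trans k2.
have N0k : (N0 <= k)%N by apply: leq_trans kN; exact: leq_maxl.
have k0 : (1 <= k)%N by apply: leq_trans kN; exact: leq_maxr.
have p4 i : 4 ^+ i = 2 ^+ (2 * i) :> R by rewrite exprM; congr (_ ^+ _); ring.
have N_lt : `|xi.1| + `|xi.2| < 2 ^+ (2 * k + 3).
  move: k2; rewrite /z ltr_pdivrMr// p4 -exprSr => /lt_le_trans; apply.
  by rewrite ler_weXn2l ?ler1n//; clear; lia.
have N_ge : 2 ^+ (2 * k).+1 <= `|xi.1| + `|xi.2|.
  by move: k1; rewrite /z ler_pdivlMr// p4 -exprSr.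
have [i i_lt i_close] : exists2 i, (i < 2 ^ (4 * k + 4))%N & `|xi.1 - grid R k i| <= 2 ^- (2 * k).
  by apply: grid_approx; apply: le_lt_trans N_lt; rewrite lerDl.
have [j j_lt j_close] : exists2 i, (i < 2 ^ (4 * k + 4))%N & `|xi.2 - grid R k i| <= 2 ^- (2 * k).
  by apply: grid_approx; apply: le_lt_trans N_lt; rewrite lerDr.
have p1 : 2 <= 2 ^+ (2 * k) :> R.
  by rewrite -[X in X <= _]expr1 ler_weXn2l ?ler1n//; clear -k0; lia.
have p2 : 2 ^- (2 * k) <= 2^-1 :> R by rewrite lef_pV2 ?posrE// exprn_gt0.
have g_ge : 2 ^+ (2 * k) <= `|grid R k i| + `|grid R k j|.
  have := ler_normB xi.1 (xi.1 - grid R k i); have := ler_normB xi.2 (xi.2 - grid R k j).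
  rewrite !opprB ![_ + (_ - _)]addrC !subrK.
  have := ler_normD (grid R k i) (xi.1 - grid R k i); have := ler_normD (grid R k j) (xi.2 - grid R k j).
  rewrite ![grid R k _ + (_ - _)]addrC !subrK; move: N_ge; rewrite exprS.
  move: (2 ^+ (2 * k)) (2 ^- (2 * k)) i_close j_close p1 p2 => u v; lra.
have rpow : 2 ^- (2 * k) <= r ^+ (2 * k).
  by rewrite -exprVn; apply: lerXn2r; rewrite ?nnegrE ?invr_ge0 ?(ltW r0).
have bound q : `|phase_integral xi.1 xi.2 (quarter_turn R q)| <= (`|C| + 2 * K) * r ^+ (2 * k).
  have h1 := hC k i j q i_lt j_lt N0k g_ge.
  have h2 := hK xi.1 xi.2 (grid R k i) (grid R k j) (quarter_turn R q).
  have h3 : C * r ^+ (2 * k) <= `|C| * r ^+ (2 * k).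
    by rewrite ler_wpM2r ?exprn_ge0 ?(ltW r0)// ler_norm.
  have h4 : K * (`|xi.1 - grid R k i| + `|xi.2 - grid R k j|) <= 2 * K * r ^+ (2 * k).
    rewrite [2 * K]mulrC -mulrA ler_wpM2l// mulrDl !mul1r lerD//; exact: le_trans rpow.
  have := ler_normD (phase_integral (grid R k i) (grid R k j) (quarter_turn R q))
    (phase_integral xi.1 xi.2 (quarter_turn R q) - phase_integral (grid R k i) (grid R k j) (quarter_turn R q)).
  rewrite addrC subrK mulrDl; move: h1 h2 h3 h4; rewrite -/r.
  move: `|phase_integral _ _ _| `|phase_integral _ _ _| `|_ - _| => u1 u2 u3; lra.
have xi0 : 0 < norm2 xi.
  by apply: lt_le_trans xi_ge; rewrite mulr_gt0// exprn_gt0.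
have rn : r ^+ (2 * k + 3) <= norm2 xi `^ (- (s / 2)).
  have -> : r ^+ (2 * k + 3) = (2 ^+ (2 * k + 3)) `^ (- (s / 2)).
    by rewrite powR_exprn.
  rewrite !powRN lef_pV2 ?posrE ?powR_gt0 ?exprn_gt0//.
  apply: ge0_ler_powR; rewrite ?nnegrE ?divr_ge0 ?exprn_ge0 ?(ltW xi0)//.
  exact: le_trans n2 (ltW N_lt).
apply: le_trans (fourier_le xi) _.
have D0 : 0 <= D by rewrite divr_ge0 ?exprn_ge0 ?(ltW r0)// addr_ge0// mulr_ge0.
have E : (`|C| + 2 * K) * r ^+ (2 * k) = D * r ^+ (2 * k + 3).
  have : r ^+ 3 != 0 by rewrite gt_eqF// exprn_gt0.
  by rewrite /D exprD; move: (r ^+ (2 * k)) (r ^+ 3) => u v v0; field.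
have := ler_wpM2l D0 rn; have := bound false; have := bound true; rewrite /= E.
move: `|phase_integral _ _ _| `|phase_integral _ _ _| => u1 u2; lra.
Qed.

End fourier_of_arc.

(** * Moments and the endpoint exponent *)

Section moments.
Context d0 (T0 : measurableType d0) (R : realType) (P0 : probability T0 R) (W : {RV P0 >-> R}).
Hypothesis hW : minimal_Kahane_Peyriere P0 W.

(** [W] is nonnegative only almost surely. The positive part has the same integrals and is
    nonnegative everywhere, as the level masses require. *)
Definition positive_part (w : T0) : R := Num.max (W w) 0.

Lemma measurable_positive_part : measurable_fun setT positive_part.
Proof. exact: measurable_maxr. Qed.

HB.instance Definition _ := isMeasurableFun.Build _ _ _ _ positive_part measurable_positive_part.

Lemma positive_part_ge0 w : 0 <= positive_part w.
Proof. by rewrite /positive_part le_max lexx orbT. Qed.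

Lemma positive_part_integral (f : R -> R) : measurable_fun setT f ->
  (\int[P0]_w (f (positive_part w))%:E = \int[P0]_w (f (W w))%:E)%E.
Proof.
move=> mf; apply: ae_eq_integral => //.
- by apply/measurable_EFinP; apply: measurableT_comp => //; exact: measurable_positive_part.
- by apply/measurable_EFinP; apply: measurableT_comp.
- case: hW => + _ _ _; apply: filterS => w W0 _.
  by rewrite /positive_part max_l.
Qed.

Lemma positive_part_mean : (\int[P0]_w (positive_part w)%:E = 1)%E.
Proof.
by rewrite (positive_part_integral (@measurable_id _ _ _)); case: hW => _ <- _ _; rewrite unlock.
Qed.

Lemma positive_part_moment q : (\int[P0]_w (positive_part w `^ q)%:E = 'E_P0[fun w => (W w `^ q)%R])%E.
Proof.
by rewrite unlock (positive_part_integral (measurable_powR q)).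
Qed.

(** Integrate Young's inequality [V <= V ^ q / q + (1 - 1 / q)] and use [E V = 1]. *)
Lemma moment_ge1 q M : 1 < q -> (\int[P0]_w (positive_part w `^ q)%:E = M%:E)%E -> 1 <= M.
Proof.
move=> q1 VqM; have q0 : 0 < q by apply: lt_trans q1.
have c0 : 0 <= 1 - q^-1 by rewrite subr_ge0 invf_le1// ltW.
have young w : positive_part w <= q^-1 * positive_part w `^ q + (1 - q^-1).
  have e0 : q - 1 != 0 by rewrite subr_eq0 gt_eqF.
  have := @conjugate_powR R (positive_part w) 1 q (q / (q - 1)) (positive_part_ge0 w) ler01 q0.
  rewrite mulr1 powR1 => /(_ _ _)/le_trans; apply.
  - by rewrite divr_gt0// subr_gt0.
  - by field; rewrite e0 gt_eqF.
  - by rewrite mulrC lerD2l; rewrite le_eqVlt; apply/orP; left; apply/eqP; field; rewrite e0 gt_eqF.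
have mp : measurable_fun setT (fun w => positive_part w `^ q).
  exact: (measurableT_comp (measurable_powR q) measurable_positive_part).
have : (1 <= (q^-1 * M + (1 - q^-1))%:E :> \bar R)%E.
  rewrite -positive_part_mean EFinD EFinM -VqM -[X in (_ <= _ + X)%E]mule1 -(@probability_setT _ _ _ P0).
  rewrite -integral_cst// -ge0_integralZl_EFin ?invr_ge0 ?(ltW q0)//; last 2 first.
  - by move=> w _; rewrite lee_fin powR_ge0.
  - exact/measurable_EFinP.
  have p1 w : setT w -> (0 <= (q^-1)%:E * (positive_part w `^ q)%:E)%E.
    by move=> _; rewrite mule_ge0// lee_fin ?invr_ge0 ?(ltW q0)// powR_ge0.
  have m1 : measurable_fun setT (fun w => (q^-1)%:E * (positive_part w `^ q)%:E)%E.
    by apply: measurable_funeM; exact/measurable_EFinP.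
  have p2 (w : T0) : setT w -> (0 <= cst (1 - q^-1)%:E w)%E by move=> _; rewrite lee_fin.
  rewrite -(ge0_integralD P0 measurableT p1 m1 p2 (measurable_cst _)).
  apply: ge0_le_integral => //.
  - by move=> w _; rewrite lee_fin positive_part_ge0.
  - by apply/measurable_EFinP; exact: measurable_positive_part.
  - apply: emeasurable_funD; last exact: measurable_cst.
    by apply: measurable_funeM; exact/measurable_EFinP.
  - by move=> w _; rewrite -EFinM -EFinD lee_fin young.
rewrite lee_fin => h.
have : q^-1 <= q^-1 * M by move: h; move: (q^-1 * M) => z; lra.
by rewrite -[X in X <= _ -> _]mulr1 ler_pM2l// invr_gt0.
Qed.

Lemma A_loc_term_ge0 q : 0 <= A_loc_term P0 W q.
Proof. by rewrite /A_loc_term; case: ifP => // _; rewrite le_max lexx. Qed.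

Lemma log2_ge0 (M : R) : 1 <= M -> 0 <= log2 M.
Proof. by move=> M1; rewrite /log2 divr_ge0 ?ln_ge0// ler1n. Qed.

Lemma moment_ge0 q : (0 <= 'E_P0[fun w => (W w `^ q)%R])%E.
Proof. by rewrite -positive_part_moment; apply: integral_ge0 => w _; rewrite lee_fin powR_ge0. Qed.

Lemma A_loc_term_le1 q : 1 < q -> A_loc_term P0 W q <= 1.
Proof.
move=> q1; have q0 : 0 < q by apply: lt_trans q1.
rewrite /A_loc_term; case: ifPn => [//|Moo].
have Mf : (('E_P0[fun w => (W w `^ q)%R])%E \is a fin_num).
  by rewrite ge0_fin_numE ?moment_ge0// ltey.
have M1 : 1 <= fine ('E_P0[fun w => (W w `^ q)%R])%E.
  by apply: (moment_ge1 q1); rewrite positive_part_moment fineK.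
rewrite ge_max ler01/= ler_pdivrMr// mul1r.
by have := log2_ge0 M1; move: (log2 _) => z; lra.
Qed.

Lemma A_loc_has_sup : has_sup [set A_loc_term P0 W q | q in [set q : R | 1 < q]].
Proof.
split; first by exists (A_loc_term P0 W 2), 2 => //=; rewrite ltr1n.
by exists 1 => _ [q q1 <-]; exact: A_loc_term_le1.
Qed.

Lemma A_loc_ge0 : 0 <= A_loc P0 W.
Proof.
apply: le_trans (A_loc_term_ge0 2) _; apply: ub_le_sup; first by case: A_loc_has_sup.
by exists 2 => //=; rewrite ltr1n.
Qed.

Lemma A_loc_le1 : A_loc P0 W <= 1.
Proof.
apply: ge_sup; first by case: A_loc_has_sup.
by move=> _ [q q1 <-]; exact: A_loc_term_le1.
Qed.

Lemma powR2_log2 (M : R) : 0 < M -> 2 `^ (log2 M) = M.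
Proof.
move=> M0; have l2 : ln 2 != 0 :> R by rewrite gt_eqF// ln_gt0// ltr1n.
by rewrite /powR /log2 pnatr_eq0/= -mulrA mulVf// mulr1 lnK.
Qed.

(** An infinite moment contributes 0, so a term above [s >= 0] has a finite one. The exponent [s'],
    halfway between [s] and this term, leaves room for two intermediate rates. *)
Lemma A_loc_gt (s : R) : 0 <= s < A_loc P0 W -> exists q M s', [/\ 1 < q,
  (\int[P0]_w (positive_part w `^ q)%:E = M%:E)%E, s < s' &
  2 * (2^-1 `^ q * M) < (2 `^ (- s')) `^ q].
Proof.
move=> /andP[s0 sA].
have [_ [q q1 <-] sq] := sup_gt A_loc_has_sup.1 sA.
have q0 : 0 < q by apply: lt_trans q1.
move: sq; rewrite /A_loc_term; case: ifPn => [_|Moo]; first by rewrite ltNge s0.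
have Mf : (('E_P0[fun w => (W w `^ q)%R])%E \is a fin_num).
  by rewrite ge0_fin_numE ?moment_ge0// ltey.
set M := fine _ => sM.
have VqM : (\int[P0]_w (positive_part w `^ q)%:E = M%:E)%E by rewrite positive_part_moment fineK.
have M1 := moment_ge1 q1 VqM; have M0 : 0 < M by apply: lt_le_trans M1.
have {sM}sM : s < (q - 1 - log2 M) / q.
  by move: sM; rewrite lt_max ltNge s0.
pose s' := (s + (q - 1 - log2 M) / q) / 2.
have s's : s < s' by rewrite /s'; move: sM; move: (_ / q) => z; lra.
have s'M : s' * q < q - 1 - log2 M.
  by rewrite -ltr_pdivlMr// /s'; move: sM; move: (_ / q) => z; lra.
exists q, M, s'; split => //.
have -> : 2 * (2^-1 `^ q * M) = 2 `^ (1 - q + log2 M).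
  have p2 : (2 != 0 :> R) by rewrite pnatr_eq0.
  have -> : 2 `^ (1 - q + log2 M) = 2 `^ 1 * 2 `^ (- q) * 2 `^ (log2 M).
    by rewrite -!powRD ?p2 ?implybT.
  rewrite powRr1// powR2_log2// mulrA; congr (_ * _ * _).
  by rewrite -(powR_inv1 (ler0n _ 2)) -powRrM mulN1r.
rewrite -powRrM /powR pnatr_eq0/= ltr_expR ltr_pM2r ?ln_gt0 ?ltr1n//.
by move: s'M; rewrite mulNr; move: (s' * q) (log2 M) => u v; lra.
Qed.

End moments.

Section iid.
Context d0 (T0 : measurableType d0) (R : realType) (P0 : probability T0 R) (W : {RV P0 >-> R})
  d (T : measurableType d) (P : probability T R) (X : seq bool -> {RV P >-> R}).
Hypothesis hW : minimal_Kahane_Peyriere P0 W.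
Hypothesis hX : iid_copies W X.

Definition positive_weight v w : R := Num.max (X v w) 0.

Lemma positive_weight_ge0 v w : 0 <= positive_weight v w.
Proof. by rewrite /positive_weight le_max lexx orbT. Qed.

Lemma positive_weight_iid : iid_family P (distribution P0 (positive_part W)) positive_weight.
Proof.
case: hX => law indep; split; first by move=> v; exact: measurable_maxr.
move=> s A us s0 mA.
have mmax : measurable_fun setT (fun z : R => Num.max z 0) by exact: measurable_maxr.
pose B v := (fun z : R => Num.max z 0) @^-1` A v.
have mB v : measurable (B v) by rewrite /B -[X in measurable X]setTI; exact: mmax.
have := indep s B us _ mB; rewrite -/(_ @^-1` _) => ->; last first.
  by move=> v /= vs; apply: contraNneq s0 => <-.
by apply: eq_big_seq => v vs; rewrite -[LHS]/(distribution P (X v) (B v)) (law v)//; apply: contraNneq s0 => <-.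
Qed.

Lemma positive_weight_ae : {ae P, forall w, forall v, v != [::] -> X v w = positive_weight v w}.
Proof.
have h v : {ae P, forall w, v != [::] -> X v w = positive_weight v w}.
  have [->|v0] := eqVneq v [::]; first by apply: aeW.
  exists (X v @^-1` `]-oo, 0[); split.
  - by rewrite -[X in measurable X]setTI; apply: measurable_funPT => //; exact: measurable_itv.
  - rewrite -[LHS]/(distribution P (X v) _) (proj1 hX)//.
    case: hW => -[N [mN N0 sub]] _ _ _; apply/eqP; rewrite eq_le measure_ge0 andbT -N0.
    change (P0 (W @^-1` `]-oo, 0%R[) <= P0 N)%E; apply: le_measure; rewrite ?inE//.
      by rewrite -[X in measurable X]setTI; apply: measurable_funPT => //; exact: measurable_itv.
    by move=> w /=; rewrite in_itv/= => W0; apply: sub => /=; rewrite leNgt W0.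
  - move=> w /= /not_implyP[_ h]; rewrite in_itv/= ltNge; apply/negP => X0; apply: h.
    by rewrite /positive_weight max_l.
have : {ae P, forall w, forall n : nat, forall v, unpickle n = Some v -> v != [::] -> X v w = positive_weight v w}.
  apply: ae_foralln => n; case: (unpickle n) => [v|]; last exact: aeW.
  by move: (h v); apply: filterS => w hw _ [<-].
by apply: filterS => w hw v; apply: (hw (pickle v)); rewrite pickleK.
Qed.

Lemma cascade_weight_eq w : (forall v, v != [::] -> X v w = positive_weight v w) ->
  forall v, cascade_weight (fun v => X v) v w = cascade_weight positive_weight v w.
Proof.
move=> h v; apply: eq_big_nat => j /andP[j0 jv]; apply: h.
by rewrite -size_eq0 size_takel// -lt0n.
Qed.

Lemma cascade_approx_eq w : (forall v, v != [::] -> X v w = positive_weight v w) ->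
  forall n, cascade_approx (fun v => X v) n w = cascade_approx positive_weight n w.
Proof.
move=> h n; apply/funext => A; apply: eq_integral => t _; congr (_%:E).
by apply: eq_bigr => v _; rewrite cascade_weight_eq.
Qed.

End iid.

Lemma fourier_decay_le (R : realType) (eta : {measure set (R * R)%type -> \bar R}) (s t : R) :
  fourier_decay eta t -> s <= t -> fourier_decay eta s.
Proof.
move=> [C [r h]] st; exists `|C|, (Num.max r 1) => xi; rewrite ge_max => /andP[rxi xi1].
apply: le_trans (h xi rxi) _; apply: (@le_trans _ _ (`|C| * norm2 xi `^ (- (t / 2)))).
  by rewrite ler_wpM2r ?powR_ge0// ler_norm.
rewrite ler_wpM2l//; apply: ler_powR => //; lra.
Qed.

Section fourier_decay_ae.
Context d0 (T0 : measurableType d0) (R : realType) (P0 : probability T0 R) (W : {RV P0 >-> R})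
  d (T : measurableType d) (P : probability T R) (X : seq bool -> {RV P >-> R})
  (mu : R.-ftker T ~> R) (gamma : {mfun R >-> (R * R)%type}).
Hypothesis hW : minimal_Kahane_Peyriere P0 W.
Hypothesis hX : iid_copies W X.
Hypothesis hmu : is_cascade P X mu.
Hypothesis hgamma : nondegenerate_C2_arc gamma.

(** A name for [mu w] on which the structure of a finite measure can be declared. *)
Definition cascade_measure (w : T) : set R -> \bar R := mu w.

HB.instance Definition _ w := isMeasure.Build _ _ _ (cascade_measure w)
  (measure0 (mu w)) (measure_ge0 (mu w)) (@measure_semi_sigma_additive _ _ _ (mu w)).

HB.instance Definition _ w := Measure_isFinite.Build _ _ _ (cascade_measure w)
  (@kernel_finite_transition _ _ _ _ _ mu w).

Let iY := positive_weight_iid hX.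
Let Y0 := positive_weight_ge0 X.
Let EV := positive_part_mean hW.

Lemma weak_cvg_positive : {ae P, forall w,
  weak_cvg (fun n => cascade_approx (positive_weight X) n w) (cascade_measure w)}.
Proof.
move: hmu (positive_weight_ae hW hX); apply: filterS2 => w wk eqw f fc fb.
by have := wk f fc fb; under eq_fun do rewrite (cascade_approx_eq eqw).
Qed.

Lemma fourier_decay_ae (s : R) : 0 < s < A_loc P0 W ->
  {ae P, forall w, fourier_decay (image_measure (mu w) gamma) s}.
Proof.
move=> /andP[s0 sA]; have sA' : 0 <= s < A_loc P0 W by rewrite ltW.
have [q [M [s' [q1 VqM ss' Mr]]]] := A_loc_gt hW sA'.
(* At [|xi| = 4 ^ m], the decay [|xi| ^ (- z / 2)] is [e z ^ (2 m)]. The three rates of the chain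
   are [e] at [s'], at the midpoint, and at [s]. *)
pose e z : R := 2 `^ (- (z / 2)).
have e_lt u v : u < v -> e v < e u.
  move=> uv; rewrite /e /powR pnatr_eq0/= ltr_expR ltr_pM2r ?ln_gt0 ?ltr1n//; lra.
have e_gt0 z : 0 < e z by rewrite powR_gt0.
have r12 : e s' < e ((s + s') / 2) by apply: e_lt; lra.
have r23 : e ((s + s') / 2) < e s by apply: e_lt; lra.
have e0 : e 0 = 1 by rewrite /e mul0r oppr0 powRr0.
have r1 : e s < 1 by rewrite -e0; exact: e_lt.
have eM : 2 * (2^-1 `^ q * M) < (e s' ^+ 2) `^ q.
  suff -> : e s' ^+ 2 = 2 `^ (- s') by [].
  rewrite /e expr2 -powRD ?pnatr_eq0 ?implybT//.
  by congr (_ `^ _); field.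
have e_half : 2^-1 <= e s.
  have <- : e 2 = 2^-1 by rewrite /e divff// powR_inv1.
  by apply/ltW/e_lt; have := A_loc_le1 hW; move: sA; move: (A_loc _ _) => z; lra.
have [x [y [dx [dy [ddx [ddy [c A]]]]]]] := regular_arc_exists hgamma.
have [xc yc _ _] := arc_cont A.
have /choice[Phi hPhi] : forall p : R * R * R, exists F, phase_primitive x y F p.1.1 p.1.2 p.2.
  move=> p; have [F hF] := primitive01 (@continuous_phase _ _ _ _ _ _ _ _ _ A p.1.1 p.1.2 p.2).
  by exists F.
have dPhi a b be : phase_primitive x y (Phi (a, b, be)) a b be by exact: hPhi.
have G := grid_decay iY (positive_part_ge0 W) Y0 EV q1 VqM (e_gt0 _) r12 r23 r1 eM A dPhi.
move: G weak_cvg_positive; apply: filterS2 => w [C [N h]] wk.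
have m01 := weak_limit_support Y0 wk.
suff : fourier_decay (image_measure (cascade_measure w) gamma) s by [].
apply: (@grid_fourier_decay _ gamma x y dx dy ddx ddy c A (cascade_measure w) gamma m01 erefl
  s C N (ltW s0) e_half) => k i j p ik jk Nk le.
have cn := cvg_norm (weak_limit_cos Y0 wk xc yc (dPhi (grid R k i) (grid R k j) (quarter_turn R p))).
have {}cn := cn eventually_filter.
rewrite /phase_integral -(cvg_lim (@Rhausdorff R) cn); apply: limr_le; first exact: (cvgP _ cn).
by exists k => // n kn; exact: h.
Qed.

Lemma fourier_decay_all : {ae P, forall w, forall s, 0 < s < A_loc P0 W ->
  fourier_decay (image_measure (mu w) gamma) s}.
Proof.
(* Countably many exponents increasing to the endpoint keep the null set independent of [s]. *)
pose u (n : nat) : R := A_loc P0 W - n.+1%:R^-1.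
have : {ae P, forall w, forall n, 0 < u n -> fourier_decay (image_measure (mu w) gamma) (u n)}.
  apply: ae_foralln => n; have [un|un] := ltP 0 (u n); last exact: aeW.
  have : 0 < u n < A_loc P0 W by rewrite un/= /u gtrDl oppr_lt0.
  by move=> /fourier_decay_ae; apply: filterS => w hw _.
apply: filterS => w hw s /andP[s0 /ltr_add_invr[k sk]].
have su : s <= u k by rewrite /u lerBrDr ltW.
by apply: (fourier_decay_le (hw k _) su); exact: lt_le_trans su.
Qed.

End fourier_decay_ae.

(** * Cell masses from Fourier decay *)

Section fejer.
Context (R : realType).
Implicit Types (t : R) (N : nat).

Lemma fejer_kernelE N t : \sum_(i < N) \sum_(j < N) cos (i%:R * t - j%:R * t) =
  (\sum_(i < N) cos (i%:R * t)) ^+ 2 + (\sum_(i < N) sin (i%:R * t)) ^+ 2.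
Proof.
rewrite !expr2 !big_distrlr/= -big_split/=; apply: eq_bigr => i _.
by rewrite -big_split/=; apply: eq_bigr => j _; rewrite cosB.
Qed.

(** Every cosine is at least 1/2, cosine being 1-Lipschitz; the square of the cosine sum alone gives
    the bound. *)
Lemma fejer_kernel_ge N t : (forall i, (i < N)%N -> i%:R * `|t| <= 2^-1) ->
  N%:R ^+ 2 / 4 <= \sum_(i < N) \sum_(j < N) cos (i%:R * t - j%:R * t).
Proof.
move=> Nt; rewrite fejer_kernelE.
have h : N%:R / 2 <= \sum_(i < N) cos (i%:R * t).
  rewrite -[N in N%:R / 2]card_ord -sum1_card natr_sum mulr_suml; apply: ler_sum => i _.
  have := cos_lipschitz (i%:R * t) 0; rewrite cos0 subr0 normrM normr_nat.
  have := Nt i (ltn_ord i); rewrite ler_norml; move: (_ * `|t|) => z h1 /andP[h2 _].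
  by move: h1 h2; move: (cos _) => u; lra.
have : (N%:R / 2) ^+ 2 <= (\sum_(i < N) cos (i%:R * t)) ^+ 2.
  by apply: lerXn2r; rewrite ?nnegrE ?divr_ge0// (le_trans _ h)// divr_ge0.
have : 0 <= (\sum_(i < N) sin (i%:R * t)) ^+ 2 by exact: sqr_ge0.
rewrite expr_div_n; have -> : 2 ^+ 2 = 4 :> R by ring.
move: (_ ^+ 2) (_ ^+ 2) => u v; lra.
Qed.

End fejer.

Lemma mean_value_le (R : realType) (f df : R -> R) (K a b : R) : continuous f ->
  a \in `[0, 1] -> b \in `[0, 1] -> (forall t : R, t \in `]0, 1[ -> is_derive t 1 f (df t)) ->
  (forall t : R, t \in `]0, 1[ -> `|t - a| <= `|b - a| -> `|df t| <= K) ->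
  `|f b - f a| <= K * `|b - a|.
Proof.
move=> fc; rewrite !in_itv/= => /andP[a0 a1] /andP[b0 b1] dF dK.
case: (ltgtP a b) => ab; last by rewrite ab !subrr normr0 mulr0.
- have sub t : t \in `]a, b[ -> t \in `]0, 1[.
    by rewrite !in_itv/= => /andP[t1 t2]; rewrite (le_lt_trans a0 t1) (lt_le_trans t2 b1).
  have [t tab ->] := MVT ab (fun t tab => dF t (sub t tab)) (continuous_subspaceT fc).
  rewrite normrM ler_wpM2r//; apply: dK; first exact: sub.
  move: tab; rewrite in_itv/= => /andP[t1 t2].
  by rewrite !gtr0_norm ?subr_gt0// lerD2r ltW.
- have sub t : t \in `]b, a[ -> t \in `]0, 1[.
    by rewrite !in_itv/= => /andP[t1 t2]; rewrite (le_lt_trans b0 t1) (lt_le_trans t2 a1).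
  have [t tab] := MVT ab (fun t tab => dF t (sub t tab)) (continuous_subspaceT fc).
  rewrite distrC [`|b - a|]distrC => ->; rewrite normrM ler_wpM2r//; apply: dK; first exact: sub.
  move: tab; rewrite in_itv/= => /andP[t1 t2].
  by rewrite distrC gtr0_norm ?subr_gt0// distrC gtr0_norm ?subr_gt0// lerD2l lerN2 ltW.
Qed.

Lemma Rintegral_sum_seq (R : realType) (m : {finite_measure set R -> \bar R}) (I : Type)
    (s : seq I) (f : I -> R -> R) : (forall i, m.-integrable setT (EFin \o f i)) ->
  m.-integrable setT (EFin \o (fun t => \sum_(i <- s) f i t)) /\
  \int[m]_t (\sum_(i <- s) f i t) = \sum_(i <- s) \int[m]_t f i t.
Proof.
move=> fi; elim: s => [|i s [IH1 IH2]].
  have -> : (fun t => \sum_(i <- [::]) f i t) = cst 0 by apply/funext => t; rewrite big_nil.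
  rewrite big_nil Rintegral_cst// mul0r; split => //.
  exact: finite_measure_integrable_cst.
have -> : (fun t => \sum_(j <- i :: s) f j t) = (fun t => f i t + \sum_(j <- s) f j t).
  by apply/funext => t; rewrite big_cons.
rewrite big_cons RintegralD//; split; last by rewrite IH2.
by have := integrableD measurableT (fi i) IH1.
Qed.

Section cap_mass.
Context (R : realType) (g : R -> R * R) (x y dx dy ddx ddy : R -> R) (c : R).
Hypothesis A : regular_arc g x y dx dy ddx ddy c.
Variables (m : {finite_measure set R -> \bar R}) (gamma : {mfun R >-> (R * R)%type}).
Hypothesis m01 : m (~` `[0, 1]) = 0%E.
Hypothesis gammaE : g = gamma.
Implicit Types a b be t : R.
Local Notation left := (cascade_left R).
Local Notation phase := (phase_integral x y m).

(** The component along the normal at [t] has a derivative that vanishes at [t] and is Lipschitz;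
    two applications of the mean value theorem give the quadratic bound. *)
Lemma normal_deviation : exists2 K, 0 < K & forall t u, t \in `[0, 1] -> u \in `[0, 1] ->
  `|- dy t * (x u - x t) + dx t * (y u - y t)| <= K * `|u - t| ^+ 2.
Proof.
have [B B1 hB] := arc_bounded A; have [xc yc dxc dyc] := arc_cont A.
have B0 : 0 < B by apply: lt_le_trans B1.
exists (2 * B ^+ 2); first by rewrite mulr_gt0// exprn_gt0.
move=> t u t01 u01; have [b1 b2 _ _] := hB t t01.
have -> : - dy t * (x u - x t) + dx t * (y u - y t) =
  (- dy t * x u + dx t * y u) - (- dy t * x t + dx t * y t) by ring.
rewrite [`|u - t| ^+ 2]expr2 mulrA; apply: (@mean_value_le R (fun u => - dy t * x u + dx t * y u)
  (fun u => - dy t * dx u + dx t * dy u)) => //.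
- exact: continuous_comb.
- move=> z z01; apply: is_deriveD; apply: is_deriveZ; [exact: (arc_dx A z01)|exact: (arc_dy A z01)].
- move=> z z01 zt; have z01' : z \in `[0, 1] by exact: subset_itv_oo_cc.
  have -> : - dy t * dx z + dx t * dy z = (dx z - dx t) * (- dy t) + (dy z - dy t) * dx t by ring.
  have l1 : `|dx z - dx t| <= B * `|u - t|.
    apply: le_trans (@mean_value_le R dx ddx B t z dxc t01 z01' (fun z z01 => arc_ddx A z01) _) _.
      by move=> r r01 _; have [] := hB r (subset_itv_oo_cc r01).
    by rewrite ler_wpM2l// ltW.
  have l2 : `|dy z - dy t| <= B * `|u - t|.
    apply: le_trans (@mean_value_le R dy ddy B t z dyc t01 z01' (fun z z01 => arc_ddy A z01) _) _.
      by move=> r r01 _; have [] := hB r (subset_itv_oo_cc r01).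
    by rewrite ler_wpM2l// ltW.
  apply: le_trans (comb_le (B := B) _ _ _ _) _ => //; first by rewrite normrN.
  have -> : 2 * B ^+ 2 * `|u - t| = (B * `|u - t| + B * `|u - t|) * B by ring.
  by rewrite ler_wpM2r ?(ltW B0)// lerD.
Qed.

Lemma phase_rotate a b be :
  phase a b be = cos be * phase a b 0 + sin be * phase a b (pi / 2).
Proof.
have int0 be' : m.-integrable setT (EFin \o (fun t => cos (2 * pi * (a * x t + b * y t) - be'))).
  apply: (@bounded_integrable R m _ 1); first exact: (continuous_phase A).
  by move=> t; rewrite ler_norml cos_geN1 cos_le1.
rewrite /phase_integral -!RintegralZl// -RintegralD//; last 2 first.
- by have := integrableZl measurableT (cos be) (int0 0).
- by have := integrableZl measurableT (sin be) (int0 (pi / 2)).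
congr (Rintegral _ _ _); apply/funext => t.
by rewrite cosBpihalf subr0 cosB mulrC [X in _ + X]mulrC.
Qed.

Lemma phase_le_fourier a b be :
  `|phase a b be| <= Normc.normc (fourier (image_measure m gamma) (a, b)) * 2.
Proof.
have h : `|phase a b 0| <= Normc.normc (fourier (image_measure m gamma) (a, b)) /\
         `|phase a b (pi / 2)| <= Normc.normc (fourier (image_measure m gamma) (a, b)).
  rewrite -!(image_cos_integral A m01 gammaE (a, b)) /fourier.
  have -> : (fun p => cos (2 * pi * dot2 p (a, b) - 0)) = (fun p => cos (2 * pi * dot2 p (a, b))).
    by apply/funext => p; rewrite subr0.
  have -> : (fun p => cos (2 * pi * dot2 p (a, b) - pi / 2)) = (fun p => sin (2 * pi * dot2 p (a, b))).
    by apply/funext => p; rewrite cosBpihalf.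
  rewrite /Normc.normc sqrrN; set u := Rintegral _ _ _; set v := Rintegral _ _ _.
  by rewrite -!sqrtr_sqr !ler_wsqrtr// ?lerDl ?lerDr sqr_ge0.
case: h => h0 h1; rewrite phase_rotate; apply: le_trans (ler_normD _ _) _.
rewrite !normrM mulr_natr mulr2n lerD//.
  apply: le_trans h0; rewrite ler_piMl// ler_norml cos_geN1 cos_le1//.
by apply: le_trans h1; rewrite ler_piMl// ler_norml sin_geN1 sin_le1.
Qed.

(** Replacing the norm by 1 plus the norm allows all frequencies, including 0: for small ones the
    total mass is the bound. *)
Lemma phase_le (s : R) : 0 <= s -> fourier_decay (image_measure m gamma) s ->
  exists2 D, 0 <= D & forall a b be, `|phase a b be| <= D * (1 + norm2 (a, b)) `^ (- (s / 2)).
Proof.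
move=> s0 [C [r hC]]; pose rho := Num.max r 1; pose M := fine (m setT).
have M0 : 0 <= M by rewrite fine_ge0.
have rho1 : 1 <= rho by rewrite le_max lexx orbT.
have rrho : r <= rho by rewrite le_max lexx.
exists (2 * `|C| * 2 `^ (s / 2) + M * (1 + rho) `^ (s / 2)).
  by rewrite addr_ge0// mulr_ge0 ?powR_ge0// mulr_ge0.
move=> a b be; set n := norm2 (a, b).
have n0 : 0 <= n by exact: sqrtr_ge0.
have p0 : 0 <= (1 + n) `^ (- (s / 2)) by exact: powR_ge0.
have [rn|nr] := leP rho n; last first.
  have le1 : `|phase a b be| <= M.
    rewrite -[M]mul1r; apply: (carried_bound m01); first exact: (continuous_phase A).
    by move=> t _; rewrite ler_norml cos_geN1 cos_le1.
  rewrite mulrDl; apply: le_trans le1 _; rewrite -[X in X <= _]add0r lerD//.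
    by rewrite mulr_ge0// mulr_ge0 ?powR_ge0// mulr_ge0.
  rewrite -mulrA ler_peMr// powRN -ler_pdivrMr ?invr_gt0 ?powR_gt0 ?ltr_wpDr//.
  rewrite div1r invrK ge0_ler_powR ?nnegrE ?divr_ge0 ?addr_ge0//.
  - by rewrite (le_trans _ rho1).
  - by rewrite lerD2l ltW.
apply: le_trans (phase_le_fourier a b be) _; rewrite mulrDl [X in X <= _]mulrC.
apply: (@le_trans _ _ (2 * (`|C| * n `^ (- (s / 2))))).
  rewrite ler_wpM2l//; apply: le_trans (hC (a, b) (le_trans rrho rn)) _.
  by rewrite ler_wpM2r ?powR_ge0// ler_norm.
rewrite -[X in X <= _]addr0 lerD//; last by rewrite mulr_ge0// mulr_ge0 ?powR_ge0.
rewrite -!mulrA ler_wpM2l// ler_wpM2l//.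
have n1 : 0 < n by apply: lt_le_trans rn; apply: lt_le_trans rho1.
rewrite !powRN -ler_pdivrMl ?powR_gt0// -invfM lef_pV2 ?posrE ?mulr_gt0 ?powR_gt0 ?ltr_wpDr//.
rewrite -powRM// ge0_ler_powR ?nnegrE ?divr_ge0 ?mulr_ge0 ?addr_ge0//.
by move: rn rho1; lra.
Qed.

(** Each term becomes the integrand of a phase integral at the frequency [(i - j) (p, q)]; the base
    point [t0] goes into the phase. *)
Lemma fejer_phase (p q t0 : R) N t :
  \sum_(i < N) \sum_(j < N) cos (i%:R * (2 * pi * (p * (x t - x t0) + q * (y t - y t0))) -
      j%:R * (2 * pi * (p * (x t - x t0) + q * (y t - y t0)))) =
  \sum_(ij <- [seq (i, j) | i <- iota 0 N, j <- iota 0 N])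
    cos (2 * pi * ((ij.1%:R - ij.2%:R) * p * x t + (ij.1%:R - ij.2%:R) * q * y t) -
         2 * pi * (ij.1%:R - ij.2%:R) * (p * x t0 + q * y t0)).
Proof.
rewrite big_allpairs_dep/= -(big_mkord xpredT (fun i => \sum_(j < N) cos (i%:R * _ - j%:R * _))).
rewrite /index_iota subn0; apply: eq_bigr => i _.
rewrite -(big_mkord xpredT (fun j => cos (i%:R * _ - j%:R * _))) /index_iota subn0.
by apply: eq_bigr => j _; congr cos; ring.
Qed.

(** The Fejer sum has [N = 2 ^ k] frequencies along the normal at the left end of the cell, with [N]
    about [4 ^ n]: the largest for which it stays of order [N^2] on the cell. Its integral is a
    double sum of decaying terms, of order [N ^ (2 - s / 2) (k + 1)]. Division by [N^2] leaves
    [N ^ (- s / 2)], about [2 ^ (- n s)]. *)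
Lemma cap_mass_le (s : R) : 0 <= s <= 2 -> fourier_decay (image_measure m gamma) s ->
  exists2 C, 0 <= C & forall v, fine (m `[left v, left v + 2 ^- size v]%classic) <=
    C * (2 * size v).+1%:R * 2 `^ (- ((size v)%:R * s)).
Proof.
move=> /andP[s0 s2] dec; have [D D0 hD] := phase_le s0 dec.
have [K K0 hK] := normal_deviation.
(* The 16 bounds [2 pi] by 8 and reserves the factor 2 for the threshold 1/2 of
   [fejer_kernel_ge]. *)
have [k0 hk0] : exists k0 : nat, 16 * K <= 2 ^+ k0.
  have [n /ltW hn] : exists n : nat, 16 * K < n%:R.
    by exists (Num.truncn (16 * K)).+1; exact: truncnS_gt.
  by exists n; apply: le_trans hn _; rewrite -natrX ler_nat ltnW// ltn_expl.
pose al := s / 2; have al0 : 0 <= al by rewrite divr_ge0.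
have al1 : al <= 1 by rewrite /al; lra.
(* The normal vector has the length of the velocity, at least [c], so [1 + |i - j|] times that
   length is at least [c' (1 + |i - j|)]. *)
have c0 := arc_gt0 A; pose c' := Num.min c 1.
have c'0 : 0 < c' by rewrite lt_min c0 ltr01.
pose C := 16 * (D * c' `^ (- al)) * 2 `^ (k0%:R * al).
have D'0 : 0 <= D * c' `^ (- al) by rewrite mulr_ge0// powR_ge0.
exists C; first by rewrite !mulr_ge0// powR_ge0.
move=> v; set n := size v; set t0 := left v; set I := `[_, _]%classic.
have I01 : I `<=` `[0, 1] by exact: word_itv.
have t0I : t0 \in `[left v, left v + 2 ^- n] by rewrite in_itv/= lexx lerDl invr_ge0 exprn_ge0.
have t001 : t0 \in `[0, 1] by exact: I01.
set k := (2 * n - k0)%N; pose N := (2 ^ k)%N.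
have N0 : 0 < N%:R :> R by rewrite ltr0n expn_gt0.
pose p := - dy t0; pose q := dx t0.
pose f t := \sum_(ij <- [seq (i, j) | i <- iota 0 N, j <- iota 0 N])
    cos (2 * pi * ((ij.1%:R - ij.2%:R) * p * x t + (ij.1%:R - ij.2%:R) * q * y t) -
         2 * pi * (ij.1%:R - ij.2%:R) * (p * x t0 + q * y t0)).
have fge0 t : 0 <= f t.
  by rewrite /f -fejer_phase fejer_kernelE addr_ge0// sqr_ge0.
have fge t : I t -> N%:R ^+ 2 / 4 <= f t.
  move=> It; rewrite /f -fejer_phase; apply: fejer_kernel_ge => i iN.
  (* If [2 n <= k0] the subtraction is truncated, [N = 1], and only [i = 0] occurs. *)
  have [k_0|k_gt0] := posnP k.
    by move: iN; rewrite /N k_0 expn0 ltnS leqn0 => /eqP ->; rewrite mul0r.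
  have tt : `|t - t0| <= 2 ^- n.
    move: It; rewrite /I/= in_itv/= => /andP[t1 t2]; rewrite ger0_norm ?subr_ge0//.
    by rewrite lerBlDl.
  have h1 := hK t0 t t001 (I01 _ It).
  have h2 : `|p * (x t - x t0) + q * (y t - y t0)| <= K * (2 ^- n) ^+ 2.
    apply: le_trans h1 _; rewrite ler_wpM2l ?(ltW K0)//.
    by apply: lerXn2r; rewrite ?nnegrE ?invr_ge0 ?exprn_ge0.
  rewrite normrM; have p8 : `|2 * pi| <= 8 :> R.
    by rewrite ger0_norm ?mulr_ge0 ?pi_ge0//; have /andP[_] := @pihalf_02 R; lra.
  apply: (@le_trans _ _ (N%:R * (8 * (K * (2 ^- n) ^+ 2)))).
    apply: ler_pM; rewrite ?mulr_ge0//; first by rewrite ler_nat ltnW.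
    by apply: ler_pM.
  have e1 : N%:R * 2 ^+ k0 = (2 ^+ n) ^+ 2 :> R.
    rewrite /N natrX -exprD -exprM; congr (_ ^+ _); rewrite /k; clear -k_gt0; lia.
  have e2 : N%:R * (16 * K) <= (2 ^+ n) ^+ 2 by rewrite -e1 ler_wpM2l// ltW.
  rewrite exprVn; have z0 : 0 < (2 ^+ n) ^+ 2 :> R by rewrite !exprn_gt0.
  have -> : N%:R * (8 * (K * ((2 ^+ n) ^+ 2)^-1)) = N%:R * (16 * K) / (2 ^+ n) ^+ 2 / 2.
    by move: z0; move: ((2 ^+ n) ^+ 2) => z z0; field; rewrite gt_eqF.
  by rewrite ler_pdivrMr// mulVf// ler_pdivrMr// mul1r.
have int_ij (ij : nat * nat) : m.-integrable setT (EFin \o (fun t =>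
    cos (2 * pi * ((ij.1%:R - ij.2%:R) * p * x t + (ij.1%:R - ij.2%:R) * q * y t) -
         2 * pi * (ij.1%:R - ij.2%:R) * (p * x t0 + q * y t0)))).
  apply: (@bounded_integrable R m _ 1); first exact: (continuous_phase A).
  by move=> t; rewrite ler_norml cos_geN1 cos_le1.
have [fi fE] := Rintegral_sum_seq [seq (i, j) | i <- iota 0 N, j <- iota 0 N] int_ij.
have lower : N%:R ^+ 2 / 4 * fine (m I) <= \int[m]_t f t.
  have mI : measurable I by exact: measurable_itv.
  have mf : measurable_fun setT (EFin \o f) by exact: measurable_int fi.
  have le_e : ((N%:R ^+ 2 / 4)%:E * m I <= \int[m]_t (f t)%:E)%E.
    rewrite -integral_cst//; apply: (@le_trans _ _ (\int[m]_(t in I) (f t)%:E)%E).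
      apply: ge0_le_integral => //.
      - by move=> t _; rewrite lee_fin divr_ge0.
      - exact: measurable_funTS.
    by apply: ge0_subset_integral => // t _; rewrite lee_fin.
  rewrite /Rintegral -lee_fin EFinM !fineK ?fin_num_measure//.
  exact: integrable_fin_num fi.
have term (i j : nat) : (i < N)%N -> (j < N)%N -> `|phase ((i%:R - j%:R) * p) ((i%:R - j%:R) * q)
    (2 * pi * (i%:R - j%:R) * (p * x t0 + q * y t0))| <=
  D * c' `^ (- al) * N%:R `^ (1 - al) * (1 + `|j%:R - i%:R|)^-1.
  move=> iN jN; apply: le_trans (hD _ _ _) _; rewrite -/al -!mulrA ler_wpM2l//.
  set l := `|j%:R - i%:R|; have l0 : 0 <= l by exact: normr_ge0.
  have lE : norm2 ((i%:R - j%:R) * p, (i%:R - j%:R) * q) = l * Num.sqrt (dx t0 ^+ 2 + dy t0 ^+ 2).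
    rewrite /norm2/= !exprMn -mulrDr sqrtrM ?sqr_ge0// sqrtr_sqr distrC; congr (_ * Num.sqrt _).
    by rewrite /p /q sqrrN addrC.
  have lN : 1 + l <= N%:R.
    have [ij|ij] := leqP i j.
      rewrite /l -natrB// normr_nat nat1r ler_nat; clear -ij jN; lia.
    rewrite /l distrC -natrB ?(ltnW ij)// normr_nat nat1r ler_nat; clear -ij iN; lia.
  have l1 : 0 < 1 + l by rewrite ltr_wpDr.
  apply: (@le_trans _ _ ((c' * (1 + l)) `^ (- al))).
    rewrite !powRN lef_pV2 ?posrE ?powR_gt0 ?mulr_gt0//; last first.
      by rewrite ltr_wpDr// sqrtr_ge0.
    apply: ge0_ler_powR; rewrite ?nnegrE ?addr_ge0 ?sqrtr_ge0 ?mulr_ge0 ?(ltW c'0) ?(ltW l1)//.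
    rewrite mulrDr mulr1 lerD ?ge_min ?lexx ?orbT// mulrC lE ler_wpM2l//.
    by apply: le_trans (arc_speed A t001); rewrite ge_min lexx.
  rewrite powRM ?(ltW c'0) ?(ltW l1)// ler_wpM2l ?powR_ge0//.
  (* As [al <= 1], the first factor is at most [N ^ (1 - al)]; the second is summed by the harmonic
     bound. *)
  have -> : (1 + l) `^ (- al) = (1 + l) `^ (1 - al) * (1 + l)^-1.
    rewrite -(powR_inv1 (ltW l1)) -powRD ?(gt_eqF l1) ?implybT//.
    by congr (_ `^ _); ring.
  rewrite ler_wpM2r ?invr_ge0 ?(ltW l1)//.
  by apply: ge0_ler_powR; rewrite ?subr_ge0 ?nnegrE ?(ltW l1) ?(ltW N0).
have upper : \int[m]_t f t <= N%:R * (D * c' `^ (- al) * N%:R `^ (1 - al) * (4 * k.+1%:R)).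
  rewrite fE big_allpairs_dep/=.
  have -> : N%:R * (D * c' `^ (- al) * N%:R `^ (1 - al) * (4 * k.+1%:R)) =
      \sum_(i <- iota 0 N) D * c' `^ (- al) * N%:R `^ (1 - al) * (4 * k.+1%:R).
    move: (D * _ * _ * _) => z.
    by rewrite big_const_seq count_predT size_iota iter_addr addr0 mulr_natl.
  rewrite big_seq [leRHS]big_seq; apply: ler_sum => i; rewrite mem_iota add0n => /andP[_ iN].
  apply: (@le_trans _ _ (\sum_(j < N) D * c' `^ (- al) * N%:R `^ (1 - al) * (1 + `|j%:R - i%:R|)^-1)).
    rewrite -(big_mkord xpredT (fun j => D * c' `^ (- al) * N%:R `^ (1 - al) * (1 + `|j%:R - i%:R|)^-1)).
    rewrite /index_iota subn0 big_seq [leRHS]big_seq; apply: ler_sum => j; rewrite mem_iota add0n => /andP[_ jN].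
    by apply: le_trans (ler_norm _) _; exact: (term i j iN jN).
  rewrite -mulr_sumr ler_wpM2l ?mulr_ge0 ?powR_ge0//; exact: inv_distance_sum_le.
have N2 : 0 < N%:R ^+ 2 / 4 :> R by rewrite divr_gt0// exprn_gt0.
have := le_trans lower upper; rewrite mulrC -ler_pdivlMr// => h; apply: le_trans h _.
have -> : N%:R * (D * c' `^ (- al) * N%:R `^ (1 - al) * (4 * k.+1%:R)) / (N%:R ^+ 2 / 4) =
  16 * (D * c' `^ (- al)) * k.+1%:R * N%:R `^ (- al).
  rewrite powRD ?(gt_eqF N0) ?implybT// powRr1 ?(ltW N0)//; move: N0; move: (N%:R : R) => z z0.
  by field; rewrite gt_eqF.
have -> : C * (2 * n).+1%:R * 2 `^ (- (n%:R * s)) =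
    16 * (D * c' `^ (- al)) * (2 * n).+1%:R * (2 `^ (k0%:R * al) * 2 `^ (- (n%:R * s))).
  by rewrite /C; ring.
apply: ler_pM; rewrite ?mulr_ge0 ?powR_ge0//.
  by rewrite ler_wpM2l ?mulr_ge0 ?powR_ge0// ler_nat ltnS leq_subr.
rewrite -powRD ?pnatr_eq0 ?implybT// /N natrX -powR_mulrn// -powRrM; apply: ler_powR; first by rewrite ler1n.
have kE : 2 * n%:R <= k%:R + k0%:R :> R by rewrite -natrM -natrD ler_nat /k; clear; lia.
have := ler_wpM2r al0 kE; have -> : 2 * n%:R * al = n%:R * s by rewrite /al; field.
rewrite [(_ + _) * al]mulrDl mulrN.
by move: (k%:R * al) (k0%:R * al) (n%:R * s) => a1 a2 a3; lra.
Qed.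

End cap_mass.

(** * Large branches *)

Lemma absorb_half (R : realType) (x y z : R) : z <= x + y + y -> y <= z / 4 -> z / 2 <= x.
Proof. lra. Qed.

Section truncated_power.
Context (R : realType).
Implicit Types (K q u : R).

(** The power [u ^ q] cut to a window on which it is bounded for exponents of either sign; negative
    ones occur when a tilt near 0 is lowered. *)
Definition truncated_power K q u : R := \1_(`[K^-1, K]) u * expR (q * ln u).

Lemma truncated_powerT K q u : K^-1 <= u <= K -> truncated_power K q u = expR (q * ln u).
Proof. by move=> h; rewrite /truncated_power indicE mem_set ?mul1r//= in_itv. Qed.

Lemma truncated_powerF K q u : ~~ (K^-1 <= u <= K) -> truncated_power K q u = 0.
Proof.
by move=> h; rewrite /truncated_power indicE memNset ?mul0r//= in_itv/=; exact/negP.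
Qed.

Lemma truncated_power_ge0 K q u : 0 <= truncated_power K q u.
Proof. by rewrite mulr_ge0// expR_ge0. Qed.

Lemma measurable_truncated_power K q : measurable_fun setT (truncated_power K q).
Proof.
apply: measurable_funM; first by apply: measurable_indic; exact: measurable_itv.
by apply: measurableT_comp => //; apply: measurable_funM.
Qed.

Lemma ln_truncated K u : 1 <= K -> K^-1 <= u <= K -> `|ln u| <= ln K.
Proof.
move=> K1 /andP[u1 u2]; have K0 : 0 < K by apply: lt_le_trans K1.
have u0 : 0 < u by apply: lt_le_trans u1; rewrite invr_gt0.
by rewrite ler_norml -lnV ?posrE// !ler_ln ?posrE ?invr_gt0// u1 u2.
Qed.

Lemma truncated_power_le K q u : 1 <= K -> truncated_power K q u <= expR (`|q| * ln K).
Proof.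
move=> K1; have [h|h] := boolP (K^-1 <= u <= K); last by rewrite truncated_powerF// expR_ge0.
rewrite truncated_powerT// ler_expR; apply: le_trans (ler_norm _) _.
by rewrite normrM ler_wpM2l// ln_truncated.
Qed.

Lemma truncated_power_shift K q q' u : 1 <= K ->
  truncated_power K q' u <= expR (`|q' - q| * ln K) * truncated_power K q u.
Proof.
move=> K1; have [h|h] := boolP (K^-1 <= u <= K); last first.
  by rewrite !truncated_powerF// mulr0.
rewrite !truncated_powerT// -expRD ler_expR -lerBlDr -mulrBl.
by apply: le_trans (ler_norm _) _; rewrite normrM ler_wpM2l// ln_truncated.
Qed.

Lemma truncated_power_quadratic K q h u : 1 <= K -> `|h| * ln K <= 2^-1 ->
  truncated_power K (q + h) u <= (1 + 2 * (h * ln K) ^+ 2) * truncated_power K q u +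
    h * (truncated_power K q u * ln u).
Proof.
move=> K1 hK; have [hu|hu] := boolP (K^-1 <= u <= K); last first.
  by rewrite !truncated_powerF// mul0r !mulr0 addr0.
have lu := ln_truncated K1 hu; have lK : 0 <= ln K by exact: ln_ge0.
have hl : `|h * ln u| <= `|h| * ln K by rewrite normrM ler_wpM2l.
rewrite !truncated_powerT// mulrDl expRD.
have e1 : expR (h * ln u) <= 1 + h * ln u + 2 * (h * ln u) ^+ 2.
  by apply: expR_le_quadratic; apply: le_trans (ler_norm _) _; apply: le_trans hl hK.
have e2 : (h * ln u) ^+ 2 <= (h * ln K) ^+ 2.
  rewrite -[(h * ln u) ^+ 2]real_normK ?num_real// -[(h * ln K) ^+ 2]real_normK ?num_real//.
  apply: lerXn2r; rewrite ?nnegrE//.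
  by apply: le_trans hl _; rewrite normrM ler_wpM2l// ler_norm.
have -> : (1 + 2 * (h * ln K) ^+ 2) * expR (q * ln u) + h * (expR (q * ln u) * ln u) =
  expR (q * ln u) * (1 + h * ln u + 2 * (h * ln K) ^+ 2) by ring.
by rewrite ler_wpM2l ?expR_ge0//; move: e1 e2; lra.
Qed.

End truncated_power.

Section cramer.
Context d (T : measurableType d) d0 (T0 : measurableType d0) (R : realType)
  (P : probability T R) (P0 : probability T0 R) (V : {RV P0 >-> R})
  (Y : seq bool -> T -> R).
Hypothesis iY : iid_family P (distribution P0 V) Y.
Variables (a K : R).
Hypothesis a0 : 0 < a.
Hypothesis K1 : 1 < K.
Implicit Types q h : R.

Let L := ln K.
Let L0 : 0 < L. Proof. by rewrite ln_gt0. Qed.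
Let G q w := truncated_power K q (a * V w).
Let phi q := \int[P0]_w G q w.
(** Formally the derivative of [phi]; the upper bound [phi_quadratic] takes the place of
    differentiation. *)
Let psi q := \int[P0]_w (G q w * ln (a * V w)).

Lemma measurable_G q : measurable_fun setT (G q).
Proof.
apply: (measurableT_comp (measurable_truncated_power K q)).
by apply: measurable_funM.
Qed.

Lemma G_integrable q : P0.-integrable setT (EFin \o G q).
Proof.
apply: measurable_bounded_integrable => //.
- by rewrite (le_lt_trans (probability_le1 _ _))// ltry.
- exact: measurable_G.
- exists (expR (`|q| * L)); split; first exact: num_real.
  move=> z z1 w _ /=; rewrite ger0_norm ?truncated_power_ge0// (le_trans _ (ltW z1))//.
  by apply: truncated_power_le; exact: ltW.
Qed.

Lemma Gln_integrable q : P0.-integrable setT (EFin \o (fun w => G q w * ln (a * V w))).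
Proof.
apply: measurable_bounded_integrable => //.
- by rewrite (le_lt_trans (probability_le1 _ _))// ltry.
- apply: measurable_funM; first exact: measurable_G.
  by apply: measurableT_comp => //; apply: measurable_funM.
- exists (expR (`|q| * L) * L); split; first exact: num_real.
  move=> z z1 w _ /=; rewrite (le_trans _ (ltW z1))// normrM ger0_norm ?truncated_power_ge0//.
  have [h|h] := boolP (K^-1 <= a * V w <= K); last first.
    by rewrite /G truncated_powerF// mul0r mulr_ge0 ?expR_ge0// ltW.
  apply: ler_pM; rewrite ?truncated_power_ge0//.
    by apply: truncated_power_le; exact: ltW.
  by apply: ln_truncated => //; exact: ltW.
Qed.

Lemma phi_integral q : (\int[P0]_w (G q w)%:E = (phi q)%:E)%E.
Proof. by rewrite /phi /Rintegral fineK// (integrable_fin_num _ (G_integrable q)). Qed.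

Lemma phi_ge0 q : 0 <= phi q.
Proof. by apply: Rintegral_ge0 => w _; exact: truncated_power_ge0. Qed.

Lemma phi_shift q q' : phi q' <= expR (`|q' - q| * L) * phi q.
Proof.
rewrite /phi -RintegralZl//; last exact: G_integrable.
apply: le_Rintegral => //; first exact: G_integrable.
  by have := integrableZl measurableT (expR (`|q' - q| * L)) (G_integrable q).
by move=> w _; apply: truncated_power_shift; exact: ltW.
Qed.

Lemma phi_quadratic q h : `|h| * L <= 2^-1 ->
  phi (q + h) <= (1 + 2 * (h * L) ^+ 2) * phi q + h * psi q.
Proof.
move=> hL.
have i1 : P0.-integrable setT (EFin \o (fun w => (1 + 2 * (h * L) ^+ 2) * G q w)).
  by have := integrableZl measurableT (1 + 2 * (h * L) ^+ 2) (G_integrable q).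
have i2 : P0.-integrable setT (EFin \o (fun w => h * (G q w * ln (a * V w)))).
  by have := integrableZl measurableT h (Gln_integrable q).
rewrite /phi /psi -RintegralZl//; last exact: G_integrable.
rewrite -[X in _ <= _ + X]RintegralZl//; last exact: Gln_integrable.
rewrite -RintegralD//.
apply: le_Rintegral => //; first exact: G_integrable.
  by have := integrableD measurableT i1 i2.
by move=> w _; apply: truncated_power_quadratic => //; exact: ltW.
Qed.

Lemma continuous_phi : continuous phi.
Proof.
move=> q.
have e1 : expR (`|q' - q| * L) @[q' --> q] --> (1 : R).
  rewrite -expR0 -(mul0r L) -(normr0 R) -(subrr q).
  apply: (continuous_comp (f := fun q' => `|q' - q| * L)); last exact: continuous_expR.
  apply: cvgM; last exact: cvg_cst.
  by apply: cvg_norm; apply: cvgB; [exact: cvg_id|exact: cvg_cst].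
have up : expR (`|q' - q| * L) * phi q @[q' --> q] --> phi q.
  by rewrite -[X in _ --> X]mul1r; apply: cvgM => //; exact: cvg_cst.
have low : (expR (`|q' - q| * L))^-1 * phi q @[q' --> q] --> phi q.
  suff h : (expR (`|q' - q| * L))^-1 * phi q @[q' --> q] --> 1^-1 * phi q.
    by rewrite invr1 mul1r in h.
  apply: cvgM; last exact: cvg_cst.
  by apply: cvgV => //; exact: oner_neq0.
apply: squeeze_cvgr low up; apply: nearW => q'.
rewrite phi_shift andbT mulrC ler_pdivrMr ?expR_gt0// mulrC distrC; exact: phi_shift.
Qed.

Let prod_G q v w := \prod_(1 <= j < (size v).+1) truncated_power K q (a * Y (take j v) w).

Lemma prod_G_integral q v : (\int[P]_w (prod_G q v w)%:E = (phi q ^+ size v)%:E)%E.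
Proof.
apply: (branch_integral (g := fun x => truncated_power K q (a * x)) iY).
- by apply: (measurableT_comp (measurable_truncated_power K q)); apply: measurable_funM.
- by move=> x; exact: truncated_power_ge0.
- exact: phi_integral.
Qed.

Let log_sum v w := \sum_(1 <= j < (size v).+1) ln (a * Y (take j v) w).

Lemma prod_GE v w :
  (forall q, prod_G q v w = 0) \/
  (0 < a ^+ size v * cascade_weight Y v w /\ ln (a ^+ size v * cascade_weight Y v w) = log_sum v w /\
   forall q, prod_G q v w = expR (q * log_sum v w)).
Proof.
have [h|/allPn[j js h]] := boolP (all (fun j => K^-1 <= a * Y (take j v) w <= K) (iota 1 (size v))).
  right; have pos j : j \in iota 1 (size v) -> 0 < a * Y (take j v) w.
    move=> js; have /andP[h1 _] := allP h j js; apply: lt_le_trans h1.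
    by rewrite invr_gt0 (lt_trans _ K1).
  have E : a ^+ size v * cascade_weight Y v w = expR (log_sum v w).
    rewrite /log_sum expR_sum /cascade_weight /index_iota subn1/=.
    have -> : a ^+ size v = \prod_(j <- iota 1 (size v)) a.
      by rewrite big_const_seq count_predT size_iota -Monoid.iteropE.
    rewrite -big_split/=; apply: eq_big_seq => j js; rewrite lnK ?posrE//; exact: pos.
  split; first by rewrite E expR_gt0.
  split; first by rewrite E expRK.
  move=> q; rewrite /prod_G /log_sum mulr_sumr expR_sum /index_iota subn1/=.
  by apply: eq_big_seq => j js; rewrite truncated_powerT//; exact: (allP h).
left => q; rewrite /prod_G /index_iota subn1/= (big_rem j)//= truncated_powerF//.
by rewrite mul0r.
Qed.

(** Three ranges of the logarithmic sum [S]. Above [(m + dl) n] and below [(m - dl) n] the tilts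
    [q + h] and [q - h] pay. In between, [q m <= 0] gives [q S <= q dl n], and [S > - dl n] puts the
    sample in the event. *)
Lemma tilted_bound q m dl h v w : 0 <= q -> 0 <= m -> q * m <= 0 -> 0 <= dl -> 0 <= h ->
  prod_G q v w <= expR (q * dl * (size v)%:R) *
      \1_[set w | expR (- (dl * (size v)%:R)) <= a ^+ size v * cascade_weight Y v w] w +
    expR (- (h * (m + dl) * (size v)%:R)) * prod_G (q + h) v w +
    expR (h * (m - dl) * (size v)%:R) * prod_G (q - h) v w.
Proof.
move=> q0 m0 qm dl0 h0; set n := (size v)%:R; have n0 : 0 <= n by [].
case: (prod_GE v w) => [z|[W0 [lnW pE]]]; first by rewrite !z !mulr0 !addr0 mulr_ge0// expR_ge0.
rewrite !pE; set S := log_sum v w.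
have ind : - (dl * n) <= S -> \1_[set w | expR (- (dl * n)) <= a ^+ size v * cascade_weight Y v w] w = 1 :> R.
  by move=> h1; rewrite indicE mem_set//= -[X in _ <= X]lnK ?posrE// ler_expR lnW.
have t1 : 0 <= expR (q * dl * n) * \1_[set w | expR (- (dl * n)) <= a ^+ size v * cascade_weight Y v w] w.
  by rewrite mulr_ge0// expR_ge0.
have t2 : 0 <= expR (- (h * (m + dl) * n)) * expR ((q + h) * S) by rewrite mulr_ge0 ?expR_ge0.
have t3 : 0 <= expR (h * (m - dl) * n) * expR ((q - h) * S) by rewrite mulr_ge0 ?expR_ge0.
have [S1|S1] := leP ((m + dl) * n) S.
  apply: (@le_trans _ _ (expR (- (h * (m + dl) * n)) * expR ((q + h) * S))).
    rewrite -expRD ler_expR; have := ler_wpM2l h0 S1; rewrite mulrA mulrDl.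
    by move: (h * (m + dl) * n) (h * S) (q * S) => z1 z2 z3; lra.
  by rewrite addrAC lerDr addr_ge0.
have [S2|S2] := leP S ((m - dl) * n).
  apply: (@le_trans _ _ (expR (h * (m - dl) * n) * expR ((q - h) * S))).
    rewrite -expRD ler_expR; have := ler_wpM2l h0 S2; rewrite mulrA mulrBl.
    by move: (h * (m - dl) * n) (h * S) (q * S) => z1 z2 z3; lra.
  by rewrite lerDr addr_ge0.
rewrite ind; last first.
  apply: le_trans (ltW S2); have := mulr_ge0 m0 n0; rewrite mulrBl.
  by move: (m * n) (dl * n) => z1 z2; lra.
rewrite mulr1; apply: (@le_trans _ _ (expR (q * dl * n))).
  rewrite ler_expR; apply: le_trans (ler_wpM2l q0 (ltW S1)) _.
  rewrite mulrDl mulrDr mulrA [q * (dl * n)]mulrA gerDr -mulrA mulrA.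
  by rewrite mulr_le0_ge0.
by move: t2 t3; move: (expR (q * dl * n)) (_ * _) (_ * _) => z1 z2 z3; lra.
Qed.

Lemma chernoff q m dl h v : 0 <= q -> 0 <= m -> q * m <= 0 -> 0 <= dl -> 0 <= h ->
  phi q ^+ size v <= expR (q * dl * (size v)%:R) *
      fine (P [set w | expR (- (dl * (size v)%:R)) <= a ^+ size v * cascade_weight Y v w]) +
    expR (- (h * (m + dl) * (size v)%:R)) * phi (q + h) ^+ size v +
    expR (h * (m - dl) * (size v)%:R) * phi (q - h) ^+ size v.
Proof.
move=> q0 m0 qm dl0 h0; set E := [set w | _].
have mY t : measurable_fun setT (Y t) by have [] := iY.
have mE : measurable E.
  rewrite /E; apply: measurable_set_ler => //; apply: measurable_funM => //.
  by apply: measurable_weight => j _.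
have mp q' : measurable_fun setT (prod_G q' v).
  apply: measurable_prod => j _.
  by apply: (measurableT_comp (measurable_truncated_power K q')); apply: measurable_funM.
have p0 q' w : 0 <= prod_G q' v w by apply: prodr_ge0 => j _; exact: truncated_power_ge0.
rewrite -lee_fin !EFinD !EFinM -!prod_G_integral fineK ?fin_num_measure//.
rewrite -(setIT E) -(integral_indic P measurableT mE).
have e0 z : (0 <= (expR z)%:E :> \bar R)%E by rewrite lee_fin expR_ge0.
have mI : measurable_fun setT (fun w => (\1_E w)%:E : \bar R).
  by apply/measurable_EFinP; exact: measurable_indic.
have mP q' : measurable_fun setT (fun w => (prod_G q' v w)%:E) by exact/measurable_EFinP.
rewrite -!ge0_integralZl_EFin ?expR_ge0//; try by move=> w _; rewrite lee_fin.
have f1 w : setT w -> (0 <= (expR (q * dl * (size v)%:R))%:E * (\1_E w)%:E)%E.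
  by move=> _; rewrite mule_ge0// lee_fin.
have f2 q' z w : setT w -> (0 <= (expR z)%:E * (prod_G q' v w)%:E)%E.
  by move=> _; rewrite mule_ge0// lee_fin.
have mf1 : measurable_fun setT (fun w => (expR (q * dl * (size v)%:R))%:E * (\1_E w)%:E)%E.
  exact: measurable_funeM.
have mf2 q' z : measurable_fun setT (fun w => (expR z)%:E * (prod_G q' v w)%:E)%E.
  exact: measurable_funeM.
rewrite -(ge0_integralD P measurableT f1 mf1 (f2 _ _) (mf2 _ _)).
rewrite -(ge0_integralD P measurableT (fun w tw => adde_ge0 (f1 w tw) (f2 _ _ w tw))
  (emeasurable_funD mf1 (mf2 _ _)) (f2 _ _) (mf2 _ _)).
apply: ge0_le_integral => //.
- by move=> w _; rewrite lee_fin.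
- by apply: emeasurable_funD => //; apply: emeasurable_funD.
- by move=> w _; rewrite -!EFinM -!EFinD lee_fin; exact: tilted_bound.
Qed.

Variables (Q b : R).
Hypothesis Q0 : 0 < Q.
Hypothesis b2 : 2^-1 < b.
Hypothesis phi_ge : forall q, 0 <= q <= Q -> b <= phi q.
Hypothesis phiQ : 1 < phi Q.

Lemma phi0_le1 : phi 0 <= 1.
Proof.
apply: (@le_trans _ _ (\int[P0]_w 1)).
  apply: le_Rintegral => //; first exact: G_integrable.
    by apply: finite_measure_integrable_cst.
  by move=> w _; have := truncated_power_le 0 (a * V w) (ltW K1); rewrite normr0 mul0r expR0.
by rewrite Rintegral_cst// mul1r -lee_fin fineK ?fin_num_measure// probability_le1.
Qed.

(** Here [q] minimises [phi] on [[0, Q]] and [m = psi q / phi q] is the mean of the logarithm under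
    the tilted law. Since [phi Q > 1 >= phi 0], the minimum is not at [Q], so [psi q >= 0]; if
    moreover [q > 0], then [psi q <= 0]. *)
Lemma tilt : exists q m, [/\ 0 <= q <= Q, 0 <= m, q * m <= 0 &
  forall h, `|h| * L <= 2^-1 -> phi (q + h) <= phi q * expR (2 * (h * L) ^+ 2 + h * m)].
Proof.
have [q qQ qmin] := EVT_min (ltW Q0) (continuous_subspaceT continuous_phi).
move: qQ; rewrite in_itv/= => /andP[q0 qQ].
have ph0 : 0 < phi q.
  by apply: lt_le_trans (phi_ge _); rewrite ?q0//; apply: lt_trans b2; rewrite invr_gt0.
have qltQ : q < Q.
  rewrite lt_neqAle qQ andbT; apply/eqP => qE.
  have := qmin 0; rewrite in_itv/= lexx (ltW Q0) => /(_ isT); rewrite qE.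
  by have := phi0_le1; move: phiQ; move: (phi Q) (phi 0) => u v; lra.
have near_min h : `|h| * L <= 2^-1 -> 0 <= q + h <= Q -> 0 <= h * (2 * h * L ^+ 2 * phi q + psi q).
  move=> hL hQ; have := phi_quadratic q hL; have := qmin (q + h); rewrite in_itv/= hQ => /(_ isT).
  have -> : (1 + 2 * (h * L) ^+ 2) * phi q + h * psi q =
    phi q + h * (2 * h * L ^+ 2 * phi q + psi q) by ring.
  by move=> h1 /(le_trans h1); rewrite lerDl.
have psi0 : 0 <= psi q.
  rewrite leNgt; apply/negP => psi_lt.
  (* A step small enough for the quadratic bound, for staying in [[0, Q]], and for the negative
     linear term to win: it would contradict minimality. *)
  pose h := Num.min (Num.min ((2 * L)^-1) (Q - q)) (- psi q / (4 * L ^+ 2 * phi q)).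
  have h0 : 0 < h.
    rewrite !lt_min invr_gt0 mulr_gt0// subr_gt0 qltQ divr_gt0 ?oppr_gt0//.
    by rewrite mulr_gt0// mulr_gt0// exprn_gt0.
  have h1 : h <= (2 * L)^-1 by rewrite /h !ge_min lexx.
  have h2 : h <= Q - q by rewrite /h !ge_min lexx orbT.
  have h3 : h <= - psi q / (4 * L ^+ 2 * phi q) by rewrite /h ge_min lexx orbT.
  have hL : `|h| * L <= 2^-1.
    by rewrite gtr0_norm// -ler_pdivlMr// -invfM.
  have : 0 <= h * (2 * h * L ^+ 2 * phi q + psi q).
    by apply: near_min => //; rewrite addr_ge0 ?(ltW h0)//=; move: h2; lra.
  rewrite pmulr_rge0// leNgt => /negP; apply.
  move: h3; rewrite ler_pdivlMr; last by rewrite mulr_gt0// mulr_gt0// exprn_gt0.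
  have -> : h * (4 * L ^+ 2 * phi q) = 2 * (2 * h * L ^+ 2 * phi q) by ring.
  by move: (2 * h * _ * _) => z; move: psi_lt; lra.
have psi_le : 0 < q -> psi q <= 0.
  move=> q_gt0; rewrite leNgt; apply/negP => psi_gt.
  pose h := Num.min (Num.min ((2 * L)^-1) q) (psi q / (4 * L ^+ 2 * phi q)).
  have h0 : 0 < h.
    rewrite !lt_min invr_gt0 mulr_gt0// q_gt0 divr_gt0//.
    by rewrite mulr_gt0// mulr_gt0// exprn_gt0.
  have h1 : h <= (2 * L)^-1 by rewrite /h !ge_min lexx.
  have h2 : h <= q by rewrite /h !ge_min lexx orbT.
  have h3 : h <= psi q / (4 * L ^+ 2 * phi q) by rewrite /h ge_min lexx orbT.
  have hL : `|- h| * L <= 2^-1.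
    by rewrite normrN gtr0_norm// -ler_pdivlMr// -invfM.
  have : 0 <= - h * (2 * - h * L ^+ 2 * phi q + psi q).
    by apply: near_min => //; rewrite subr_ge0 h2/=; move: h0 qQ; lra.
  rewrite mulNr oppr_ge0 pmulr_rle0// leNgt => /negP; apply.
  move: h3; rewrite ler_pdivlMr; last by rewrite mulr_gt0// mulr_gt0// exprn_gt0.
  have -> : h * (4 * L ^+ 2 * phi q) = 2 * (2 * h * L ^+ 2 * phi q) by ring.
  have -> : 2 * - h * L ^+ 2 * phi q = - (2 * h * L ^+ 2 * phi q) by ring.
  by move: (2 * h * _ * _) => z; move: psi_gt; lra.
exists q, (psi q / phi q); split.
- by rewrite q0.
- by rewrite divr_ge0// ltW.
- move: q0; rewrite le_eqVlt => /orP[/eqP <-|q0]; first by rewrite mul0r.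
  by rewrite mulrA pmulr_lle0 ?invr_gt0// pmulr_rle0// psi_le.
- move=> h hL; apply: le_trans (phi_quadratic q hL) _.
  have -> : (1 + 2 * (h * L) ^+ 2) * phi q + h * psi q =
    phi q * (1 + (2 * (h * L) ^+ 2 + h * (psi q / phi q))).
    by field; rewrite gt_eqF.
  by rewrite ler_wpM2l ?(ltW ph0)// expR_ge1Dx.
Qed.

(** Both side tilts lose a factor [th ^ N] with [th < 1], so half of [phi q ^ N] must come from the
    event. Its probability times [2 ^ N] is then at least half of the [N]-th power of
    [2 b exp (- Q dl) > 1]. *)
Lemma large_branch_truncated (dl : R) : 0 < dl -> 1 < 2 * b * expR (- (Q * dl)) ->
  exists N, (0 < N)%N /\ exists2 gam, 1 < gam & forall v, size v = N ->
    gam <= 2 ^+ N * fine (P [set w | expR (- (dl * N%:R)) <= a ^+ N * cascade_weight Y v w]).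
Proof.
move=> dl0 big; have [q [m [/andP[q0 qQ] m0 qm hphi]]] := tilt.
have ph_ge : b <= phi q by apply: phi_ge; rewrite q0.
have ph0 : 0 < phi q by apply: lt_le_trans ph_ge; apply: lt_trans b2; rewrite invr_gt0.
(* So chosen, the quadratic error [2 (h L)^2] consumes at most half of the gain [h dl]. *)
pose h := Num.min ((2 * L)^-1) (dl / (4 * L ^+ 2)).
have h0 : 0 < h by rewrite lt_min invr_gt0 mulr_gt0// divr_gt0// mulr_gt0// exprn_gt0.
have hL : `|h| * L <= 2^-1.
  by rewrite gtr0_norm// -ler_pdivlMr// -invfM /h ge_min lexx.
have hL' : `|- h| * L <= 2^-1 by rewrite normrN.
pose th := expR (- (h * dl / 2)).
have th0 : 0 < th by exact: expR_gt0.
have th1 : th < 1 by rewrite -expR0 ltr_expR oppr_lt0 divr_gt0// mulr_gt0.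
have hd : 2 * (h * L) ^+ 2 <= h * dl / 2.
  have -> : 2 * (h * L) ^+ 2 = h * (2 * h * L ^+ 2) by ring.
  rewrite -[h * dl / 2]mulrA ler_wpM2l ?(ltW h0)//.
  have : h <= dl / (4 * L ^+ 2) by rewrite /h ge_min lexx orbT.
  rewrite ler_pdivlMr; last by rewrite mulr_gt0// exprn_gt0.
  have -> : h * (4 * L ^+ 2) = 2 * (2 * h * L ^+ 2) by ring.
  by move: (2 * h * _) => z; lra.
have b1 : expR (- (h * (m + dl))) * phi (q + h) <= phi q * th.
  apply: le_trans (ler_wpM2l (expR_ge0 _) (hphi h hL)) _.
  rewrite mulrCA ler_wpM2l ?(ltW ph0)// -expRD ler_expR mulrDr.
  by move: hd; move: (2 * _ ^+ 2) (h * m) (h * dl) => z1 z2 z3; lra.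
have b3 : expR (h * (m - dl)) * phi (q - h) <= phi q * th.
  apply: le_trans (ler_wpM2l (expR_ge0 _) (hphi (- h) hL')) _.
  rewrite mulrCA ler_wpM2l ?(ltW ph0)// -expRD ler_expR mulrBr !mulNr sqrrN.
  by move: hd; move: (2 * _ ^+ 2) (h * m) (h * dl) => z1 z2 z3; lra.
pose ga := 2 * b * expR (- (Q * dl)).
have thn : `|th| < 1 by rewrite ger0_norm ?(ltW th0).
have /cvgrPdist_lt/(_ 4^-1) := @cvg_geometric R 1 th thn.
move=> /(_ _)[|N1 _ hN1]; first by rewrite invr_gt0.
have ginv : `|ga^-1| < 1 by rewrite ger0_norm ?invr_ge0 ?(ltW (lt_trans _ big))// invf_lt1// (lt_trans _ big).
have /cvgrPdist_lt/(_ 2^-1) := @cvg_geometric R 1 (ga^-1) ginv.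
move=> /(_ _)[|N2 _ hN2]; first by rewrite invr_gt0.
(* [N1] makes the two side terms smaller than a quarter each; [N2] makes [ga ^ N] exceed 2, the
   factor lost by halving. *)
pose N := (maxn N1 N2).+1; have ga0 : 0 < ga by apply: lt_trans big.
have gaN : 2 < ga ^+ N.
  have := hN2 N (leqW (leq_maxr _ _)); rewrite /= sub0r normrN /geometric/= mul1r.
  rewrite exprVn ger0_norm ?invr_ge0 ?exprn_ge0 ?(ltW ga0)//.
  by rewrite ltf_pV2 ?posrE ?exprn_gt0.
exists N; split=> //; exists (ga ^+ N / 2); first by rewrite ltr_pdivlMr// mul1r.
move=> v vN.
have thN : th ^+ N < 4^-1.
  have := hN1 N (leqW (leq_maxl _ _)); rewrite /= sub0r normrN /geometric/= mul1r.
  by rewrite ger0_norm// exprn_ge0// ltW.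
have := chernoff v q0 m0 qm (ltW dl0) (ltW h0); rewrite vN.
set p := fine _ => ch.
have eN (z : R) : expR (z * N%:R) = expR z ^+ N by exact: expRM_natr.
have c1 : expR (- (h * (m + dl) * N%:R)) * phi (q + h) ^+ N <= phi q ^+ N * th ^+ N.
  rewrite -mulNr eN -!exprMn; apply: lerXn2r b1; rewrite nnegrE mulr_ge0 ?expR_ge0 ?phi_ge0//.
have c2 : expR (h * (m - dl) * N%:R) * phi (q - h) ^+ N <= phi q ^+ N * th ^+ N.
  rewrite eN -!exprMn; apply: lerXn2r b3; rewrite nnegrE mulr_ge0 ?expR_ge0 ?phi_ge0//.
have phN : 0 < phi q ^+ N by rewrite exprn_gt0.
have half : phi q ^+ N / 2 <= expR (q * dl * N%:R) * p.
  have : phi q ^+ N * th ^+ N <= phi q ^+ N * 4^-1 by rewrite ler_wpM2l ?(ltW phN)// ltW.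
  move: (le_trans ch (lerD (lerD (lexx (expR (q * dl * N%:R) * p)) c1) c2)).
  exact: absorb_half.
have gle : ga ^+ N <= 2 ^+ N * (phi q ^+ N * expR (- (q * dl * N%:R))).
  rewrite -mulNr eN -!exprMn; apply: lerXn2r; rewrite ?nnegrE ?(ltW ga0) ?mulr_ge0 ?expR_ge0 ?(ltW ph0)//.
  rewrite /ga -mulrA ler_wpM2l//; apply: ler_pM; rewrite ?expR_ge0//.
    by apply/ltW; apply: lt_trans b2; rewrite invr_gt0.
  by rewrite ler_expR lerN2 ler_wpM2r// ltW.
apply: le_trans (ler_wpM2r _ gle) _; first by rewrite invr_ge0.
rewrite -[leLHS]mulrA ler_wpM2l ?exprn_ge0// mulrAC expRN ler_pdivrMr ?expR_gt0// [p * _]mulrC.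
exact: half.
Qed.

End cramer.

Section positive_power.
Context (R : realType).
Implicit Types (q u x : R) (k : nat).

(** The increasing limit of the truncated powers. It differs from the real power at [u = 0],
    [q = 0], where it is 0: samples with [W = 0] never count. *)
Definition positive_power q u : R := if 0 < u then expR (q * ln u) else 0.

Lemma positive_power_ge0 q u : 0 <= positive_power q u.
Proof. by rewrite /positive_power; case: ifP => // _; exact: expR_ge0. Qed.

Lemma measurable_positive_power q : measurable_fun setT (positive_power q).
Proof.
apply: measurable_fun_ifT => //; first exact: measurable_fun_ltr.
by apply: measurableT_comp => //; apply: measurable_funM.
Qed.

Lemma positive_power_powR q x : 0 <= x -> q != 0 -> positive_power q x = x `^ q.
Proof.
rewrite /positive_power /powR le_eqVlt => /orP[/eqP <- q0|x0 _].
  by rewrite ltxx eqxx (negbTE q0).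
by rewrite x0 gt_eqF.
Qed.

Lemma positive_power_scale q (a x : R) : 0 < a ->
  positive_power q (a * x) = expR (q * ln a) * positive_power q x.
Proof.
move=> a0; rewrite /positive_power pmulr_rgt0//; case: ifP => [x0|_]; last by rewrite mulr0.
by rewrite lnM ?posrE// mulrDr expRD.
Qed.

Lemma truncated_power_mono q u k k' : (k <= k')%N ->
  truncated_power k.+2%:R q u <= truncated_power k'.+2%:R q u.
Proof.
move=> kk; have [/andP[h1 h2]|h] := boolP (k.+2%:R^-1 <= u <= k.+2%:R); last first.
  by rewrite (truncated_powerF _ h) truncated_power_ge0.
have le : k.+2%:R <= k'.+2%:R :> R by rewrite ler_nat.
rewrite !truncated_powerT ?h1//.
by rewrite (le_trans _ h1) ?(le_trans h2)// lef_pV2 ?posrE.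
Qed.

Lemma truncated_power_lim q u : \forall k \near \oo, truncated_power k.+2%:R q u = positive_power q u.
Proof.
rewrite /positive_power; have [u0|u0] := ltP 0 u; last first.
  apply: nearW => k; rewrite truncated_powerF// negb_and -ltNge.
  by rewrite (le_lt_trans u0) ?invr_gt0.
exists (maxn (Num.truncn u) (Num.truncn u^-1)) => // k /=; rewrite geq_max => /andP[k1 k2].
have lt v : (Num.truncn v <= k)%N -> v <= k.+2%:R :> R.
  by move=> vk; apply: le_trans (ltW (truncnS_gt v)) _; rewrite ler_nat ltnS leqW.
by rewrite truncated_powerT// lt// andbT -[X in _ <= X]invrK lef_pV2 ?posrE ?invr_gt0// lt.
Qed.

End positive_power.

Section entropy.
Context d0 (T0 : measurableType d0) (R : realType) (P0 : probability T0 R) (W : {RV P0 >-> R}).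
Hypothesis hW : minimal_Kahane_Peyriere P0 W.
Local Notation V := (positive_part W).
Local Notation l2 := (ln 2 : R).

Let l20 : 0 < l2. Proof. by rewrite ln_gt0// ltr1n. Qed.

Lemma measurable_log2p : measurable_fun setT (@log2p R).
Proof. by apply: measurable_maxr => //; apply: measurable_funM. Qed.

(** Domination for the entropy integral. Below 1, [1 + y <= exp y] at [y = - ln x] gives
    [- x ln x <= 1 - x]. *)
Lemma xlnx_le (x : R) : 0 <= x -> `|x * ln x| <= l2 * (x * log2p x) + 1.
Proof.
move=> x0; have p0 : 0 <= log2p x by rewrite /log2p le_max lexx orbT.
have [x1|x1] := leP 1 x.
  rewrite ger0_norm ?mulr_ge0 ?ln_ge0//.
  have : ln x <= l2 * log2p x.
    by rewrite mulrC -ler_pdivrMr// /log2p /log2 le_max lexx.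
  by move=> /(ler_wpM2l x0); rewrite mulrCA; lra.
apply: (@le_trans _ _ 1); last by rewrite lerDr !mulr_ge0// ltW.
move: x0; rewrite le_eqVlt => /orP[/eqP <-|x0]; first by rewrite mul0r normr0.
rewrite ler0_norm; last by rewrite mulr_ge0_le0 ?(ltW x0)// ln_le0// ltW.
have := expR_ge1Dx (- ln x); rewrite expRN lnK ?posrE// => /(ler_wpM2l (ltW x0)).
rewrite mulfV ?gt_eqF// mulrDr mulr1 mulrN.
by move: (x * ln x) x0 => z; lra.
Qed.

Lemma xlnx_integrable : P0.-integrable setT (EFin \o (fun w => V w * ln (V w))).
Proof.
have mlp : measurable_fun setT (fun w => V w * log2p (V w)).
  by apply: measurable_funM => //; exact: (measurableT_comp measurable_log2p).
have i1 : P0.-integrable setT (EFin \o (fun w => V w * log2p (V w))).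
  apply/integrableP; split; first exact/measurable_EFinP.
  under eq_integral => w _.
    rewrite /= ger0_norm; last by rewrite mulr_ge0 ?positive_part_ge0// /log2p le_max lexx orbT.
    over.
  have mm : measurable_fun setT (fun x : R => x * log2p x).
    by apply: measurable_funM => //; exact: measurable_log2p.
  by rewrite (positive_part_integral hW mm); case: hW => _ _; rewrite unlock.
have i2 := integrableZl measurableT l2 i1.
have i3 : P0.-integrable setT (EFin \o (fun=> 1 : R)) by exact: finite_measure_integrable_cst.
apply: (le_integrable measurableT _ _ (integrableD measurableT i2 i3)).
  by apply/measurable_EFinP; apply: measurable_funM => //; exact: (measurableT_comp (@measurable_ln R)).
move=> w _ /=; rewrite lee_fin [leRHS]ger0_norm; first exact/xlnx_le/positive_part_ge0.
rewrite addr_ge0// mulr_ge0 ?(ltW l20)// mulr_ge0 ?positive_part_ge0// /log2p le_max lexx orbT//.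
Qed.

Definition entropy : R := \int[P0]_w (V w * ln (V w)).

Lemma entropy_lt : entropy < l2.
Proof.
have mm : measurable_fun setT (fun x : R => x * log2 x).
  by apply: measurable_funM => //; apply: measurable_funM.
case: hW => _ _ _; rewrite unlock -(positive_part_integral hW mm).
have -> : (\int[P0]_w (V w * log2 (V w))%:E = (l2^-1 * entropy)%:E)%E.
  rewrite /entropy -RintegralZl//; last exact: xlnx_integrable.
  rewrite /Rintegral fineK; last first.
    by have := integrable_fin_num measurableT (integrableZl measurableT l2^-1 xlnx_integrable).
  by apply: eq_integral => w _; congr (_%:E); rewrite /log2 mulrA mulrC.
by rewrite lte_fin mulrC ltr_pdivrMr// mul1r.
Qed.

Lemma V_integrable : P0.-integrable setT (EFin \o V).
Proof.
apply/integrableP; split; first exact/measurable_EFinP.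
under eq_integral => w _ do rewrite /= ger0_norm ?positive_part_ge0//.
by rewrite (positive_part_mean hW) ltry.
Qed.

(** Write [x ^ q = x exp ((q - 1) ln x)] and take the tangent of the exponential at the entropy.
    Integrated, this is Jensen's inequality for the law of density [W], without introducing that
    law. *)
Lemma tangent_le (q x : R) : 0 <= x ->
  expR ((q - 1) * entropy) * (x + (q - 1) * (x * ln x - entropy * x)) <= positive_power q x.
Proof.
rewrite le_eqVlt => /orP[/eqP <-|x0].
  by rewrite mul0r mulr0 subr0 mulr0 addr0 mulr0 positive_power_ge0.
rewrite /positive_power x0.
have -> : expR (q * ln x) = expR ((q - 1) * entropy) * (x * expR ((q - 1) * (ln x - entropy))).
  by rewrite -{2}(lnK x0) -!expRD; congr expR; ring.
rewrite ler_wpM2l ?expR_ge0//.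
have -> : x + (q - 1) * (x * ln x - entropy * x) = x * (1 + (q - 1) * (ln x - entropy)) by ring.
by rewrite ler_wpM2l ?(ltW x0)// expR_ge1Dx.
Qed.

Lemma positive_moment_entropy q :
  ((expR ((q - 1) * entropy))%:E <= \int[P0]_w (positive_power q (V w))%:E)%E.
Proof.
have mp : measurable_fun setT (fun w => (positive_power q (V w))%:E).
  by apply/measurable_EFinP; exact: (measurableT_comp (measurable_positive_power q)).
have p0 : (0 <= \int[P0]_w (positive_power q (V w))%:E)%E.
  by apply: integral_ge0 => w _; rewrite lee_fin positive_power_ge0.
have [->|fin] := eqVneq (\int[P0]_w (positive_power q (V w))%:E)%E +oo%E; first exact: leey.
have gi : P0.-integrable setT (EFin \o (fun w => positive_power q (V w))).
  apply/integrableP; split => //; rewrite (eq_integral (fun w => (positive_power q (V w))%:E)).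
    by rewrite ltey.
  by move=> w _ /=; rewrite ger0_norm// positive_power_ge0.
set e := expR _.
have j1 : P0.-integrable setT (EFin \o (fun w => entropy * V w)).
  by have := integrableZl measurableT entropy V_integrable.
have j2 : P0.-integrable setT (EFin \o (fun w => V w * ln (V w) - entropy * V w)).
  by have := integrableB measurableT xlnx_integrable j1.
have j3 : P0.-integrable setT (EFin \o (fun w => (q - 1) * (V w * ln (V w) - entropy * V w))).
  by have := integrableZl measurableT (q - 1) j2.
have j4 : P0.-integrable setT (EFin \o (fun w => V w + (q - 1) * (V w * ln (V w) - entropy * V w))).
  by have := integrableD measurableT V_integrable j3.
have j5 : P0.-integrable setT (EFin \o (fun w => e * (V w + (q - 1) * (V w * ln (V w) - entropy * V w)))).
  by have := integrableZl measurableT e j4.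
have EV : \int[P0]_w V w = 1 by rewrite /Rintegral (positive_part_mean hW).
have val : \int[P0]_w (e * (V w + (q - 1) * (V w * ln (V w) - entropy * V w))) = e.
  rewrite RintegralZl// RintegralD//; last exact: V_integrable.
  rewrite RintegralZl// RintegralB//; last exact: xlnx_integrable.
  rewrite RintegralZl//; last exact: V_integrable.
  by rewrite EV mulr1 -/entropy subrr mulr0 addr0 mulr1.
have : \int[P0]_w (e * (V w + (q - 1) * (V w * ln (V w) - entropy * V w))) <=
    \int[P0]_w positive_power q (V w).
  by apply: le_Rintegral => // w _; apply: tangent_le; exact: positive_part_ge0.
rewrite val -lee_fin => /le_trans; apply.
by rewrite /Rintegral fineK// ge0_fin_numE// ltey.
Qed.

Lemma positive_moment_A_loc q : 1 < q ->
  ((expR ((q - 1 - q * A_loc P0 W) * l2))%:E <= \int[P0]_w (positive_power q (V w))%:E)%E.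
Proof.
move=> q1; have q0 : 0 < q by apply: lt_trans q1.
have -> : (\int[P0]_w (positive_power q (V w))%:E = 'E_P0[fun w => (W w `^ q)%R])%E.
  rewrite -(positive_part_moment hW); apply: eq_integral => w _.
  by rewrite positive_power_powR ?positive_part_ge0// gt_eqF.
have tA : A_loc_term P0 W q <= A_loc P0 W.
  by apply: ub_le_sup; [case: (A_loc_has_sup hW)|exists q].
move: tA; rewrite /A_loc_term; case: ifPn => [/eqP -> _|Moo]; first exact: leey.
have Mf : (('E_P0[fun w => (W w `^ q)%R])%E \is a fin_num).
  by rewrite ge0_fin_numE ?(moment_ge0 hW)// ltey.
rewrite ge_max => /andP[_]; rewrite ler_pdivrMr// -[X in (_ <= X)%E]fineK// lee_fin.
have M1 : 1 <= fine ('E_P0[fun w => (W w `^ q)%R])%E.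
  by apply: (moment_ge1 hW q1); rewrite (positive_part_moment hW) fineK.
move: (fine _) M1 => M M1; have M0 : 0 < M by apply: lt_le_trans M1.
rewrite /log2 => h; rewrite -[X in _ <= X](lnK M0) ler_expR -ler_pdivlMr//.
by move: h; rewrite [q * _]mulrC; move: (_ * q) (_ / _) => u v; lra.
Qed.

Variables (s1 : R).
Hypothesis As1 : A_loc P0 W < s1.
(** This is [2 ^ (s1 - 1)]: along a word [u] of length [N], [a ^ N Q_u >= 1] means
    [Q_u 2 ^ (- N) >= 2 ^ (- N s1)]. *)
Let a := expR ((s1 - 1) * l2).
Let a0 : 0 < a. Proof. exact: expR_gt0. Qed.

Lemma scaled_moment q : (\int[P0]_w (positive_power q (a * V w))%:E =
  (expR (q * ((s1 - 1) * l2)))%:E * \int[P0]_w (positive_power q (V w))%:E)%E.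
Proof.
under eq_integral => w _ do rewrite positive_power_scale// expRK EFinM.
rewrite ge0_integralZl_EFin ?expR_ge0//.
- by move=> w _; rewrite lee_fin positive_power_ge0.
- by apply/measurable_EFinP; exact: (measurableT_comp (measurable_positive_power q)).
Qed.

Lemma scaled_moment_gt1 q : 1 < q ->
  ((expR ((q * (s1 - A_loc P0 W) - 1) * l2))%:E <= \int[P0]_w (positive_power q (a * V w))%:E)%E.
Proof.
move=> q1; rewrite scaled_moment.
have -> : (q * (s1 - A_loc P0 W) - 1) * l2 = q * ((s1 - 1) * l2) + (q - 1 - q * A_loc P0 W) * l2.
  by ring.
by rewrite expRD EFinM lee_pmul2l ?lte_fin ?expR_gt0//; exact: positive_moment_A_loc.
Qed.

(** The bound is [2 ^ eta / 2], so twice the moment exceeds 1 uniformly in [q]. For [q > 1] this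
    comes from [s1] exceeding the endpoint exponent, for [q <= 1] from the entropy being less than
    [ln 2]. *)
Lemma scaled_moment_ge : exists2 eta, 0 < eta & forall q, 0 <= q ->
  ((expR ((eta - 1) * l2))%:E <= \int[P0]_w (positive_power q (a * V w))%:E)%E.
Proof.
have A0 := A_loc_ge0 hW; have Hl := entropy_lt.
pose eta := Num.min (1 - entropy / l2) (s1 - A_loc P0 W).
have e1 : eta <= 1 - entropy / l2 by rewrite /eta ge_min lexx.
have e2 : eta <= s1 - A_loc P0 W by rewrite /eta ge_min lexx orbT.
have eta0 : 0 < eta by rewrite lt_min !subr_gt0 ltr_pdivrMr// mul1r Hl.
exists eta => // q q0; have [q1|q1] := ltP 1 q.
  apply: le_trans (scaled_moment_gt1 q1); rewrite lee_fin ler_expR ler_wpM2r ?(ltW l20)//.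
  rewrite lerB//; apply: le_trans e2 _; rewrite ler_peMl//; first by rewrite subr_ge0 ltW.
  exact: ltW.
rewrite scaled_moment; apply: (@le_trans _ _ ((expR (q * ((s1 - 1) * l2)))%:E * (expR ((q - 1) * entropy))%:E)%E).
  rewrite -EFinM -expRD lee_fin ler_expR.
  have h1 : entropy <= (1 - eta) * l2.
    rewrite -ler_pdivrMr//; move: e1; move: (entropy / l2) => z; lra.
  have h2 : (eta - 1) * l2 <= (s1 - 1) * l2.
    by rewrite ler_wpM2r ?(ltW l20)//; move: e2 A0; move: (A_loc _ _) => z; lra.
  have q10 : 0 <= 1 - q by rewrite subr_ge0.
  have := ler_wpM2l q0 h2; have := ler_wpM2l q10 h1.
  have -> : (1 - q) * ((1 - eta) * l2) = - ((eta - 1) * l2) + q * ((eta - 1) * l2) by ring.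
  have -> : (1 - q) * entropy = - ((q - 1) * entropy) by ring.
  move: (q * ((eta - 1) * l2)) (q * _) ((q - 1) * _) ((eta - 1) * l2) => z1 z2 z3 z4; lra.
by rewrite lee_pmul2l ?lte_fin ?expR_gt0//; exact: positive_moment_entropy.
Qed.

Let phi k q := \int[P0]_w truncated_power k.+2%:R q (a * V w).

Let k1 k : 1 < k.+2%:R :> R. Proof. by rewrite ltr1n. Qed.

Lemma phi_mono k k' q : (k <= k')%N -> phi k q <= phi k' q.
Proof.
move=> kk; apply: le_Rintegral => //.
- exact: (G_integrable V a (k1 k) q).
- exact: (G_integrable V a (k1 k') q).
- by move=> w _; exact: truncated_power_mono.
Qed.

Lemma phi_gt q (b : R) : (b%:E < \int[P0]_w (positive_power q (a * V w))%:E)%E ->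
  exists k, b < phi k q.
Proof.
move=> hb; apply/not_existsP => h; move: hb; apply/negP; rewrite -leNgt.
pose g k w := (truncated_power k.+2%:R q (a * V w))%:E.
have mg k : measurable_fun setT (g k).
  apply/measurable_EFinP; apply: (measurableT_comp (measurable_truncated_power _ _)).
  exact: measurable_funM.
have g0 k w : setT w -> (0 <= g k w)%E by move=> _; rewrite lee_fin truncated_power_ge0.
have ndg w : setT w -> {homo g^~ w : k k' / (k <= k')%N >-> (k <= k')%E}.
  by move=> _ k k' kk; rewrite lee_fin truncated_power_mono.
have gE k : (\int[P0]_w g k w = (phi k q)%:E)%E by exact: (phi_integral V a (k1 k) q).
have := monotone_convergence P0 measurableT mg g0 ndg.
rewrite (_ : (fun w => limn (g^~ w)) = (fun w => (positive_power q (a * V w))%:E)); last first.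
  apply/funext => w; apply: lim_near_cst => //.
  by move: (truncated_power_lim q (a * V w)); apply: filterS => k; rewrite /g => ->.
move=> ->; apply: lime_le.
  apply: ereal_nondecreasing_is_cvgn => k k' kk; rewrite !gE lee_fin; exact: phi_mono.
by apply: nearW => k; rewrite gE lee_fin leNgt; apply/negP => /h.
Qed.

(** Compactness: a cut that works at [q] works on a ball, because [ln phi] is Lipschitz in [q], and
    it may be enlarged, because [phi] increases with the cut. *)
Lemma phi_uniform (Q b : R) : 0 < b ->
  (forall q, 0 <= q -> (b%:E < \int[P0]_w (positive_power q (a * V w))%:E)%E) ->
  exists k, forall q, 0 <= q <= Q -> b <= phi k q.
Proof.
move=> b0 hb; pose S k q := b <= phi k q.
have /compact_near_coveringP/(_ nat \oo S _) := @segment_compact R 0 Q.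
case=> [q|k _ hk]; last by exists k => q qQ; apply: (hk k (leqnn k)) => /=; rewrite in_itv.
rewrite /= in_itv/= => /andP[q0 _]; have [k bk] := phi_gt (hb q q0).
have L0 : 0 < ln (k.+2%:R : R) by rewrite ln_gt0// ltr1n.
have ph0 : 0 < phi k q by apply: lt_trans bk.
pose e := ln (phi k q / b) / ln k.+2%:R.
have e0 : 0 < e by rewrite divr_gt0// ln_gt0// ltr_pdivlMr// mul1r.
exists (ball q e, [set j | (k <= j)%N]) => /=.
  by split; [exact: nbhsx_ballx|exists k].
move=> [t j] [/= qt kj]; rewrite /S; apply: le_trans (phi_mono t kj).
have h : phi k q <= expR (`|q - t| * ln k.+2%:R) * phi k t by exact: (phi_shift V a (k1 k) t q).
have le : expR (`|q - t| * ln k.+2%:R) <= phi k q / b.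
  rewrite -[leRHS]lnK ?posrE ?divr_gt0// ler_expR -ler_pdivlMr//; exact: ltW.
have pt0 : 0 <= phi k t by apply: Rintegral_ge0 => w _; exact: truncated_power_ge0.
have := le_trans h (ler_wpM2r pt0 le); rewrite -mulrA -[X in X <= _]mulr1 ler_pM2l//.
by rewrite mulrC ler_pdivlMr// mul1r.
Qed.

End entropy.

Section large_branches.
Context d (T : measurableType d) d0 (T0 : measurableType d0) (R : realType)
  (P : probability T R) (P0 : probability T0 R) (W : {RV P0 >-> R})
  (Y : seq bool -> T -> R).
Hypothesis hW : minimal_Kahane_Peyriere P0 W.
Hypothesis iY : iid_family P (distribution P0 (positive_part W)) Y.

Lemma large_branch (s : R) : A_loc P0 W < s ->
  exists N, (0 < N)%N /\ exists2 gam, 1 < gam & forall v, size v = N ->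
    gam <= 2 ^+ N * fine (P [set w | 2 `^ (N%:R * (1 - s)) <= cascade_weight Y v w]).
Proof.
move=> As; pose s1 := (A_loc P0 W + s) / 2.
have As1 : A_loc P0 W < s1 by rewrite /s1; move: As; move: (A_loc _ _) => z; lra.
have s1s : s1 < s by rewrite /s1; move: As; move: (A_loc _ _) => z; lra.
pose l2 : R := ln 2; have l20 : 0 < l2 by rewrite ln_gt0// ltr1n.
have [eta eta0 heta] := scaled_moment_ge hW As1.
(* Half of [eta] makes the inequality strict, as the passage to truncated moments requires; the
   other half keeps [b] above 1/2. *)
pose b := expR ((eta / 2 - 1) * l2).
have b2 : 2^-1 < b.
  rewrite -(lnK (_ : 2^-1 \is Num.pos)) ?posrE// ltr_expR lnV ?posrE//.
  by rewrite mulrBl mul1r ltrDr mulr_gt0// divr_gt0.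
have b0 : 0 < b by exact: expR_gt0.
have hb q : 0 <= q -> (b%:E < \int[P0]_w (positive_power q (expR ((s1 - 1) * l2) * positive_part W w))%:E)%E.
  move=> q0; apply: lt_le_trans (heta q q0); rewrite lte_fin ltr_expR ltr_pM2r//; lra.
(* Large enough for [Q (s1 - A_loc) > 1], hence for a scaled moment above 1 at [Q]. *)
pose Q := 2 / (s1 - A_loc P0 W) + 1.
have sA : 0 < s1 - A_loc P0 W by rewrite subr_gt0.
have Q1 : 1 < Q by rewrite /Q ltrDr divr_gt0.
have Q0 : 0 < Q by apply: lt_trans Q1.
have [kq hkq] : exists k, 1 < \int[P0]_w truncated_power k.+2%:R Q (expR ((s1 - 1) * l2) * positive_part W w).
  have h2 : ((expR ((Q * (s1 - A_loc P0 W) - 1) * l2))%:E <=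
      \int[P0]_w (positive_power Q (expR ((s1 - 1) * l2) * positive_part W w))%:E)%E.
    by first [exact: (scaled_moment_gt1 hW s1 Q1)|exact: (scaled_moment_gt1 hW As1 Q1)|exact: (scaled_moment_gt1 hW Q1)].
  have h1 : (1%:E < \int[P0]_w (positive_power Q (expR ((s1 - 1) * l2) * positive_part W w))%:E)%E.
    apply: lt_le_trans h2; rewrite lte_fin -[X in X < _]expR0 ltr_expR.
    rewrite mulr_gt0// /Q mulrDl mul1r divfK ?gt_eqF//.
    by move: sA; move: (s1 - _) => z; lra.
  by first [exact: (phi_gt h1)|exact: (phi_gt hW h1)|exact: (phi_gt As1 h1)|exact: (phi_gt hW As1 h1)].
have [kb hkb] : exists kb, forall q, 0 <= q <= Q ->
    b <= \int[P0]_w truncated_power kb.+2%:R q (expR ((s1 - 1) * l2) * positive_part W w).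
  by first [exact: (phi_uniform Q b0 hb)|exact: (phi_uniform s1 Q b0 hb)].
pose k := maxn kq kb.
have ph_ge q : 0 <= q <= Q -> b <= \int[P0]_w truncated_power k.+2%:R q (expR ((s1 - 1) * l2) * positive_part W w).
  by move=> /hkb h; apply: le_trans h _; apply: phi_mono => //; exact: leq_maxr.
have phQ : 1 < \int[P0]_w truncated_power k.+2%:R Q (expR ((s1 - 1) * l2) * positive_part W w).
  by apply: lt_le_trans hkq _; apply: phi_mono => //; exact: leq_maxl.
(* The first bound converts the exponent [s1] into [s]; the second keeps the growth factor
   [2 b exp (- Q dl)] above 1. *)
pose dl := Num.min ((s - s1) * l2) (eta * l2 / (4 * Q)).
have dl0 : 0 < dl by rewrite lt_min mulr_gt0 ?subr_gt0//= divr_gt0 ?mulr_gt0.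
have dl1 : dl <= (s - s1) * l2 by rewrite /dl ge_min lexx.
have dl2 : Q * dl <= eta * l2 / 4.
  have : dl <= eta * l2 / (4 * Q) by rewrite /dl ge_min lexx orbT.
  rewrite ler_pdivlMr ?mulr_gt0// ler_pdivlMr// => h; apply: le_trans h.
  by rewrite le_eqVlt; apply/orP; left; apply/eqP; ring.
have big : 1 < 2 * b * expR (- (Q * dl)).
  rewrite -[X in X * b](lnK (_ : 2 \is Num.pos)) ?posrE// -!expRD -[X in X < _]expR0 ltr_expR -/l2.
  have : 0 < eta * l2 by rewrite mulr_gt0.
  have -> : l2 + (eta / 2 - 1) * l2 = eta * l2 / 2 by ring.
  by move: dl2; move: (Q * dl) (eta * l2) => z1 z2; lra.
have K1 : 1 < k.+2%:R :> R by rewrite ltr1n.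
have [N [N0 [gam gam1 hN]]] := large_branch_truncated iY K1 Q0 b2 ph_ge phQ dl0 big.
exists N; split=> //; exists gam => // v vN; apply: le_trans (hN v vN) _; rewrite ler_wpM2l ?exprn_ge0//.
have mY t : measurable_fun setT (Y t) by have [] := iY.
have mw : measurable_fun setT (cascade_weight Y v) by apply: measurable_weight => j _.
apply: fine_le; rewrite ?fin_num_measure//; try by apply: measurable_set_ler => //; apply: measurable_funM.
apply: le_measure; rewrite ?inE//.
- by apply: measurable_set_ler => //; apply: measurable_funM.
- by apply: measurable_set_ler.
move=> w /= h.
have aN : expR ((s1 - 1) * l2) ^+ N = expR (N%:R * ((s1 - 1) * l2)) by rewrite expRM_natl.
move: h; rewrite aN [expR (N%:R * _) * _]mulrC -ler_pdivrMr ?expR_gt0// -expRN -expRD => /(le_trans _); apply.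
rewrite /powR pnatr_eq0/= ler_expR -/l2.
have := ler_wpM2r (ler0n R N) dl1; rewrite mulrC.
have -> : N%:R * (1 - s) * l2 = N%:R * l2 - N%:R * s * l2 by ring.
have -> : N%:R * ((s1 - 1) * l2) = N%:R * s1 * l2 - N%:R * l2 by ring.
have -> : (s - s1) * l2 * N%:R = N%:R * s * l2 - N%:R * s1 * l2 by ring.
by move: (N%:R * s * l2) (N%:R * s1 * l2) (N%:R * l2) (N%:R * dl) => z1 z2 z3 z4; lra.
Qed.

End large_branches.

(** * Branching and the zero-one law *)

(** A Bonferroni inequality: each new event loses at most its intersections with the earlier
    ones. *)
Lemma union_prob_ge d (T : measurableType d) (R : realType) (P : probability T R)
    (I : choiceType) (s : seq I) (E : I -> set T) (be : R) : uniq s -> (forall i, measurable (E i)) ->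
  0 <= be -> (forall i j, i != j -> fine (P (E i `&` E j)) <= be) ->
  \sum_(i <- s) fine (P (E i)) <= fine (P (\big[setU/set0]_(i <- s) E i)) + (size s)%:R ^+ 2 * be.
Proof.
move=> + mE be0 hbe; elim: s => [_|i s IH /=/andP[is_ us]].
  by rewrite !big_nil measure0/= expr0n mul0r addr0.
set U := \big[setU/set0]_(j <- s) E j in IH *.
have mU : measurable U by exact: bigsetU_measurable.
have mD : measurable (E i `\` U) by exact: measurableD.
have mij j : measurable (E i `&` E j) by exact: measurableI.
have f A : measurable A -> P A = (fine (P A))%:E by move=> mA; rewrite fineK ?fin_num_measure.
have h1 : fine (P (E i)) <= fine (P (E i `\` U)) + (size s)%:R * be.
  have mB : measurable (\big[setU/set0]_(j <- s) (E i `&` E j)) by exact: bigsetU_measurable.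
  apply: (@le_trans _ _ (fine (P (E i `\` U)) + \sum_(j <- s) fine (P (E i `&` E j)))).
    rewrite -lee_fin EFinD -sumEFin -!f//.
    rewrite (eq_bigr (fun j => P (E i `&` E j))) => [|j _]; last by rewrite -f.
    apply: le_trans (leeD2l _ (measure_bigsetU_le P s mij)).
    apply: (le_trans _ (measureU2 _ mD mB)).
    apply: le_measure; rewrite ?inE//; first exact: measurableU.
    move=> w Ew; have [h|h] := pselect (U w); [right|by left].
    by move: h; rewrite /U -!bigcup_seq => -[j js Ej]; exists j.
  rewrite lerD2l; apply: (@le_trans _ _ (\sum_(j <- s) be)).
    rewrite big_seq [leRHS]big_seq; apply: ler_sum => j js; apply: hbe.
    by apply: contraNneq is_ => ->.
  by rewrite big_const_seq count_predT iter_addr addr0 mulr_natl.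
have h2 : fine (P (E i `|` U)) = fine (P (E i `\` U)) + fine (P U).
  have -> : E i `|` U = (E i `\` U) `|` U.
    apply/seteqP; split=> w [h|h]; [|by right|by left; case: h|by right].
    by have [h'|h'] := pselect (U w); [right|left].
  rewrite measureU//; last by rewrite setDE -setIA setICl setI0.
  by rewrite fineD ?fin_num_measure.
have := IH us; rewrite !big_cons -/U h2 -natr1 => h3.
have -> : ((size s)%:R + 1) ^+ 2 * be = (size s)%:R ^+ 2 * be + (size s)%:R * be + ((size s)%:R + 1) * be.
  by ring.
have : 0 <= ((size s)%:R + 1) * be by rewrite mulr_ge0.
move: h1 h3; move: (fine (P (E i))) (\sum_(_ <- _) _) (fine (P (_ `\` _))) (fine (P U)).
by move: ((size s)%:R * be) (_ ^+ 2 * be) (_ * be) => a1 a2 a3 a4 a5 a6 a7; lra.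
Qed.

(** Up to [(ga - 1) / M] the sequence does not decrease; from above this level one step keeps at
    least the fraction [rho] of it. *)
Lemma logistic_lower (R : realType) (s : nat -> R) (ga rho M : R) :
  0 < s 0 -> 1 < ga -> 0 < rho <= 1 -> 0 < M -> (forall k, s k.+1 >= ga * s k - M * s k ^+ 2) ->
  (forall k, s k.+1 >= rho * s k) -> exists2 de, 0 < de & forall k, de <= s k.
Proof.
move=> s0 ga1 /andP[rho0 rho1] M0 h1 h2.
pose de := Num.min (s 0) (rho * ((ga - 1) / M)).
have de0 : 0 < de by rewrite lt_min s0 mulr_gt0// divr_gt0// subr_gt0.
exists de => //; elim=> [|k IH]; first by rewrite /de ge_min lexx.
have sk0 : 0 < s k by apply: lt_le_trans IH.
have [le|lt] := leP (s k) ((ga - 1) / M).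
  apply: le_trans IH _; apply: le_trans (h1 k).
  have -> : ga * s k - M * s k ^+ 2 = s k + s k * (ga - 1 - s k * M) by ring.
  by rewrite lerDl mulr_ge0 ?(ltW sk0)// subr_ge0 -ler_pdivlMr.
apply: le_trans (h2 k); apply: (@le_trans _ _ (rho * ((ga - 1) / M))).
  by rewrite /de ge_min lexx orbT.
by rewrite ler_wpM2l// ltW.
Qed.

(** * Persistence, extinction and growth as events on the path space *)

Section path_events.
Context (R : realType).
Local Notation S := (path_space R nonnil).
Implicit Types (x : S) (u v t : seq bool) (c : R).

Definition coordinate t (x : S) : R := x t.

Definition shift u (x : S) : S := fun t => x (u ++ t).

Local Notation weight := (cascade_weight coordinate).

Definition total n (x : S) : R := 2 ^- n * \sum_(u <- words n) weight u x.

(** Infinitely often rather than in the limit: this is an event in every subtree whether or not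
    [total] converges there. *)
Definition persistent c : set S := [set x | forall N, exists2 n, (N <= n)%N & c <= total n x].

Lemma weight_cat u v x : weight (u ++ v) x = weight u x * weight v (shift u x).
Proof. exact: cascade_weight_cat. Qed.

Lemma shift_cat u v x : shift v (shift u x) = shift (u ++ v) x.
Proof. by apply/funext => t; rewrite /shift catA. Qed.

Lemma total_cat l n x : total (l + n) x = 2 ^- l * \sum_(u <- words l) weight u x * total n (shift u x).
Proof.
rewrite /total sum_words_cat exprD invfM -mulrA; congr (_ * _); rewrite mulr_sumr.
apply: eq_bigr => u _; rewrite mulrCA; congr (_ * _); rewrite mulr_sumr.
by apply: eq_bigr => t _; exact: weight_cat.
Qed.

Lemma measurable_path_weight D u : (forall j, (0 < j <= size u)%N -> D (take j u)) ->
  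
  measurable_fun setT (cascade_weight (fun t (x : path_space R D) => x t) u).
Proof. by move=> h; apply: (@measurable_weight _ (path_space R D)) => j ju;
  exact: (@measurable_coord R D (take j u) (h j ju)). Qed.

Lemma nonnil_take u j : (0 < j <= size u)%N -> nonnil (take j u).
Proof. by move=> /andP[j0 ju]; rewrite /nonnil/= -size_eq0 size_takel// -lt0n. Qed.

Lemma measurable_total n : measurable_fun setT (total n : S -> R).
Proof.
apply: measurable_funM => //; apply: measurable_sum_seq => u _.
by apply: (@measurable_path_weight nonnil) => j; exact: nonnil_take.
Qed.

Lemma measurable_shift D u : (forall t, nonnil t -> D (u ++ t)) ->
  
  measurable_fun setT ((fun x t => x (u ++ t)) : path_space R D -> S).
Proof. by move=> h; apply: (@measurable_path _ _ (path_space R D)) => t t0;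
  exact: (@measurable_coord R D (u ++ t) (h t t0)). Qed.

Lemma measurable_persistent c : measurable (persistent c).
Proof.
have -> : persistent c = \bigcap_N \bigcup_(n in [set n | (N <= n)%N]) [set x | c <= total n x].
  by apply/seteqP; split=> x h N; [move=> _; have [n ? ?] := h N; exists n|have [n ? ?] := h N I; exists n].
apply: bigcap_measurable => // N _; apply: bigcup_measurable => n _.
apply: measurable_set_ler => //; exact: measurable_total.
Qed.

Lemma persistent_shift c u x : (forall t, 0 <= x t) -> persistent c (shift u x) ->
  persistent (2 ^- size u * weight u x * c) x.
Proof.
move=> x0 h N; have [n Nn cn] := h N; exists (size u + n)%N; first exact: (leq_trans Nn (leq_addl _ _)).
have w0 v (y : S) : (forall t, 0 <= y t) -> 0 <= weight v y.
  by move=> y0; apply: prodr_ge0 => j _; exact: y0.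
rewrite total_cat -mulrA ler_wpM2l ?invr_ge0 ?exprn_ge0//.
rewrite (bigD1_seq u) ?uniq_words ?mem_words//=; apply: (@le_trans _ _ (weight u x * total n (shift u x))).
  by rewrite ler_wpM2l ?w0.
rewrite lerDl sumr_ge0// => v _; rewrite mulr_ge0 ?w0// mulr_ge0 ?invr_ge0 ?exprn_ge0//.
by apply: sumr_ge0 => t _; apply: w0 => t'; exact: x0.
Qed.

(** Survival for [k] generations of the branching process whose offspring are blocks of [N] letters
    with weight at least [r], ending at a word with a persistent subtree. *)
Fixpoint heavy_chain N (r c : R) k : set S :=
  if k is k'.+1 then \big[setU/set0]_(u <- words N)
    ([set x | r <= weight u x] `&` shift u @^-1` heavy_chain N r c k')
  else persistent c.

Lemma measurable_heavy_chain N r c k : measurable (heavy_chain N r c k).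
Proof.
elim: k => [|k IH] /=; first exact: measurable_persistent.
apply: bigsetU_measurable => u _; apply: measurableI.
  by apply: measurable_set_ler => //; apply: (@measurable_path_weight nonnil) => j; exact: nonnil_take.
rewrite -[X in measurable X]setTI; apply: (@measurable_shift nonnil u) => //.
by move=> t; rewrite /nonnil/= -!size_eq0 size_cat addn_eq0 negb_and orbC => ->.
Qed.

Lemma heavy_chainP N r c k x : 0 <= r -> heavy_chain N r c k x ->
  exists2 v, size v = (k * N)%N & r ^+ k <= weight v x /\ persistent c (shift v x).
Proof.
move=> r0; elim: k x => [|k IH] x /=.
  by move=> h; exists [::] => //; rewrite cascade_weight_nil expr0.
rewrite -bigcup_seq => -[u]; rewrite /= mem_words => /eqP uN [/= ru /IH [v vk [rv hv]]].
exists (u ++ v); first by rewrite size_cat uN vk mulSn.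
rewrite weight_cat exprS -shift_cat; split => //; apply: ler_pM => //; exact: exprn_ge0.
Qed.

(** Only words with a persistent subtree are tested: for these the mass of the cell under the weak
    limit dominates the product of weights. *)
Definition growth_bound (s c : R) (K : nat) : set S := [set x | forall v,
  persistent c (shift v x) -> 2 `^ ((size v)%:R * s) * (2 ^- size v * weight v x) <= K%:R].

Lemma measurable_growth_bound s c K : measurable (growth_bound s c K).
Proof.
pose G n : set S := if unpickle n is Some v then
  ~` (shift v @^-1` persistent c) `|` [set x | 2 `^ ((size v)%:R * s) * (2 ^- size v * weight v x) <= K%:R]
  else setT.
have mG n : measurable (G n).
  rewrite /G; case: (unpickle n) => [v|]; last exact: measurableT.
  apply: measurableU.
    apply: measurableC; rewrite -[X in measurable X]setTI.
    apply: (@measurable_shift nonnil v) => //; last exact: measurable_persistent.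
    by move=> t; rewrite /nonnil/= -!size_eq0 size_cat addn_eq0 negb_and orbC => ->.
  apply: measurable_set_ler => //; apply: measurable_funM => //; apply: measurable_funM => //.
  by apply: (@measurable_path_weight nonnil) => j; exact: nonnil_take.
have -> : growth_bound s c K = \bigcap_n G n.
  apply/seteqP; split=> x h.
    by move=> n _; rewrite /G; case: (unpickle n) => // v; have [hv|hv] := pselect (persistent c (shift v x));
      [right; exact: h|left].
  by move=> v hv; have := h (pickle v) I; rewrite /G pickleK => -[].
exact: bigcapT_measurable.
Qed.

Definition bounded_growth (s c : R) : set S := \bigcup_K growth_bound s c K.

(** In a nonnegative environment: [total] tends to 0. *)
Definition extinct : set S := \bigcap_k ~` persistent k.+1%:R^-1.

Lemma measurable_bounded_growth s c : measurable (bounded_growth s c).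
Proof. by apply: bigcup_measurable => K _; exact: measurable_growth_bound. Qed.

Lemma measurable_extinct : measurable extinct.
Proof. by apply: bigcap_measurable => // k _; apply: measurableC; exact: measurable_persistent. Qed.

Lemma extinctP x : extinct x -> forall c, 0 < c -> ~ persistent c x.
Proof.
move=> ex c c0 h; have [k] := ltr_add_invr c0; rewrite add0r => kc.
apply: (ex k I) => N; have [n Nn cn] := h N; exists n => //; exact: le_trans (ltW kc) cn.
Qed.

Lemma path_weight_ge0 u x : (forall t, 0 <= x t) -> 0 <= weight u x.
Proof. by move=> x0; apply: prodr_ge0 => j _; exact: x0. Qed.

(** On extinction a persistent subtree can only hang below a word of weight 0. *)
Lemma extinct_bounded s c x : 0 < c -> (forall t, 0 <= x t) -> extinct x -> bounded_growth s c x.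
Proof.
move=> c0 x0 ex; exists 0 => // v hv.
have := path_weight_ge0 v x0; rewrite le_eqVlt => /orP[/eqP <-|w0]; first by rewrite !mulr0.
have := extinctP ex _ (persistent_shift x0 hv); case.
by rewrite !mulr_gt0// invr_gt0 exprn_gt0.
Qed.

Lemma bounded_growth_child s c x b : (forall t, 0 <= x t) -> 0 <= s -> bounded_growth s c x ->
  x [:: b] = 0 \/ bounded_growth s c (shift [:: b] x).
Proof.
move=> x0 s0 [K _ h]; have := x0 [:: b]; rewrite le_eqVlt => /orP[/eqP <-|xb0]; [by left|right].
(* Without its first letter a word is one shorter: its mass is multiplied by [2 / x [:: b]], while
   the factor [2 ^ (|v| s)] does not grow, as [s >= 0]. *)
exists (Num.truncn (2 * K%:R / x [:: b])).+1 => // v hv.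
have sx0 t : 0 <= shift [:: b] x t by exact: x0.
have := h (b :: v) hv.
have -> : weight (b :: v) x = x [:: b] * weight v (shift [:: b] x).
  by rewrite -cat1s weight_cat; congr (_ * _); rewrite /cascade_weight big_nat1.
rewrite [size (b :: v)]/= => h1; apply: le_trans (ltW (truncnS_gt _)).
rewrite ler_pdivlMr//; apply: (@le_trans _ _ (2 * (2 `^ ((size v).+1%:R * s) *
    (2 ^- (size v).+1 * (x [:: b] * weight v (shift [:: b] x)))))); last by rewrite ler_wpM2l.
have -> : 2 * (2 `^ ((size v).+1%:R * s) * (2 ^- (size v).+1 * (x [:: b] * weight v (shift [:: b] x)))) =
   2 `^ ((size v).+1%:R * s) * (2 ^- size v * weight v (shift [:: b] x)) * x [:: b].
  by rewrite exprS; field; rewrite expf_neq0// pnatr_eq0.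
rewrite ler_wpM2r ?(ltW xb0)// ler_wpM2r ?mulr_ge0 ?invr_ge0 ?exprn_ge0 ?path_weight_ge0//.
by apply: ler_powR; rewrite ?ler1n// ler_wpM2r// ler_nat.
Qed.

Lemma extinct_children x : (forall t, 0 <= x t) ->
  (forall b, x [:: b] = 0 \/ extinct (shift [:: b] x)) -> extinct x.
Proof.
move=> x0 ch k _ h.
have e0 : 0 < k.+1%:R^-1 :> R by rewrite invr_gt0.
have small b : exists N, forall n, (N <= n)%N -> x [:: b] * total n (shift [:: b] x) < k.+1%:R^-1.
  have [->|ex] := ch b; first by exists 0 => n _; rewrite mul0r.
  have := x0 [:: b]; rewrite le_eqVlt => /orP[/eqP <-|xb0]; first by exists 0 => n _; rewrite mul0r.
  have c0 : 0 < k.+1%:R^-1 / x [:: b] by rewrite divr_gt0.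
  have /existsNP[N hN] := extinctP ex c0; exists N => n Nn; rewrite ltNge; apply/negP => le.
  by apply: hN; exists n => //; rewrite ler_pdivrMr// mulrC.
have [N1 h1] := small false; have [N2 h2] := small true.
have [n Nn] := h (maxn N1 N2).+1; apply/negP; rewrite -ltNge.
case: n Nn => // n; rewrite ltnS geq_max => /andP[n1 n2].
rewrite -add1n total_cat /words/= !big_cons big_nil addr0 /=.
have wb b : weight [:: b] x = x [:: b] by rewrite /cascade_weight big_nat1.
rewrite !wb expr1; have := h1 n n1; have := h2 n n2.
by move: (_ * _) (_ * total n _) => z1 z2; move: (k.+1%:R^-1) => z; lra.
Qed.

End path_events.

Section growth.
Context d (T : measurableType d) d0 (T0 : measurableType d0) (R : realType)
  (P : probability T R) (P0 : probability T0 R) (V : {RV P0 >-> R})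
  (Y : seq bool -> T -> R).
Hypothesis iY : iid_family P (distribution P0 V) Y.
Hypothesis Y0 : forall v w, 0 <= Y v w.
Local Notation S := (path_space R nonnil).
Local Notation root := (subtree Y [::]).

Definition prob_root (A : set S) : R := fine (P (root @^-1` A)).

Let msub v (A : set S) : measurable A -> measurable (subtree Y v @^-1` A).
Proof. by move=> mA; rewrite -[X in measurable X]setTI; exact: (measurable_subtree iY v). Qed.

Let mY v : measurable_fun setT (Y v). Proof. by have [] := iY. Qed.

Lemma fine_probE (A : set T) : measurable A -> P A = (fine (P A))%:E.
Proof. by move=> mA; rewrite fineK ?fin_num_measure. Qed.

Lemma prob_root_subtree v (A : set S) : measurable A -> fine (P (subtree Y v @^-1` A)) = prob_root A.
Proof. by move=> mA; rewrite (subtree_law iY v mA). Qed.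

Lemma weight_independent N r u (B : set S) : size u = N -> measurable B ->
  fine (P ([set w | r <= cascade_weight Y u w] `&` subtree Y u @^-1` B)) =
  fine (P [set w | r <= cascade_weight Y u w]) * prob_root B.
Proof.
move=> uN mB; pose D := [set t : seq bool | t != [::] /\ (size t <= N)%N].
pose D' := [set t : seq bool | (N < size t)%N].
have Dn : D `<=` nonnil by move=> t [].
have Dn' : D' `<=` nonnil by move=> t /= h; rewrite /nonnil/= -size_eq0 -lt0n; exact: leq_ltn_trans h.
have DD : D `&` D' = set0.
  by apply/seteqP; split => // t [[_ h1] h2]; have := leq_ltn_trans h1 h2; rewrite ltnn.
pose A := [set x : path_space R D | r <= cascade_weight (fun t (x : path_space R D) => x t) u x].
have mA : measurable A.
  apply: measurable_set_ler => //; apply: measurable_path_weight => j ju; split.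
    exact: (nonnil_take ju).
  by rewrite size_takel ?uN// -uN; case/andP: ju.
have Du t : nonnil t -> D' (u ++ t).
  by rewrite /nonnil/= -size_eq0 -lt0n => t0; rewrite /D'/= size_cat uN -[X in (X < _)%N]addn0 ltn_add2l.
pose A' := ((fun x t => x (u ++ t)) : path_space R D' -> S) @^-1` B.
have mA' : measurable A'.
  by rewrite -[X in measurable X]setTI; exact: (measurable_shift Du).
have := path_independent iY Dn Dn' DD mA mA'.
rewrite -[path_of Y D @^-1` A]/[set w | r <= cascade_weight Y u w].
rewrite -[path_of Y D' @^-1` A']/(subtree Y u @^-1` B) => ->.
rewrite fineM ?fin_num_measure ?prob_root_subtree//; last exact: msub.
by apply: measurable_set_ler => //; apply: measurable_weight => j _.
Qed.

Lemma subtrees_independent u u' (B B' : set S) : size u = size u' -> u != u' ->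
  measurable B -> measurable B' ->
  fine (P (subtree Y u @^-1` B `&` subtree Y u' @^-1` B')) = prob_root B * prob_root B'.
Proof.
move=> uu nuu mB mB'; pose D v := [set v ++ t | t in nonnil].
have Dn v : D v `<=` nonnil.
  by move=> _ [t t0 <-]; move: t0; rewrite /nonnil/= -!size_eq0 size_cat addn_eq0 negb_and orbC => ->.
have DD : D u `&` D u' = set0.
  apply/seteqP; split => // t [[t1 _ <-] [t2 _ /eqP]].
  by rewrite eqseq_cat// eq_sym (negbTE nuu).
have Du v t : nonnil t -> D v (v ++ t) by move=> t0; exists t.
have mA v (C : set S) : measurable C -> measurable (((fun x t => x (v ++ t)) : path_space R (D v) -> S) @^-1` C).
  by move=> mC; rewrite -[X in measurable X]setTI; exact: (measurable_shift (Du v)).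
have := path_independent iY (@Dn u) (@Dn u') DD (mA u _ mB) (mA u' _ mB').
rewrite -[path_of Y (D u) @^-1` _]/(subtree Y u @^-1` B).
rewrite -[path_of Y (D u') @^-1` _]/(subtree Y u' @^-1` B') => ->.
by rewrite fineM ?fin_num_measure ?prob_root_subtree//; exact: msub.
Qed.

Lemma prob_root_ge0 A : 0 <= prob_root A. Proof. by rewrite fine_ge0. Qed.

(** The [2 ^ N] events of a surviving child have probabilities summing to at least [ga] times the
    previous survival probability, and pairwise intersections of at most its square. Bonferroni then
    gives the logistic recursion. *)
Lemma heavy_chain_ge N r c ga : 1 < ga -> 0 < prob_root (persistent c) ->
  (forall u, size u = N -> ga <= 2 ^+ N * fine (P [set w | r <= cascade_weight Y u w])) ->
  exists2 de, 0 < de & forall k, de <= prob_root (heavy_chain N r c k).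
Proof.
move=> ga1 c0 hN; pose s k := prob_root (heavy_chain N r c k).
have p2 : 0 < 2 ^+ N :> R by rewrite exprn_gt0.
have mH k := @measurable_heavy_chain R N r c k.
have mW u : measurable [set w | r <= cascade_weight Y u w].
  by apply: measurable_set_ler => //; apply: measurable_weight => j _.
pose E k u := [set w | r <= cascade_weight Y u w] `&` subtree Y u @^-1` heavy_chain N r c k.
have mE k u : measurable (E k u) by apply: measurableI => //; exact: msub.
have HE k : root @^-1` heavy_chain N r c k.+1 = \big[setU/set0]_(u <- words N) E k u.
  by rewrite /= -!bigcup_seq preimage_bigcup.
have EE k u : size u = N -> ga / 2 ^+ N * s k <= fine (P (E k u)).
  move=> uN; rewrite /E (weight_independent _ uN)//; apply: ler_wpM2r; first exact: prob_root_ge0.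
  by rewrite ler_pdivrMr// mulrC; exact: hN.
have rho : 0 < ga / 2 ^+ N <= 1.
  rewrite divr_gt0 ?(lt_trans _ ga1)//= ler_pdivrMr// mul1r.
  have := hN (nseq N false); rewrite size_nseq => /(_ erefl)/le_trans; apply.
  by rewrite ler_piMr ?(ltW p2)// -lee_fin -fine_probE ?probability_le1.
apply: (@logistic_lower _ s ga (ga / 2 ^+ N) ((2 ^+ N) ^+ 2)) => //.
- move=> k; rewrite lerBlDr.
  have be0 : 0 <= s k ^+ 2 by rewrite sqr_ge0.
  apply: (@le_trans _ _ (\sum_(u <- words N) fine (P (E k u)))).
    apply: (@le_trans _ _ (\sum_(u <- words N) ga / 2 ^+ N * s k)).
      rewrite big_const_seq count_predT size_words iter_addr addr0 -[_ *+ _]mulr_natl natrX.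
      by rewrite mulrA mulrCA divff ?mulr1// gt_eqF.
    by rewrite big_seq [leRHS]big_seq; apply: ler_sum => u; rewrite mem_words => /eqP; exact: EE.
  (* [union_prob_ge] wants the overlap bound for all pairs of words; independence gives it at equal
     length, and the empty set elsewhere. *)
  pose E' u := if size u == N then E k u else set0.
  have E'E (u : seq bool) : u \in words N -> E k u = E' u by rewrite mem_words /E' => ->.
  have := @union_prob_ge _ T R P _ (words N) E' (s k ^+ 2) (uniq_words N) _ be0.
  rewrite size_words natrX /s /prob_root HE -/(prob_root _) -/(s k).
  rewrite (eq_big_seq (fun u => fine (P (E k u)))) => [|u uN]; last by rewrite E'E.
  rewrite [\big[setU/set0]_(u <- words N) E' u](eq_big_seq (E k)) => [|u uN]; last by rewrite E'E.
  apply; first by move=> u; rewrite /E'; case: ifP.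
  move=> u v uv; rewrite /E'; case: eqP => uN; last by rewrite set0I measure0.
  case: eqP => vN; last by rewrite setI0 measure0.
  rewrite expr2 -(subtrees_independent (etrans uN (esym vN)) uv (mH k) (mH k)).
  apply: fine_le; rewrite ?fin_num_measure//; try (by apply: measurableI); try by apply: measurableI; exact: msub.
  apply: le_measure; rewrite ?inE; [exact: measurableI|by apply: measurableI; exact: msub|].
  by move=> w [[_ h1] [_ h2]].
- move=> k; apply: le_trans (EE k (nseq N false) (size_nseq _ _)) _.
  rewrite /s /prob_root; apply: fine_le; rewrite ?fin_num_measure//; first exact: msub.
  apply: le_measure; rewrite ?inE//; first exact: msub.
  by rewrite HE -bigcup_seq => w Ew; exists (nseq N false) => //=; rewrite mem_words size_nseq.
Qed.

(** A heavy chain of exponent [s' < s] with [k] large violates the growth bound [K]. Its probability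
    is at least [de] whatever [K] is, so [1 - de] survives the union over [K]. *)
Lemma bounded_growth_lt1 N c ga (s s' : R) : (0 < N)%N -> 1 < ga -> s' < s ->
  0 < prob_root (persistent c) ->
  (forall u, size u = N -> ga <= 2 ^+ N * fine (P [set w | 2 `^ (N%:R * (1 - s')) <= cascade_weight Y u w])) ->
  prob_root (bounded_growth s c) < 1.
Proof.
move=> N0 ga1 ss c0 hN; have [de de0 hde] := heavy_chain_ge ga1 c0 hN.
set r := 2 `^ _ in hN hde; have r0 : 0 <= r by exact: powR_ge0.
have mG K := @measurable_growth_bound R s c K.
have bound K : prob_root (growth_bound s c K) <= 1 - de.
  pose e := (s - s') * N%:R * ln 2.
  have e0 : 0 < e by rewrite !mulr_gt0 ?subr_gt0 ?ltr0n ?ln_gt0 ?ltr1n.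
  pose k := (Num.truncn (K%:R / e)).+1.
  have kK : K%:R < expR (k%:R * e).
    apply: lt_le_trans (expR_ge1Dx _); apply: (@lt_trans _ _ (k%:R * e)); last by rewrite ltrDr.
    by rewrite -ltr_pdivrMr//; exact: truncnS_gt.
  have disj : growth_bound s c K `&` heavy_chain N r c k = set0.
    apply/seteqP; split => // x [hK /(heavy_chainP r0)[v vk [rv hv]]].
    have := hK v hv; apply/negP; rewrite -ltNge; apply: lt_le_trans kK _.
    apply: (@le_trans _ _ (2 `^ ((size v)%:R * s) * (2 ^- size v * r ^+ k))); last first.
      by rewrite !ler_wpM2l ?powR_ge0 ?invr_ge0 ?exprn_ge0.
    rewrite vk /r -powR_mulrn ?powR_ge0// -powRrM -powR_inv1 ?exprn_ge0// -powR_mulrn// -powRrM.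
    rewrite -!powRD ?pnatr_eq0 ?implybT// /powR pnatr_eq0/= ler_expR natrM /e.
    by rewrite le_eqVlt; apply/orP; left; apply/eqP; ring.
  have mK : measurable (root @^-1` growth_bound s c K) by exact: msub.
  have mC : measurable (root @^-1` heavy_chain N r c k) by apply: msub; exact: measurable_heavy_chain.
  have : fine (P (root @^-1` growth_bound s c K `|` root @^-1` heavy_chain N r c k)) <= 1.
    by rewrite -lee_fin -fine_probE ?probability_le1//; exact: measurableU.
  rewrite measureU//; last by rewrite -preimage_setI disj preimage_set0.
  rewrite fineD ?fin_num_measure//; have := hde k; rewrite /prob_root.
  by move: (fine _) (fine _) => z1 z2; lra.
apply: (@le_lt_trans _ _ (1 - de)); last by rewrite gtrDl oppr_lt0.
have mF : measurable (root @^-1` bounded_growth s c) by apply: msub; exact: measurable_bounded_growth.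
rewrite /prob_root -lee_fin -fine_probE//.
have nd : {homo (fun K => root @^-1` growth_bound s c K) : n m / (n <= m)%N >-> (n <= m)%O}.
  move=> n m nm; apply/subsetPset => w h v hv; apply: le_trans (h v hv) _.
  by rewrite ler_nat.
have mFK K : measurable (root @^-1` growth_bound s c K) by exact: msub.
have mU : measurable (\bigcup_K root @^-1` growth_bound s c K) by exact: bigcup_measurable.
have cv := nondecreasing_cvg_mu (mu := P) mFK mU nd.
rewrite /bounded_growth preimage_bigcup -(cvg_lim (@ereal_hausdorff R) cv).
apply: lime_le; first by apply/cvg_ex; exists (P (\bigcup_K root @^-1` growth_bound s c K)).
by apply: nearW => K /=; rewrite fine_probE// lee_fin; exact: bound.
Qed.

Let child (A : set S) b := [set w | Y [:: b] w = 0 \/ A (subtree Y [:: b] w)].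

Let no_child b := Y [:: b] @^-1` [set 0].

Lemma prob_no_child b : fine (P (no_child b)) = fine (P0 (V @^-1` [set 0])).
Proof. by rewrite /no_child (iid_law iY). Qed.

(** The complement asks for a nonzero weight and for the failure of [A] below it, which are
    independent. *)
Lemma prob_child (A : set S) b : measurable A -> measurable (child A b) /\
  fine (P (child A b)) = 1 - (1 - fine (P0 (V @^-1` [set 0]))) * (1 - prob_root A).
Proof.
move=> mA; have m0 : measurable (no_child b).
  by rewrite /no_child -[X in measurable X]setTI; exact: (mY [:: b] measurableT (measurable_set1 0)).
have mb : measurable (subtree Y [:: b] @^-1` A) by exact: msub.
have cE : child A b = ~` (~` no_child b `&` subtree Y [:: b] @^-1` (~` A)).
  rewrite setCI setCK -preimage_setC setCK; apply/seteqP; split=> w [h|h]; by [left|right].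
have mc : measurable (child A b).
  by rewrite cE; apply: measurableC; apply: measurableI; [exact: measurableC|apply: msub; exact: measurableC].
split => //.
pose D := [set t : seq bool | t = [:: b]]; pose D' := [set b :: t | t in nonnil].
have Dn : D `<=` nonnil by move=> t ->.
have Dn' : D' `<=` nonnil by move=> _ [t _ <-].
have DD : D `&` D' = set0 by apply/seteqP; split => // t [-> [t' + [E]]]; rewrite E.
have mD : measurable ((fun x : path_space R D => x [:: b]) @^-1` (~` [set 0])).
  by rewrite -[X in measurable X]setTI; apply: (@measurable_coord R D [:: b] erefl) => //; exact: measurableC.
have Du t : nonnil t -> D' ([:: b] ++ t) by move=> t0; exists t.
have mD' : measurable (((fun x t => x ([:: b] ++ t)) : path_space R D' -> S) @^-1` (~` A)).
  by rewrite -[X in measurable X]setTI; apply: (measurable_shift Du) => //; exact: measurableC.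
have := path_independent iY Dn Dn' DD mD mD'.
rewrite -[path_of Y D @^-1` _]/(~` no_child b).
rewrite -[path_of Y D' @^-1` _]/(subtree Y [:: b] @^-1` (~` A)) => ind.
have compl (B : set T) : measurable B -> fine (P (~` B)) = 1 - fine (P B).
  by move=> mB; rewrite probability_setC// fineB ?fin_num_measure.
rewrite cE compl; last first.
  by apply: measurableI; [exact: measurableC|apply: msub; exact: measurableC].
rewrite ind fineM ?fin_num_measure//; [|exact: measurableC|by apply: msub; exact: measurableC].
by rewrite compl// prob_no_child preimage_setC compl// prob_root_subtree.
Qed.

Lemma prob_children (A : set S) : measurable A ->
  fine (P (child A false `&` child A true)) =
  (1 - (1 - fine (P0 (V @^-1` [set 0]))) * (1 - prob_root A)) ^+ 2.
Proof.
move=> mA; pose D b := [set b :: t | t in [set: seq bool]].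
have Dn b : D b `<=` nonnil by move=> _ [t _ <-].
have DD : D false `&` D true = set0 by apply/seteqP; split => // t [[t1 _ <-] [t2 _]].
pose C b := [set x : path_space R (D b) | x [:: b] = 0] `|`
  (((fun x t => x ([:: b] ++ t)) : path_space R (D b) -> S) @^-1` A).
have mC b : measurable (C b).
  apply: measurableU.
    have Db : D b [:: b] by exists [::].
    rewrite -[X in measurable X]setTI.
    exact: (@measurable_coord R (D b) [:: b] Db measurableT [set 0] (measurable_set1 0)).
  rewrite -[X in measurable X]setTI; apply: (@measurable_shift R (D b) [:: b]) => //.
  by move=> t _; exists t.
have := path_independent iY (@Dn false) (@Dn true) DD (mC false) (mC true).
rewrite -[path_of Y (D false) @^-1` _]/(child A false) -[path_of Y (D true) @^-1` _]/(child A true) => ->.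
have [m1 e1] := prob_child false mA; have [m2 e2] := prob_child true mA.
by rewrite fineM ?fin_num_measure// e1 e2 expr2.
Qed.

Lemma growth_zero_one (s c : R) : 0 <= s -> 0 < c -> prob_root (bounded_growth s c) < 1 ->
  {ae P, forall w, ~ extinct (root w) -> ~ bounded_growth s c (root w)}.
Proof.
move=> s0 c0 p1; set F := bounded_growth s c; have mF := @measurable_bounded_growth R s c.
have mE := @measurable_extinct R.
have mrF : measurable (root @^-1` F) by exact: msub.
have mrE : measurable (root @^-1` @extinct R) by exact: msub.
have x0 v w t : 0 <= subtree Y v w t by exact: Y0.
set b := 1 - fine (P0 (V @^-1` [set 0])).
have b0 : 0 <= b.
  have mV0 : measurable (V @^-1` [set 0]) by rewrite -[X in measurable X]setTI; exact: measurable_funPT.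
  by rewrite subr_ge0 -lee_fin fineK ?fin_num_measure ?probability_le1.
have [mf1 _] := prob_child false mF; have [mf2 _] := prob_child true mF.
have [me1 _] := prob_child false mE; have [me2 _] := prob_child true mE.
have pF : prob_root F <= (1 - b * (1 - prob_root F)) ^+ 2.
  rewrite -(prob_children mF); apply: fine_le; rewrite ?fin_num_measure//; first exact: measurableI.
  apply: le_measure; rewrite ?inE//; first exact: measurableI.
  by move=> w Fw; split; exact: (bounded_growth_child _ (x0 _ _) s0 Fw).
have pE : (1 - b * (1 - prob_root (@extinct R))) ^+ 2 <= prob_root (@extinct R).
  rewrite -(prob_children mE); apply: fine_le; rewrite ?fin_num_measure//; first exact: measurableI.
  apply: le_measure; rewrite ?inE//; first exact: measurableI.
  by move=> w [w1 w2]; apply: (extinct_children (x0 _ _)) => -[].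
have EF : root @^-1` @extinct R `<=` root @^-1` F by move=> w; exact: (extinct_bounded s c0 (x0 _ _)).
suff D0 : P (root @^-1` F `\` root @^-1` @extinct R) = 0%E.
  exists (root @^-1` F `\` root @^-1` @extinct R); split => //; first exact: measurableD.
  by move=> w /= /not_implyP[nE /contrapT Fw].
have DE : P (root @^-1` F `\` root @^-1` @extinct R) = (prob_root F - prob_root (@extinct R))%:E.
  rewrite measureD//; last by rewrite ltey_eq fin_num_measure.
  by rewrite (setIidr EF) EFinB /prob_root !fineK ?fin_num_measure.
have pEF : prob_root (@extinct R) <= prob_root F.
  by apply: fine_le; rewrite ?fin_num_measure//; apply: le_measure; rewrite ?inE.
have le : prob_root F <= prob_root (@extinct R).
  have q0 : 0 < 1 - prob_root F by rewrite subr_gt0.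
  have f0 : 0 < 1 - prob_root (@extinct R) by rewrite subr_gt0; exact: le_lt_trans p1.
  move: pF pE q0 f0; move: (prob_root F) (prob_root (@extinct R)) => p e pF pE q0 f0.
  (* 1 is a fixed point of [z -> (1 - b (1 - z)) ^ 2]. Dividing by [1 - z] leaves an affine function
     of [1 - z] with slope [b ^ 2], nonnegative at [p] and nonpositive at [e]. *)
  have h1 : 0 <= (1 - p) * (1 - 2 * b + b ^+ 2 * (1 - p)).
    have -> : (1 - p) * (1 - 2 * b + b ^+ 2 * (1 - p)) = (1 - b * (1 - p)) ^+ 2 - p by ring.
    by rewrite subr_ge0.
  have h2 : (1 - e) * (1 - 2 * b + b ^+ 2 * (1 - e)) <= 0.
    have -> : (1 - e) * (1 - 2 * b + b ^+ 2 * (1 - e)) = (1 - b * (1 - e)) ^+ 2 - e by ring.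
    by rewrite subr_le0.
  rewrite pmulr_rge0// in h1; rewrite pmulr_rle0// in h2.
  have b1 : 0 < b.
    rewrite lt_neqAle b0 andbT; apply/eqP => bE.
    by move: h2; rewrite -bE mulr0 expr0n mul0r subr0 addr0 ler10.
  have : b ^+ 2 * (1 - e) <= b ^+ 2 * (1 - p).
    by move: h1 h2; move: (b ^+ 2 * _) (b ^+ 2 * _) => z1 z2; lra.
  by rewrite ler_pM2l ?exprn_gt0//; lra.
by apply/eqP; rewrite DE eqe subr_eq0 eq_le le pEF.
Qed.

End growth.

Section unbounded_growth.
Context d (T : measurableType d) d0 (T0 : measurableType d0) (R : realType)
  (P : probability T R) (P0 : probability T0 R) (W : {RV P0 >-> R})
  (Y : seq bool -> T -> R).
Hypothesis hW : minimal_Kahane_Peyriere P0 W.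
Hypothesis iY : iid_family P (distribution P0 (positive_part W)) Y.
Hypothesis Y0 : forall v w, 0 <= Y v w.
Local Notation root := (subtree Y [::]).

Lemma unbounded_growth (s : R) : A_loc P0 W < s -> exists2 c, 0 < c &
  {ae P, forall w, ~ extinct (root w) -> ~ bounded_growth s c (root w)}.
Proof.
move=> As; have A0 := A_loc_ge0 hW.
have mp k : measurable (root @^-1` persistent k.+1%:R^-1).
  by rewrite -[X in measurable X]setTI; apply: (measurable_subtree iY) => //; exact: measurable_persistent.
have [[k hk]|none] := pselect (exists k, 0 < prob_root P Y (persistent k.+1%:R^-1)).
  exists k.+1%:R^-1; first by rewrite invr_gt0.
  pose s' := (A_loc P0 W + s) / 2.
  have As' : A_loc P0 W < s' by rewrite /s'; move: As; move: (A_loc _ _) => z; lra.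
  have ss : s' < s by rewrite /s'; move: As; move: (A_loc _ _) => z; lra.
  have [N [N0 [ga ga1 hN]]] := large_branch hW iY As'.
  apply: (growth_zero_one iY Y0); first by rewrite (le_trans A0)// ltW.
    by rewrite invr_gt0.
  exact: (bounded_growth_lt1 iY N0 ga1 ss hk hN).
(* If no level [1 / (k + 1)] is persistent with positive probability, extinction is almost sure and
   any constant serves. *)
exists 1 => //; apply: filterS (_ : {ae P, forall w, forall k, ~ persistent k.+1%:R^-1 (root w)}).
  by move=> w h ne; case: ne => k _; exact: h.
apply: ae_foralln => k; exists (root @^-1` persistent k.+1%:R^-1); split => //.
  apply/eqP; rewrite eq_le measure_ge0 andbT -[X in (X <= _)%E]fineK ?fin_num_measure//.
  by rewrite lee_fin leNgt; apply/negP => h; apply: none; exists k.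
by move=> w /= /contrapT.
Qed.

End unbounded_growth.

(** * The Fourier dimension *)

Lemma average_mean (R : realType) (f F : R -> R) u :
  (forall t : R, t \in `[0, 1] -> is_derive t 1 F (f t)) ->
  exists2 t, t \in `[cascade_left R u, cascade_left R u + 2 ^- size u] & average F u = f t.
Proof.
move=> dF; set l := cascade_left R u.
have p0 : 0 < 2 ^- size u :> R by rewrite invr_gt0 exprn_gt0.
have lr : l < l + 2 ^- size u by rewrite ltrDl.
have dF' t : t \in `[l, l + 2 ^- size u] -> is_derive t 1 F (f t) by move=> /word_itv; exact: dF.
have Fc : {within `[l, l + 2 ^- size u], continuous F}.
  apply: continuous_in_subspaceT => t; rewrite inE => /dF'[dFt _].
  by apply: differentiable_continuous; exact/derivable1_diffP.
have [t tI E] := MVT lr (fun t ti => dF' t (subset_itv_oo_cc ti)) Fc.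
exists t; first exact: subset_itv_oo_cc.
by rewrite /average -/l E addrAC subrr add0r mulrCA mulfV ?mulr1// expf_neq0// pnatr_eq0.
Qed.

Section cell_mass.
Context d (T : measurableType d) (R : realType) (Y : seq bool -> T -> R) (w : T).
Hypothesis Y0 : forall v w, 0 <= Y v w.
Variable m : {finite_measure set R -> \bar R}.
Hypothesis Ym : weak_cvg (fun n => cascade_approx Y n w) m.
Local Notation left := (cascade_left R).
Local Notation root := (subtree Y [::] w).

Lemma total_shift v n : mass Y v w * total n (shift v root) = \sum_(t <- words n) mass Y (v ++ t) w.
Proof.
rewrite /total !mulr_sumr big_seq [RHS]big_seq.
apply: eq_bigr => t; rewrite mem_words => /eqP tn.
rewrite /mass cascade_weight_cat size_cat tn exprD invfM.
have -> : cascade_weight (@coordinate R) t (shift v root) = cascade_weight (fun t => Y (v ++ t)) t w by [].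
by ring.
Qed.

Lemma level_mass_ge v n (f F : R -> R) : continuous f -> (forall t : R, 0 <= f t) ->
  (forall t : R, t \in `[left v, left v + 2 ^- size v] -> f t = 1) ->
  (forall t : R, t \in `[0, 1] -> is_derive t 1 F (f t)) ->
  mass Y v w * total n (shift v root) <= level_mass Y (size v + n) (average F) w.
Proof.
move=> fc f0 f1 dF; rewrite total_shift /level_mass sum_words_cat.
have av0 u : 0 <= average F u by have [t _ ->] := average_mean u dF; exact: f0.
rewrite [leRHS](bigD1_seq v) ?uniq_words ?mem_words//= -[leLHS]addr0 lerD//; last first.
  by apply: sumr_ge0 => u _; apply: sumr_ge0 => t _; rewrite mulr_ge0// mass_ge0.
apply: ler_sum => t _; have [z zI ->] := average_mean (v ++ t) dF.
rewrite f1 ?mulr1//; have sv : (size v <= size (v ++ t))%N by rewrite size_cat leq_addr.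
have [l r] := @cascade_subinterval R (size v) (v ++ t) sv.
move: zI l r; rewrite take_size_cat// !in_itv/= => /andP[z1 z2] l r.
by rewrite (le_trans l z1) (le_trans z2 r).
Qed.

(** Test functions equal to 1 on the cell and vanishing at distance [1 / (j + 1)] have level masses
    at least [c] times the mass of [v] infinitely often, hence such an integral in the weak limit.
    Then [j] tends to infinity. *)
Lemma cell_mass_ge c v : persistent c (shift v root) ->
  c * mass Y v w <= fine (m `[left v, left v + 2 ^- size v]%classic).
Proof.
move=> pc; set I := `[_, _]%classic; pose h : R := 2 ^- size v.
have h0 : 0 < h by rewrite invr_gt0 exprn_gt0.
(* The projection onto the closed cell; [|t - pr t|] is the distance to it. *)
pose pr (t : R) := left v + h * clamp ((t - left v) / h).
have prI t : pr t \in `[left v, left v + h].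
  have := clamp_itv ((t - left v) / h); rewrite !in_itv/= => /andP[c0 c1].
  by rewrite /pr lerDl mulr_ge0 ?(ltW h0)//= lerD2l ler_piMr// ltW.
have prE t : t \in `[left v, left v + h] -> pr t = t.
  rewrite in_itv/= => /andP[t1 t2]; rewrite /pr clamp_id.
    by rewrite mulrC divfK ?gt_eqF// addrC subrK.
  by rewrite in_itv/= divr_ge0 ?subr_ge0 ?(ltW h0)//= ler_pdivrMr// mul1r lerBlDl.
have prc : continuous pr.
  move=> t; apply: cvgD; first exact: cvg_cst.
  apply: cvgM; first exact: cvg_cst.
  apply: (continuous_comp (f := fun t => (t - left v) / h)); last exact: continuous_clamp.
  by apply: cvgM; [apply: cvgB; [exact: cvg_id|exact: cvg_cst]|exact: cvg_cst].
pose J (j : nat) := `[left v - j.+1%:R^-1, left v + h + j.+1%:R^-1]%classic.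
have bound j : c * mass Y v w <= fine (m (J j)).
  pose f t := 1 - clamp (j.+1%:R * `|t - pr t|).
  have fc : continuous f.
    move=> t; apply: cvgB; first exact: cvg_cst.
    apply: (continuous_comp (f := fun t => j.+1%:R * `|t - pr t|)); last exact: continuous_clamp.
    apply: cvgM; first exact: cvg_cst.
    by apply: cvg_norm; apply: cvgB; [exact: cvg_id|exact: prc].
  have f01 t : 0 <= f t <= 1.
    have := clamp_itv (j.+1%:R * `|t - pr t|); rewrite in_itv/= /f => /andP[c0 c1].
    by rewrite subr_ge0 c1 gerBl c0.
  have f0 t : 0 <= f t by have /andP[] := f01 t.
  have f1 t : t \in `[left v, left v + h] -> f t = 1.
    by move=> /prE tE; rewrite /f tE subrr normr0 mulr0 clamp_id ?subr0// in_itv/= lexx ler01.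
  have fJ t : f t <= \1_(J j) t.
    rewrite indicE; have [//|tJ] := boolP (t \in J j); first by have /andP[] := f01 t.
    rewrite /f subr_le0; have [x1|x1] := leP 1 (j.+1%:R * `|t - pr t|).
      by rewrite /clamp min_r// max_r.
    exfalso; move/negP: tJ; apply; rewrite inE /J/= in_itv/=.
    have j0 : 0 < j.+1%:R :> R by [].
    move: x1; rewrite mulrC -ltr_pdivlMr// mul1r ltr_norml => /andP[x1 x2].
    have := prI t; rewrite in_itv/= => /andP[p1 p2].
    by apply/andP; split; move: x1 x2 p1 p2; move: (_^-1) (pr t) => z1 z2; lra.
  have [F dF] := primitive01 fc.
  have lim := weak_limit_nonneg Y0 Ym fc f01 dF.
  have le_int : c * mass Y v w <= \int[m]_t f t.
    rewrite -(cvg_lim (@Rhausdorff R) lim).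
    rewrite leNgt; apply/negP => lt.
    have limE := cvg_lim (@Rhausdorff R) lim; rewrite limE in lt.
    have d0 : 0 < c * mass Y v w - \int[m]_t f t by rewrite subr_gt0.
    have /cvgrPdist_lt/(_ _ d0)[N _ hN] := lim.
    have [n Nn cn] := pc N.
    have := hN (size v + n)%N (leq_trans Nn (leq_addl _ _)).
    have := level_mass_ge n fc f0 f1 dF; have := ler_wpM2l (mass_ge0 Y0 v w) cn.
    rewrite /= distrC ltr_norml => h1 h2 /andP[_ h3].
    move: h1 h2 h3; rewrite [mass Y v w * c]mulrC.
    by move: (c * _) (_ * total _ _) (level_mass _ _ _ _) (\int[m]_t f t) => z1 z2 z3 z4; lra.
  apply: le_trans le_int _; have mJ : measurable (J j) by exact: measurable_itv.
  have fi : m.-integrable setT (EFin \o f).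
    by apply: (@bounded_integrable R m f 1) => // t; rewrite ger0_norm//; have /andP[] := f01 t.
  rewrite /Rintegral; apply: fine_le; rewrite ?fin_num_measure ?(integrable_fin_num _ fi)//.
  rewrite -[X in (_ <= m X)%E]setIT -integral_indic//; apply: ge0_le_integral => //.
  - by move=> t _; rewrite lee_fin.
  - exact: measurable_int fi.
  - by apply/measurable_EFinP; exact: measurable_indic.
  - by move=> t _; rewrite lee_fin; exact: fJ.
have IE : \bigcap_j J j = I.
  apply/seteqP; split=> t.
    move=> tJ; rewrite /I/= in_itv/=; apply/andP; split; rewrite leNgt; apply/negP.
      move=> /ltr_add_invr[k hk]; have := tJ k Logic.I; rewrite /J/= in_itv/= => /andP[+ _].
      by move: hk; move: (_^-1) => z; lra.
    move=> /ltr_add_invr[k hk]; have := tJ k Logic.I; rewrite /J/= in_itv/= => /andP[_].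
    by move: hk; rewrite /h; move: (k.+1%:R^-1) => z; lra.
  move=> + k _; rewrite /I /J/= !in_itv/= => /andP[t1 t2].
  have : 0 <= k.+1%:R^-1 :> R by rewrite invr_ge0.
  by rewrite /h; move: t1 t2; move: (k.+1%:R^-1) => z; move=> *; apply/andP; split; lra.
have mJ j : measurable (J j) by exact: measurable_itv.
have mI : measurable (\bigcap_j J j) by rewrite IE; exact: measurable_itv.
have Joo : (m (J 0%N) < +oo)%E by rewrite ltey_eq fin_num_measure.
have nJ : {homo J : n k / (n <= k)%N >-> (k <= n)%O}.
  move=> n k nk; apply/subsetPset => t; rewrite /J/= !in_itv/= => /andP[t1 t2].
  have : k.+1%:R^-1 <= n.+1%:R^-1 :> R by rewrite lef_pV2 ?posrE// ler_nat.
  by move: t1 t2; move: (k.+1%:R^-1) (n.+1%:R^-1) => z1 z2 *; apply/andP; split; lra.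
have cv := nonincreasing_cvg_mu Joo mJ mI nJ.
rewrite -IE -lee_fin fineK ?fin_num_measure// -(cvg_lim (@ereal_hausdorff R) cv).
apply: lime_ge; first by apply/cvg_ex; exists (m (\bigcap_j J j)).
by apply: nearW => j /=; rewrite -[m (J j)]fineK ?fin_num_measure// lee_fin.
Qed.

Lemma mass_not_extinct : (0 < m `[0%R, 1%R]%classic)%E -> ~ extinct root.
Proof.
move=> m0 ex.
have id1 (t : R) : 0 <= (cst 1 : R -> R) t <= 1 by rewrite /= ler01 lexx.
have c1 : continuous (cst 1 : R -> R) by move=> t; exact: cvg_cst.
have dF (t : R) : t \in `[0, 1] -> is_derive t 1 (@id R) ((cst 1 : R -> R) t) by move=> _; exact: is_derive_id.
have lim := weak_limit_nonneg Y0 Ym c1 id1 dF.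
have I0 : 0 < \int[m]_t (1 : R).
  rewrite Rintegral_cst// mul1r fine_gt0// ltey_eq fin_num_measure// andbT.
  apply: lt_le_trans m0 _; apply: le_measure; rewrite ?inE//; exact: measurable_itv.
have I20 : 0 < (\int[m]_t (1 : R)) / 2 by rewrite divr_gt0.
have /cvgrPdist_lt/(_ _ I20)[N _ hN] := lim.
apply: (extinctP ex I20) => M; exists (maxn N M); first exact: leq_maxr.
have := hN (maxn N M) (leq_maxl _ _); rewrite /= ltr_norml => /andP[_].
have -> : level_mass Y (maxn N M) (average id) w = total (maxn N M) root.
  rewrite /level_mass /total mulr_sumr big_seq [RHS]big_seq; apply: eq_bigr => u.
  rewrite mem_words => /eqP un; have [z _ ->] := average_mean u dF; rewrite /= mulr1 /mass un.
  by [].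
by move: (Rintegral _ _ _) (total _ _) => z1 z2; lra.
Qed.

End cell_mass.

Section dimension.
Context (R : realType) (g : R -> R * R) (x y dx dy ddx ddy : R -> R) (c : R).
Hypothesis A : regular_arc g x y dx dy ddx ddy c.
Variables (m : {finite_measure set R -> \bar R}) (gamma : {mfun R >-> (R * R)%type}).
Hypothesis gammaE : g = gamma.
Context d (T : measurableType d) (Y : seq bool -> T -> R) (w : T).
Hypothesis Y0 : forall v w, 0 <= Y v w.
Hypothesis Ym : weak_cvg (fun n => cascade_approx Y n w) m.

Let m01 := weak_limit_support Y0 Ym.

Lemma fourier_decay0 : fourier_decay (image_measure m gamma) 0.
Proof.
exists (2 * fine (m setT)), 0 => xi _; rewrite mul0r oppr0 powRr0 mulr1.
have b be : `|phase_integral x y m xi.1 xi.2 be| <= fine (m setT).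
  rewrite -[leRHS]mul1r; apply: (carried_bound m01); first exact: (continuous_phase A).
  by move=> t _; rewrite ler_norml cos_geN1 cos_le1.
apply: le_trans (fourier_le A m01 gammaE xi) _.
by rewrite mulr_natl mulr2n lerD.
Qed.

Lemma decay_bounded_growth (s t e : R) : 0 <= s <= 2 -> t < s -> 0 < e ->
  fourier_decay (image_measure m gamma) s -> bounded_growth t e (subtree Y [::] w).
Proof.
move=> s02 ts e0 dec; have [C C0 hC] := cap_mass_le A m01 gammaE s02 dec.
pose l := (s - t) * ln 2; have l0 : 0 < l by rewrite mulr_gt0 ?subr_gt0// ln_gt0// ltr1n.
(* Chosen so that [2 n + 1 <= D (1 + n l) <= D exp (n l)]: the loss from [s] to [t] pays for the
   polynomial factor. *)
pose D := 1 + 2 / l; have D0 : 0 <= D by rewrite addr_ge0// divr_ge0// ltW.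
exists (Num.truncn (C / e * D)).+1 => // v hv; apply: le_trans (ltW (truncnS_gt _)).
set n := size v; have n0 : 0 <= n%:R :> R by [].
have h1 := le_trans (cell_mass_ge Y0 Ym hv) (hC v); rewrite -/n in h1.
have h2 : mass Y v w <= C / e * ((2 * n).+1%:R * 2 `^ (- (n%:R * s))).
  by move: h1; rewrite -mulrA => h1; rewrite mulrAC ler_pdivlMr// [mass Y v w * e]mulrC.
apply: (@le_trans _ _ (2 `^ (n%:R * t) * (C / e * ((2 * n).+1%:R * 2 `^ (- (n%:R * s)))))).
  by rewrite ler_wpM2l ?powR_ge0//; exact: h2.
have -> : 2 `^ (n%:R * t) * (C / e * ((2 * n).+1%:R * 2 `^ (- (n%:R * s)))) =
  C / e * ((2 * n).+1%:R * (2 `^ (n%:R * t) * 2 `^ (- (n%:R * s)))) by ring.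
rewrite ler_wpM2l ?divr_ge0 ?(ltW e0)//.
have -> : 2 `^ (n%:R * t) * 2 `^ (- (n%:R * s)) = (expR (n%:R * l))^-1.
  rewrite -powRD ?pnatr_eq0 ?implybT// -expRN /powR pnatr_eq0/=; congr expR; rewrite /l; ring.
rewrite ler_pdivrMr ?expR_gt0//; apply: (@le_trans _ _ (D * (1 + n%:R * l))).
  rewrite -natr1 natrM /D; have -> : (1 + 2 / l) * (1 + n%:R * l) = 1 + n%:R * l + 2 / l + 2 * n%:R.
    by field; rewrite gt_eqF.
  have : 0 <= 2 / l by rewrite divr_ge0// ltW.
  have : 0 <= n%:R * l by rewrite mulr_ge0// ltW.
  by move: (n%:R * l) (2 / l) (2 * n%:R) => z1 z2 z3; lra.
by rewrite ler_wpM2l// expR_ge1Dx.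
Qed.

End dimension.

Lemma fourier_dim_eq (R : realType) (eta : {measure set (R * R)%type -> \bar R}) (A : R) :
  0 <= A <= 1 -> fourier_decay eta 0 -> (forall s, 0 < s < A -> fourier_decay eta s) ->
  (forall s, A < s -> s <= 2 -> ~ fourier_decay eta s) -> fourier_dim eta = A.
Proof.
move=> /andP[A0 A1] d0 dec nodec; rewrite /fourier_dim; set E := [set s | _].
have E0 : E 0 by split=> //; rewrite lexx ler0n.
have ub : ubound E A.
  by move=> s [/andP[s0 s2] ds]; rewrite leNgt; apply/negP => As; exact: (nodec s As s2 ds).
have hs : has_sup E by split; [exists 0|exists A].
have s0 : 0 <= sup E by apply: ub_le_sup => //; exists A.
apply/eqP; rewrite eq_le; apply/andP; split; first by apply: ge_sup => //; exists 0.
rewrite leNgt; apply/negP => lt; pose s := (sup E + A) / 2.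
have sA : 0 < s < A by rewrite /s; apply/andP; split; lra.
have : s <= sup E.
  apply: ub_le_sup; first by exists A.
  split; last exact: dec.
  by move: sA => /andP[? ?]; apply/andP; split; lra.
by rewrite /s; lra.
Qed.

Theorem theorem1p2 (R : realType)
    (d0 : measure_display) (T0 : measurableType d0) (P0 : probability T0 R)
    (W : {RV P0 >-> R})
    (d : measure_display) (T : measurableType d) (P : probability T R)
    (X : seq bool -> {RV P >-> R}) (mu : R.-ftker T ~> R)
    (gamma : {mfun R >-> (R * R)%type})
    (hW : minimal_Kahane_Peyriere P0 W)
    (hX : iid_copies W X)
    (hmu : is_cascade P X mu)
    (hgamma : nondegenerate_C2_arc gamma) :
  {ae P, forall w, (0 < mu w `[0%R, 1%R]%classic)%E ->
     fourier_dim (image_measure (mu w) gamma) = A_loc P0 W} /\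
  (0 < A_loc P0 W ->
   {ae P, forall w, (0 < mu w `[0%R, 1%R]%classic)%E ->
      forall s : R, 0 < s < A_loc P0 W ->
      exists C r : R, forall xi : R * R, r <= norm2 xi ->
        Normc.normc (fourier (image_measure (mu w) gamma) xi)
          <= C * norm2 xi `^ (- (s / 2))}).
Proof.
have decay := fourier_decay_all hW hX hmu hgamma.
split; last first.
  by move=> _; move: decay; apply: filterS => w dec _ s sA; exact: dec.
have iY := positive_weight_iid hX; have Y0 := positive_weight_ge0 X.
have [x [y [dx [dy [ddx [ddy [c A]]]]]]] := regular_arc_exists hgamma.
(* Countably many exponents decreasing to the endpoint, each with its own persistence constant, give
   one null set for all [s] above the endpoint. *)
have /choice[e he] : forall n, exists e, 0 < e /\ {ae P, forall w,
    ~ extinct (subtree (positive_weight X) [::] w) ->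
    ~ bounded_growth (A_loc P0 W + n.+1%:R^-1) e (subtree (positive_weight X) [::] w)}.
  move=> n; have An : A_loc P0 W < A_loc P0 W + n.+1%:R^-1 by rewrite ltrDl.
  by have [e e0 h] := unbounded_growth hW iY Y0 An; exists e.
have growth := ae_foralln (fun n => proj2 (he n)).
move: decay growth (weak_cvg_positive hW hX hmu); apply: filterS3 => w dec gr wk m0.
have nex := mass_not_extinct Y0 wk m0.
apply: fourier_dim_eq => [|||s As s2 ds].
- by rewrite (A_loc_ge0 hW) (A_loc_le1 hW).
- exact: (fourier_decay0 A (m := cascade_measure mu w) erefl Y0 wk).
- exact: dec.
have [n ns] := ltr_add_invr As.
apply: (gr n nex).
apply: (decay_bounded_growth A (m := cascade_measure mu w) (gamma := gamma) erefl Y0 wk _ ns (proj1 (he n)) ds).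
by rewrite s2 andbT (le_trans (A_loc_ge0 hW))// ltW.
Qed.
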